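(* Let $\omega=\sum_{i=1}^N\mathrm{d}p_i\wedge\mathrm{d}q^i$ be the canonical symplectic form on $T^*Q$, and let $\mathrm{d}$ denote the exterior derivative on a nondegenerate branch of boundary data $(a,b)$, with associated solutions $(\tilde q,\tilde p)$ of the rough Hamilton's equations satisfying $\tilde q_{t_0}=a$, $\tilde p_{t_1}=b$ (see context). Then the symplectic $2$-form is preserved along the solution at the boundary points $t=t_0,t_1$: $$\mathrm{d}\tilde p_{t_0}\wedge\mathrm{d}\tilde q_{t_0}=\mathrm{d}\tilde p_{t_1}\wedge\mathrm{d}\tilde q_{t_1}.$$ Furthermore, the rough Hamiltonian flow $\Phi_{t_1,t_0}$ satisfies $\Phi_{t_1,t_0}^*\omega=\omega$.
   Context: Let $\alpha\in(\frac13,\frac12]$ and let $\mathbf{Z}=(Z,\mathbb{Z})$ be a fixed geometric $\alpha$-Hölder rough path on $[t_0,t_1]$ with values in $\mathbb{R}^K$ (Chen's relation and $\mathbb{Z}_{s,t}+\mathbb{Z}_{s,t}^*=Z_{s,t}\otimes Z_{s,t}$). $T^*Q\cong\mathbb{R}^N\times\mathbb{R}^N$; $H\in C^\infty(T^*Q,\mathbb{R})$, $\mathcal{H}=(H_1,\dots,H_K)^T\in C^\infty(T^*Q,\mathbb{R}^K)$, $\mathcal{H}\,d\mathbf{Z}=\sum_jH_j\,d\mathbf{Z}^j$. The rough Hamilton's equations are $$q_t-q_{t_0}=\int_{t_0}^t\Big(\tfrac{\partial H}{\partial p}(q_r,p_r)\,dr+\tfrac{\partial\mathcal{H}}{\partial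 p}(q_r,p_r)\,d\mathbf{Z}_r\Big),\quad p_{t_1}-p_t=-\int_t^{t_1}\Big(\tfrac{\partial H}{\partial q}(q_r,p_r)\,dr+\tfrac{\partial\mathcal{H}}{\partial q}(q_r,p_r)\,d\mathbf{Z}_r\Big),$$ with rough integrals of paths controlled by $Z$; solutions are controlled paths whose Gubinelli derivatives are the coefficients of $d\mathbf{Z}$. $\Phi_{t,s}$ denotes their two-parameter (local) solution flow $(q_s,p_s)\mapsto(q_t,p_t)$, considered near the branch below, where it consists of local $C^\infty$-diffeomorphisms; $\pi_p(q,p)=p$. Standing assumption (nondegenerate branch): there is an open set of boundary data in $\mathbb{R}^N\times\mathbb{R}^N$ on which a branch of solutions $(\tilde q,\tilde p)=(\tilde q(a,b),\tilde p(a,b))$ on $[t_0,t_1]$ with $\tilde q_{t_0}=a$, $\tilde p_{t_1}=b$ exists, and the map $p_{t_0}\mapsto\pi_p\Phi_{t_1,t_0}(a,p_{t_0})$ is a local $C^\infty$-diffeomorphism near $\tilde p_{t_0}(a,b)$; along the branch $(\tilde q,\tilde p)$ is smooth in $(a,b)$. In the displayed identity $\tilde q_{t_i},\tilde p_{t_i}$ are viewed as functions of $(a,b)$ and summation over components is understood. *)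

(* Defs.v *)
From HB Require Import structures.
From mathcomp Require Import all_boot all_order all_algebra.
From mathcomp Require Import all_classical all_reals all_analysis.

Set Implicit Arguments.
Unset Strict Implicit.
Unset Printing Implicit Defensive.
Import Order.TTheory GRing.Theory Num.Theory.
Import numFieldNormedType.Exports.
Local Open Scope classical_set_scope.
Local Open Scope ring_scope.

(* T^*Q = R^N x R^N, a point being (q, p) *)
Notation phase R N := ('rV[R]_N * 'rV[R]_N)%type.

Section Smoothness.
Context {R : realType}.

(* In finite dimension, the only case used, continuity of every directional
   derivative x |-> 'd f x v amounts to continuity of x |-> 'd f x. *)
Fixpoint Ck_on (V W : normedModType R) (n : nat) (D : set V) (f : V -> W)
    : Prop :=
  match n with
  | 0 => forall x, D x -> {for x, continuous f}
  | n'.+1 => (forall x, D x -> differentiable f x) /\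
             (forall v : V, Ck_on n' D (fun x => 'd f x v : W))
  end.

Definition smooth_on (V W : normedModType R) (D : set V) (f : V -> W) : Prop :=
  forall n, Ck_on n D f.

Definition diffeo_on (V W : normedModType R) (D : set V) (f : V -> W) : Prop :=
  [/\ open D, open (f @` D), smooth_on D f &
    exists2 g : W -> V, smooth_on (f @` D) g & forall x, D x -> g (f x) = x].

Definition local_diffeo_at (V W : normedModType R) (f : V -> W) (x : V) : Prop :=
  exists2 D : set V, D x & diffeo_on D f.

End Smoothness.

(* Differential forms on V (0-forms are functions), evaluated on constant
   vectors: a k-form maps a base point and k vectors to a scalar. *)
Section Forms.
Context {R : realType}.

Definition ext_d (V : normedModType R) (f : V -> R) : V -> V -> R :=
  fun x v => 'd f x v.

Definition wedge (V : normedModType R) (a b : V -> V -> R) : V -> V -> V -> R :=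
  fun x v w => a x v * b x w - a x w * b x v.

Definition pullback (V W : normedModType R) (f : V -> W)
    (eta : W -> W -> W -> R) : V -> V -> V -> R :=
  fun x v w => eta (f x) ('d f x v) ('d f x w).

Definition dp_wedge_dq (N : nat) (V : normedModType R) (p q : V -> 'rV[R]_N)
    : V -> V -> V -> R :=
  fun x v w => \sum_(i < N)
    wedge (ext_d (fun y => p y 0 i)) (ext_d (fun y => q y 0 i)) x v w.

Definition omega (N : nat)
    : phase R N -> phase R N -> phase R N -> R :=
  dp_wedge_dq (fun x : phase R N => x.2) (fun x : phase R N => x.1).

End Forms.

Section RoughPaths.
Context {R : realType} (K : nat).
Variables (alpha t0 t1 : R).

Definition holder2 (W : normedModType R) (beta : R) (A : R -> R -> W) : Prop :=
  exists C : R, forall s t, t0 <= s -> s <= t -> t <= t1 ->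
    `|A s t| <= C * (t - s) `^ beta.

(* The tensor x (x) y of row vectors is the matrix x^T *m y, and
   ZZ s t i j stands for the iterated integral of Z^i against dZ^j. *)
Record geometric_rough_path (Z : R -> 'rV[R]_K) (ZZ : R -> R -> 'M[R]_K)
    : Prop := GeometricRoughPath {
  rough_path_holder1 : holder2 alpha (fun s t => Z t - Z s) ;
  rough_path_holder2 : holder2 (2 * alpha) ZZ ;
  rough_path_chen : forall s u t, t0 <= s -> s <= u -> u <= t -> t <= t1 ->
    ZZ s t = ZZ s u + ZZ u t + (Z u - Z s)^T *m (Z t - Z u) ;
  rough_path_geometric : forall s t, t0 <= s -> s <= t -> t <= t1 ->
    ZZ s t + (ZZ s t)^T = (Z t - Z s)^T *m (Z t - Z s)
}.

(* A Gubinelli derivative, with values in L(R^K, W), is given by its values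
   on the standard basis of R^K. *)
Definition controlled (Z : R -> 'rV[R]_K) (W : normedModType R)
    (Y : R -> W) (Y' : R -> 'I_K -> W) : Prop :=
  (forall k, holder2 alpha (fun s t => Y' t k - Y' s k)) /\
  holder2 (2 * alpha)
    (fun s t => Y t - Y s - \sum_(k < K) (Z t - Z s) 0 k *: Y' s k).

Definition compensated_sum (Z : R -> 'rV[R]_K) (ZZ : R -> R -> 'M[R]_K)
    (W : normedModType R) (Y : R -> 'I_K -> W) (Y' : R -> 'I_K -> 'I_K -> W)
    (s t : R) (P : seq R) : W :=
  let u := nth t (s :: P) in
  \sum_(0 <= n < size P)
    (\sum_(j < K) (Z (u n.+1) - Z (u n)) 0 j *: Y (u n) j +
     \sum_(k < K) \sum_(j < K) ZZ (u n) (u n.+1) k j *: Y' (u n) k j).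

(* I is the rough integral over [s, t] of \sum_j Y^j dZ^j, where Y' r k j is
   the k-th component of the Gubinelli derivative of Y^j at time r. *)
Definition is_rough_integral (Z : R -> 'rV[R]_K) (ZZ : R -> R -> 'M[R]_K)
    (W : normedModType R) (s t : R)
    (Y : R -> 'I_K -> W) (Y' : R -> 'I_K -> 'I_K -> W) (I : W) : Prop :=
  forall e : R, 0 < e -> exists2 d : R, 0 < d &
    forall P : seq R, itv_partition s t P ->
      (forall n, (n < size P)%N ->
         nth t (s :: P) n.+1 - nth t (s :: P) n < d) ->
      `|compensated_sum Z ZZ Y Y' s t P - I| < e.

End RoughPaths.

Section RoughHamilton.
Context {R : realType} (N K : nat).

Definition dHdq (F : phase R N -> R) (x : phase R N) : 'rV[R]_N :=
  \row_(i < N) 'D_((delta_mx 0 i, 0) : phase R N) F x.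

Definition dHdp (F : phase R N -> R) (x : phase R N) : 'rV[R]_N :=
  \row_(i < N) 'D_((0, delta_mx 0 i) : phase R N) F x.

Definition vec_integral (s t : R) (f : R -> 'rV[R]_N) : 'rV[R]_N :=
  \row_(i < N) (\int[lebesgue_measure]_(r in `[s, t]) f r 0 i)%R.

Variables (alpha t0 t1 : R) (Z : R -> 'rV[R]_K) (ZZ : R -> R -> 'M[R]_K).
Variables (H : phase R N -> R) (Hs : 'I_K -> phase R N -> R).

(* coefficients of dZ in the equations for (q, p) *)
Definition hamilton_gubinelli (x : R -> phase R N) (r : R) (k : 'I_K)
    : phase R N :=
  (dHdp (Hs k) (x r), - dHdq (Hs k) (x r)).

(* Rough integral over [s, t] of \sum_j f_j(x_r) dZ^j_r along a controlled path
   (x, x'); f_j(x) has the Gubinelli derivative Df_j(x) x'. *)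
Definition is_rough_integral_along (s t : R) (x : R -> phase R N)
    (x' : R -> 'I_K -> phase R N) (f : 'I_K -> phase R N -> 'rV[R]_N)
    (I : 'rV[R]_N) : Prop :=
  is_rough_integral Z ZZ s t (fun r j => f j (x r))
    (fun r k j => 'd (f j) (x r) (x' r k)) I.

Record rough_hamilton_solution (x : R -> phase R N) : Prop :=
  RoughHamiltonSolution {
  solution_controlled : controlled alpha t0 t1 Z x (hamilton_gubinelli x) ;
  solution_q : forall t, t0 <= t -> t <= t1 ->
    exists2 I : 'rV[R]_N,
      is_rough_integral_along t0 t x (hamilton_gubinelli x)
        (fun j => dHdp (Hs j)) I &
      (x t).1 - (x t0).1 = vec_integral t0 t (fun r => dHdp H (x r)) + I ;
  solution_p : forall t, t0 <= t -> t <= t1 ->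
    exists2 I : 'rV[R]_N,
      is_rough_integral_along t t1 x (hamilton_gubinelli x)
        (fun j => dHdq (Hs j)) I &
      (x t1).2 - (x t).2 = - (vec_integral t t1 (fun r => dHdq H (x r)) + I)
}.

(* Phi t s sends the value at time s of a solution to its value at time t;
   D is an open part of the domain of Phi _ s. Outside such sets the total
   function Phi is unconstrained. *)
Record local_flow_at (Phi : R -> R -> phase R N -> phase R N) (s : R)
    (D : set (phase R N)) : Prop := LocalFlowAt {
  flow_exists : forall x, D x ->
    rough_hamilton_solution (fun t => Phi t s x) /\ Phi s s x = x ;
  flow_unique : forall y, rough_hamilton_solution y -> D (y s) ->
    forall t, t0 <= t -> t <= t1 -> y t = Phi t s (y s) ;
  flow_diffeo : forall t, t0 <= t -> t <= t1 -> diffeo_on D (Phi t s)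
}.

Definition solution_flow_near_branch (Phi : R -> R -> phase R N -> phase R N)
    (U : set (phase R N)) (sol : phase R N -> R -> phase R N) : Prop :=
  forall ab, U ab -> forall s, t0 <= s -> s <= t1 ->
    exists2 D : set (phase R N), D (sol ab s) & local_flow_at Phi s D.

(* ab = (a, b) are the boundary data; sol ab is the solution on [t0, t1] with
   q-component a at time t0 and p-component b at time t1. *)
Record nondegenerate_branch (Phi : R -> R -> phase R N -> phase R N)
    (U : set (phase R N)) (sol : phase R N -> R -> phase R N) : Prop :=
  NondegenerateBranch {
  branch_open : open U ;
  branch_solution : forall ab, U ab -> rough_hamilton_solution (sol ab) ;
  branch_q0 : forall ab, U ab -> (sol ab t0).1 = ab.1 ;
  branch_p1 : forall ab, U ab -> (sol ab t1).2 = ab.2 ;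
  branch_smooth : forall t, t0 <= t -> t <= t1 ->
    smooth_on U (fun ab => sol ab t) ;
  branch_nondegenerate : forall ab, U ab ->
    local_diffeo_at (fun p : 'rV[R]_N => (Phi t1 t0 (ab.1, p)).2) (sol ab t0).2
}.

End RoughHamilton.

(* Main.v *)
Require Import Defs.
From HB Require Import structures.
From mathcomp Require Import all_boot all_order all_algebra.
From mathcomp Require Import all_classical all_reals all_analysis.
From mathcomp Require Import ring lra.
Import Order.TTheory GRing.Theory Num.Theory.
Import numFieldNormedType.Exports.
Set Implicit Arguments.
Unset Strict Implicit.
Unset Printing Implicit Defensive.
Local Open Scope classical_set_scope.
Local Open Scope ring_scope.

(** Write V_j for the Hamiltonian field of H_j, V_0 for that of H, omega for the
    canonical form and X_t = Phi_(t, t0) x for a solution started in the domain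
    of the flow.  The theorem says that omega (J_t v) (J_t w) does not depend
    on t, where J_t is the derivative of Phi_(t, t0) at x; both assertions
    follow from this, the one on boundary data because the branch is
    transported by the flow (uniqueness of solutions) and by the chain rule.

    Summation over repeated indices is understood.
    The quantity omega (J_t v) (J_t w) is constant as soon as its increments over
    [s, t] are bounded by C * (t - s) ^ (3 alpha), since 3 alpha > 1
    ([superlinear_constant]).  Such a bound comes from the second-order
    expansion of J
      J_t v = J_s v + Z^j DV_j J_s v + ZZ^(kj) D(DV_j V_k) J_s v
              + (t - s) DV_0 J_s v + O((t - s) ^ (3 alpha)),
    the derivatives being taken at X_s.  Inserting it in omega, the first-order
    terms cancel because DV_j is infinitesimally symplectic
    ([diff_field_sp]), and so does the drift.  In the second order
      omega (D(DV_j V_k) v) w + omega v (D(DV_j V_k) w)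
        = - omega (DV_k v) (DV_j w) - omega (DV_j v) (DV_k w)
    ([form_directional_sp]), so that what remains is
    Z^k Z^j - ZZ^(kj) - ZZ^(jk) paired with omega (DV_k v) (DV_j w), and this
    vanishes because the rough path is geometric ([form_second_order]).

    The expansion of J is the analytic part.  A solution satisfies an expansion
    of the same kind with some constant depending on the solution
    ([solution_davie]): the increments of a rough integral are compared with
    one term of its compensated sum by summing over dyadic partitions.  To
    differentiate in the initial condition, the constant has to be uniform.
    This is obtained from an a priori bound ([davie_bootstrap]): a path which
    has such an expansion with any finite constant has it, on a short interval,
    with a constant that depends only on bounds for the vector fields, because
    by Chen's relation cutting an interval at its midpoint reproduces the
    remainder up to a factor 2 * 2 ^ (- 3 alpha) < 1.  Applied to the pair
    (X, (Y - X) / eps), where Y starts at x + eps * v, it bounds the remainder of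
    the difference quotient uniformly in eps ([difference_bound]); the vector
    fields of this system, difference quotients of V_j, are controlled
    uniformly in eps by four-point Taylor estimates ([smooth_four_taylor],
    [quotient_field_tame]).  Letting eps tend to 0 for each pair of times
    separately gives the expansion of J ([flow_derivative_bound]): for given
    times the remainder is a smooth function of the initial condition. *)

(** * Powers of the time increment and the dyadic sewing bound *)

(** Turns a bound improved by a factor q at each application into its fixed
    point. *)
Lemma geometric_limit (R : realType) (x M D q : R) :
  0 <= q -> q < 1 -> (forall n, x <= M + D * q ^+ n) -> x <= M.
Proof.
move=> q0 q1 H.
have qc : (fun n => q ^+ n) @ \oo --> (0 : R) by apply: cvg_expr; rewrite ger0_norm.
have qc2 : (fun n => M + D * q ^+ n) @ \oo --> M + D * 0.
  by apply: cvgD; [exact: cvg_cst|apply: cvgM => //; exact: cvg_cst].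
rewrite mulr0 addr0 in qc2.
rewrite -(cvg_lim _ qc2) //.
by apply: limr_ge; [apply/cvg_ex; exists M|apply: nearW].
Qed.

Section Power.
Variables (R : realType) (alpha : R).
Hypothesis halpha : 3^-1 < alpha <= 2^-1.

(** The unit in which increments are measured: a rough path has size hpow at
    level one and hpow ^+ 2 at level two, and the sum of hpow ^+ 3
    over a partition tends to 0 with its mesh. *)
Definition hpow (tau : R) : R := tau `^ alpha.

Lemma alpha_gt0 : 0 < alpha.
Proof. by move: halpha; lra. Qed.

Lemma hpow_ge0 tau : 0 <= hpow tau.
Proof. exact: powR_ge0. Qed.

Lemma hpow0 : hpow 0 = 0.
Proof. by rewrite /hpow powR0// gt_eqF ?alpha_gt0. Qed.

Lemma hpow_le (s t : R) : 0 <= s -> s <= t -> hpow s <= hpow t.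
Proof.
move=> s0 st; apply: ge0_ler_powR => //; rewrite ?nnegrE ?(ltW alpha_gt0)//.
exact: le_trans st.
Qed.

Lemma hpow_le1 t : 0 <= t <= 1 -> hpow t <= 1.
Proof. by move=> /andP[t0 t1]; rewrite (le_trans (hpow_le t0 t1))// /hpow powR1. Qed.

Lemma hpow_sq tau : 0 <= tau -> tau `^ (2 * alpha) = hpow tau ^+ 2.
Proof. by move=> h; rewrite mulrC powRrM -powR_mulrn ?powR_ge0. Qed.

(** Since 2 alpha <= 1, the drift is of the order of the second level of the
    rough path. *)
Lemma le_hpow_sq tau : 0 <= tau <= 1 -> tau <= hpow tau ^+ 2.
Proof.
move=> /andP[]; rewrite le_eqVlt => /predU1P[<- _|t0 t1].
  by rewrite hpow0 expr0n.
rewrite -hpow_sq ?(ltW t0)//; apply: ger1_powR; first by rewrite t0.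
by move: halpha; lra.
Qed.

Definition half_hpow : R := hpow 2^-1.

Lemma hpow_half tau : 0 <= tau -> hpow (tau / 2) = half_hpow * hpow tau.
Proof. by move=> h; rewrite /half_hpow /hpow powRM// mulrC. Qed.

Definition sewing_ratio : R := 2 * half_hpow ^+ 3.

(** This is where 3 alpha > 1 enters: the two halves of an interval contribute
    less to a remainder of order 3 alpha than the whole interval. *)
Lemma sewing_ratio_lt1 : sewing_ratio < 1.
Proof.
rewrite /sewing_ratio /half_hpow /hpow -powR_mulrn ?powR_ge0// -powRrM.
suff : 2^-1 `^ (alpha * 3) < (2^-1 : R) by lra.
rewrite -[X in _ < X]powRr1 ?invr_ge0//.
rewrite /powR ifF; last by apply/negbTE; rewrite invr_neq0.
rewrite ifF; last by apply/negbTE; rewrite invr_neq0.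
rewrite ltr_expR mul1r; have : ln (2^-1 : R) < 0 by apply: ln_lt0; lra.
by move: halpha; nra.
Qed.

Lemma sewing_ratio_ge0 : 0 <= sewing_ratio.
Proof. by rewrite /sewing_ratio mulr_ge0// exprn_ge0// hpow_ge0. Qed.

Lemma hpow_small (e : R) : 0 < e -> exists h : R, [/\ 0 < h, h <= 1 & hpow h <= e].
Proof.
move=> e0; exists (Num.min 1 (e `^ alpha^-1)); split.
- by rewrite lt_min ltr01 powR_gt0.
- by rewrite ge_min lexx.
- apply: (@le_trans _ _ (hpow (e `^ alpha^-1))).
    by apply: hpow_le; [rewrite le_min ler01 powR_ge0|rewrite ge_min lexx orbT].
  by rewrite /hpow -powRrM mulVf ?gt_eqF ?alpha_gt0// powRr1// ltW.
Qed.

Lemma midpoint_hpow (c s t : R) : s <= t ->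
  c * hpow ((s + t) / 2 - s) ^+ 3 + c * hpow (t - (s + t) / 2) ^+ 3 =
  sewing_ratio * c * hpow (t - s) ^+ 3.
Proof.
move=> st; have -> : (s + t) / 2 - s = (t - s) / 2 by field.
have -> : t - (s + t) / 2 = (t - s) / 2 by field.
by rewrite hpow_half ?subr_ge0// /sewing_ratio; ring.
Qed.

(** The sewing lemma in contraction form.  Bisection turns a bound S into
    sewing_ratio * S plus the defect of additivity c + d * S; iterating from any
    finite bound leads to the fixed point, which does not depend on it.  The
    term d * S allows the defect to depend on the quantity being estimated. *)
Lemma sewing_bound (rho : R -> R -> R) (a b C0 c d : R) :
  0 <= C0 -> 0 <= c -> 0 <= d -> sewing_ratio + d < 1 ->
  (forall s t, a <= s -> s <= t -> t <= b -> rho s t <= C0 * hpow (t - s) ^+ 3) ->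
  (forall S, 0 <= S ->
    (forall s t, a <= s -> s <= t -> t <= b -> rho s t <= S * hpow (t - s) ^+ 3) ->
    forall s t, a <= s -> s <= t -> t <= b ->
    rho s t <= rho s ((s + t) / 2) + rho ((s + t) / 2) t
               + (c + d * S) * hpow (t - s) ^+ 3) ->
  forall s t, a <= s -> s <= t -> t <= b ->
    rho s t <= c / (1 - sewing_ratio - d) * hpow (t - s) ^+ 3.
Proof.
move=> C00 c0 d0 thd H0 Hstep s t as_ st tb.
set M := c / (1 - sewing_ratio - d).
have den : 0 < 1 - sewing_ratio - d by lra.
have M0 : 0 <= M by rewrite divr_ge0// ltW.
have ME : c = M * (1 - sewing_ratio - d) by rewrite /M divfK// gt_eqF.
set q := sewing_ratio + d.
have q0 : 0 <= q by rewrite addr_ge0// sewing_ratio_ge0.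
have Hn n : forall s t, a <= s -> s <= t -> t <= b ->
    rho s t <= (M + C0 * q ^+ n) * hpow (t - s) ^+ 3.
  elim: n => [|n IH] {}s {}t {}as_ {}st {}tb.
    rewrite expr0 mulr1; apply: le_trans (H0 _ _ as_ st tb) _.
    by apply: ler_wpM2r; [rewrite exprn_ge0// hpow_ge0|lra].
  have Sn : 0 <= M + C0 * q ^+ n by rewrite addr_ge0// mulr_ge0// exprn_ge0.
  apply: le_trans (Hstep _ Sn IH s t as_ st tb) _.
  have m1 : s <= (s + t) / 2 by lra.
  have m2 : (s + t) / 2 <= t by lra.
  have h1 := IH _ _ as_ m1 (le_trans m2 tb).
  have h2 := IH _ _ (le_trans as_ m1) m2 tb.
  apply: (le_trans (lerD (lerD h1 h2) (lexx _))).
  rewrite midpoint_hpow// -mulrDl; apply: ler_wpM2r; first by rewrite exprn_ge0// hpow_ge0.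
  by rewrite ME exprS /q le_eqVlt; apply/orP; left; apply/eqP; ring.
apply: (@geometric_limit _ _ _ (C0 * hpow (t - s) ^+ 3) q) => // n.
by apply: le_trans (Hn n s t as_ st tb) _; rewrite le_eqVlt; apply/orP; left; apply/eqP; ring.
Qed.

End Power.

(** * Germs of rough integrals and the a priori bound for expansions *)

Lemma ler_norm_sum_const (R : realType) (W : normedModType R) (K : nat)
    (F : 'I_K -> W) (C : R) :
  (forall i, `|F i| <= C) -> `|\sum_i F i| <= K%:R * C.
Proof.
move=> H; apply: le_trans (ler_norm_sum _ _ _) _.
apply: le_trans (ler_sum _ (fun i _ => H i)) _.
by rewrite sumr_const card_ord mulr_natl.
Qed.

(** One square dominates the polynomial factors of the defect estimate below. *)
Lemma sqr_dominates (R : realType) (b L : R) : 0 <= b -> 0 <= L ->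
  [/\ 1 <= (b + L + 1) ^+ 2, b <= (b + L + 1) ^+ 2,
      b ^+ 2 + b <= (b + L + 1) ^+ 2 & b + L + 1 <= (b + L + 1) ^+ 2].
Proof.
move=> b0 L0; have b2 := sqr_ge0 b; have L2 := sqr_ge0 L; have bL := mulr_ge0 b0 L0.
by split; lra.
Qed.

Section Germ.
Variables (R : realType) (K : nat).
Variables (alpha t0 t1 : R) (Z : R -> 'rV[R]_K) (ZZ : R -> R -> 'M[R]_K).
Hypothesis halpha : 3^-1 < alpha <= 2^-1.

(** One term of the compensated Riemann sum. *)
Definition germ (W : normedModType R) (Y : R -> 'I_K -> W)
    (Y' : R -> 'I_K -> 'I_K -> W) (s t : R) : W :=
  \sum_(j < K) (Z t - Z s) 0 j *: Y s j +
  \sum_(k < K) \sum_(j < K) ZZ s t k j *: Y' s k j.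

Definition rough_path_bound (CZ : R) : Prop :=
  forall s t, t0 <= s -> s <= t -> t <= t1 ->
    (forall j, `|(Z t - Z s) 0 j| <= CZ * hpow alpha (t - s)) /\
    (forall k j, `|ZZ s t k j| <= CZ * hpow alpha (t - s) ^+ 2).

Definition chen : Prop := forall s u t, t0 <= s -> s <= u -> u <= t -> t <= t1 ->
  forall k j, ZZ s t k j = ZZ s u k j + ZZ u t k j + (Z u - Z s) 0 k * (Z t - Z u) 0 j.

(** Chen's relation moves the defect of additivity of a germ entirely into the
    increments of the integrand and of its Gubinelli derivative. *)
Lemma germ_chen (W : normedModType R) (Y : R -> 'I_K -> W)
    (Y' : R -> 'I_K -> 'I_K -> W) (hchen : chen) (s u t : R) :
  t0 <= s -> s <= u -> u <= t -> t <= t1 ->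
  germ Y Y' s t - germ Y Y' s u - germ Y Y' u t =
  - (\sum_(j < K) (Z t - Z u) 0 j *: (Y u j - Y s j
        - \sum_(k < K) (Z u - Z s) 0 k *: Y' s k j) +
     \sum_(k < K) \sum_(j < K) ZZ u t k j *: (Y' u k j - Y' s k j)).
Proof.
move=> h1 h2 h3 h4.
have e1 : \sum_(j < K) (Z t - Z s) 0 j *: Y s j =
   \sum_(j < K) (Z u - Z s) 0 j *: Y s j + \sum_(j < K) (Z t - Z u) 0 j *: Y s j.
  rewrite -big_split /=; apply: eq_bigr => j _; rewrite -scalerDl; congr (_ *: _).
  by rewrite !mxE; ring.
have e2 : \sum_(k < K) \sum_(j < K) ZZ s t k j *: Y' s k j =
   \sum_(k < K) \sum_(j < K) ZZ s u k j *: Y' s k j +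
   \sum_(k < K) \sum_(j < K) ZZ u t k j *: Y' s k j +
   \sum_(j < K) (Z t - Z u) 0 j *: \sum_(k < K) (Z u - Z s) 0 k *: Y' s k j.
  have -> : \sum_(j < K) (Z t - Z u) 0 j *: (\sum_(k < K) (Z u - Z s) 0 k *: Y' s k j)
     = \sum_(k < K) \sum_(j < K) ((Z u - Z s) 0 k * (Z t - Z u) 0 j) *: Y' s k j.
    rewrite exchange_big /=; apply: eq_bigr => j _; rewrite scaler_sumr.
    by apply: eq_bigr => k _; rewrite scalerA mulrC.
  rewrite -!big_split /=; apply: eq_bigr => k _; rewrite -!big_split /=.
  by apply: eq_bigr => j _; rewrite -!scalerDl (hchen s u t).
rewrite /germ e1 e2.
have -> : \sum_(j < K) (Z t - Z u) 0 j *: (Y u j - Y s j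
        - \sum_(k < K) (Z u - Z s) 0 k *: Y' s k j) =
   \sum_(j < K) (Z t - Z u) 0 j *: Y u j - \sum_(j < K) (Z t - Z u) 0 j *: Y s j
   - \sum_(j < K) (Z t - Z u) 0 j *: (\sum_(k < K) (Z u - Z s) 0 k *: Y' s k j).
  by rewrite -!sumrB; apply: eq_bigr => j _; rewrite !scalerBr.
have -> : \sum_(k < K) \sum_(j < K) ZZ u t k j *: (Y' u k j - Y' s k j) =
   \sum_(k < K) \sum_(j < K) ZZ u t k j *: Y' u k j -
   \sum_(k < K) \sum_(j < K) ZZ u t k j *: Y' s k j.
  rewrite -!sumrB; apply: eq_bigr => k _; rewrite -!sumrB.
  by apply: eq_bigr => j _; rewrite !scalerBr.
set a := \sum_j _; set b := \sum_j _; set c := \sum_k _; set d := \sum_k _.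
set e := \sum_j _; set f := \sum_j _; set g := \sum_k _.
rewrite [a + b + _](AC (2*(2*1)) ((2*4*5)*(1*3))) addrK -[LHS]opprB.
by congr (- _); rewrite !opprD !addrA (AC (2*1*1*1) (1*3*5*2*4)).
Qed.

Lemma le_germ (W : normedModType R) (Y : R -> 'I_K -> W)
    (Y' : R -> 'I_K -> 'I_K -> W) (CZ L s t : R) :
  0 <= CZ -> 0 <= L -> rough_path_bound CZ ->
  t0 <= s -> s <= t -> t <= t1 ->
  (forall j, `|Y s j| <= L) -> (forall k j, `|Y' s k j| <= L) ->
  `|\sum_(j < K) (Z t - Z s) 0 j *: Y s j| <= K%:R * (CZ * L) * hpow alpha (t - s) /\
  `|\sum_(k < K) \sum_(j < K) ZZ s t k j *: Y' s k j|
    <= K%:R * K%:R * (CZ * L) * hpow alpha (t - s) ^+ 2.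
Proof.
move=> CZ0 L0 hb h1 h2 h3 hY hY'; have [b1 b2] := hb s t h1 h2 h3.
have p0 := hpow_ge0 alpha (t - s); split.
  rewrite -mulrA; apply: ler_norm_sum_const => j; rewrite normrZ mulrAC.
  by apply: ler_pM.
rewrite -!mulrA; apply: ler_norm_sum_const => k.
apply: ler_norm_sum_const => j; rewrite normrZ [L * _]mulrC mulrA.
by apply: ler_pM.
Qed.

Lemma le_germ_delta (W : normedModType R) (Y : R -> 'I_K -> W)
    (Y' : R -> 'I_K -> 'I_K -> W) (CZ A s u t : R) :
  chen -> 0 <= CZ -> 0 <= A -> rough_path_bound CZ ->
  t0 <= s -> s <= u -> u <= t -> t <= t1 ->
  (forall j, `|Y u j - Y s j - \sum_(k < K) (Z u - Z s) 0 k *: Y' s k j|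
     <= A * hpow alpha (t - s) ^+ 2) ->
  (forall k j, `|Y' u k j - Y' s k j| <= A * hpow alpha (t - s)) ->
  `|germ Y Y' s t - germ Y Y' s u - germ Y Y' u t|
    <= K%:R * (1 + K%:R) * CZ * A * hpow alpha (t - s) ^+ 3.
Proof.
move=> hc CZ0 A0 hb h1 h2 h3 h4 hY hY'; rewrite germ_chen// normrN.
have [b1 b2] := hb u t (le_trans h1 h2) h3 h4.
have p0 := hpow_ge0 alpha (t - u).
have pp : hpow alpha (t - u) <= hpow alpha (t - s).
  by apply: hpow_le => //; [rewrite subr_ge0|rewrite lerB].
set p := hpow alpha (t - s) in pp hY hY' *.
apply: le_trans (ler_normD _ _) _.
have -> : K%:R * (1 + K%:R) * CZ * A * p ^+ 3 =
  K%:R * (CZ * p * (A * p ^+ 2)) + K%:R * (K%:R * (CZ * p ^+ 2 * (A * p))) by ring.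
apply: lerD.
  apply: ler_norm_sum_const => j; rewrite normrZ; apply: ler_pM => //.
  by apply: le_trans (b1 j) _; apply: ler_wpM2l.
apply: ler_norm_sum_const => k; apply: ler_norm_sum_const => j.
rewrite normrZ; apply: ler_pM => //.
apply: le_trans (b2 k j) _; apply: ler_wpM2l => //.
by apply: lerXn2r => //; rewrite nnegrE ?(le_trans p0).
Qed.

(** Remainder of the second-order expansion (Davie's scheme) of a solution of
    dx = V_0 (x) dt + V_j (x) dZ^j, where F k j stands for DV_j V_k. *)
Definition davie_rem (W : normedModType R) (V : 'I_K -> W -> W)
    (F : 'I_K -> 'I_K -> W -> W) (V0 : W -> W) (x : R -> W) (s t : R) : W :=
  x t - x s - (germ (fun r j => V j (x r)) (fun r k j => F k j (x r)) s t
               + (t - s) *: V0 (x s)).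

(** What the a priori bound uses of the vector fields.  The last clause is Taylor's
    formula composed with the chain rule F k j = DV_j V_k; having it for
    arbitrary z avoids mentioning DV_j, so that the same record covers the
    difference-quotient fields uniformly in their parameter. *)
Record tame (W : normedModType R) (L : R) (B : set W) (V : 'I_K -> W -> W)
    (F : 'I_K -> 'I_K -> W -> W) (V0 : W -> W) : Prop := Tame {
  tame_diam : forall x y, B x -> B y -> `|y - x| <= L ;
  tame_V : forall j x, B x -> `|V j x| <= L ;
  tame_F : forall k j x, B x -> `|F k j x| <= L ;
  tame_V0 : forall x, B x -> `|V0 x| <= L ;
  tame_lipF : forall k j x y, B x -> B y -> `|F k j y - F k j x| <= L * `|y - x| ;
  tame_lipV0 : forall x y, B x -> B y -> `|V0 y - V0 x| <= L * `|y - x| ;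
  tame_taylor : forall j x y (z : 'I_K -> R), B x -> B y ->
    `|V j y - V j x - \sum_(k < K) z k *: F k j x|
      <= L * (`|y - x| ^+ 2 + `|y - x - \sum_(k < K) z k *: V k x|)
}.

Section Bootstrap.
Variables (CZ L : R).
Hypotheses (CZ0 : 0 <= CZ) (L0 : 0 <= L) (hb : rough_path_bound CZ) (hc : chen).

Definition increment_const : R := L * (1 + K%:R * CZ + K%:R * K%:R * CZ).
Definition square_const : R := (increment_const + L + 1) ^+ 2.
Definition defect_const : R := (1 + K%:R * (1 + K%:R) * CZ) * (L * square_const).
Definition davie_const : R := increment_const + 2 * defect_const / (1 - sewing_ratio alpha).

Lemma increment_const_ge0 : 0 <= increment_const.
Proof. by rewrite mulr_ge0// !addr_ge0// !mulr_ge0. Qed.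

Lemma defect_const_ge0 : 0 <= defect_const.
Proof.
apply: mulr_ge0; last by rewrite mulr_ge0// sqr_ge0.
by rewrite addr_ge0// !mulr_ge0// addr_ge0.
Qed.

Lemma davie_const_ge0 : 0 <= davie_const.
Proof.
apply: addr_ge0; first exact: increment_const_ge0.
apply: divr_ge0; first by apply: mulr_ge0 => //; exact: defect_const_ge0.
by rewrite subr_ge0 ltW// sewing_ratio_lt1.
Qed.

Variables (W : normedModType R) (B : set W) (V : 'I_K -> W -> W).
Variables (F : 'I_K -> 'I_K -> W -> W) (V0 : W -> W).
Hypothesis hT : tame L B V F V0.

Local Notation Rem := (davie_rem V F V0).

(** Reads the first-order structure of a path off its second-order expansion. *)
Lemma tame_increment (x : R -> W) (s t : R) :
  t0 <= s -> s <= t -> t <= t1 -> t - s <= 1 -> B (x s) ->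
  `|x t - x s - \sum_(k < K) (Z t - Z s) 0 k *: V k (x s)|
     <= increment_const * hpow alpha (t - s) ^+ 2 + `|Rem x s t| /\
  `|x t - x s| <= increment_const * hpow alpha (t - s) + `|Rem x s t|.
Proof.
move=> h1 h2 h3 h4 Bs.
have [g1 g2] := @le_germ W (fun r j => V j (x r)) (fun r k j => F k j (x r))
  CZ L s t CZ0 L0 hb h1 h2 h3 (fun j => tame_V hT j Bs)
  (fun k j => tame_F hT k j Bs).
have st : 0 <= t - s <= 1 by rewrite subr_ge0 h2.
have p0 := hpow_ge0 alpha (t - s).
have p1 := hpow_le1 halpha st.
have tp := le_hpow_sq halpha st.
set p := hpow alpha (t - s) in p0 p1 tp g1 g2 *.
have g3 : `|(t - s) *: V0 (x s)| <= L * p ^+ 2.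
  rewrite normrZ mulrC ger0_norm ?subr_ge0//; apply: ler_pM => //.
    by rewrite subr_ge0.
  exact: tame_V0 hT _ Bs.
move: g1 g2 g3; set G1 := \sum_j _; set G2 := \sum_k _; set G3 := _ *: V0 _.
move=> g1 g2 g3.
have nK : 0 <= K%:R :> R by [].
have e1 : x t - x s - \sum_(k < K) (Z t - Z s) 0 k *: V k (x s) = Rem x s t + (G2 + G3).
  by rewrite /davie_rem /germ -/G1 -/G2 -/G3 -(addrA G1) opprD (addrA (x t - x s)) addrNK.
have e2 : x t - x s = Rem x s t + (G1 + (G2 + G3)).
  by rewrite addrCA addrC -e1 addrNK.
split.
  rewrite e1 addrC; apply: le_trans (ler_normD _ _) _; rewrite lerD2r.
  apply: le_trans (ler_normD _ _) _.
  have : 0 <= K%:R * CZ * L * p ^+ 2 by rewrite !mulr_ge0// exprn_ge0.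
  by rewrite /increment_const; lra.
rewrite e2 addrC; apply: le_trans (ler_normD _ _) _; rewrite lerD2r.
apply: le_trans (ler_normD _ _) _.
have := ler_normD G2 G3.
have : p ^+ 2 <= p by rewrite expr2 ler_piMr.
have KL : 0 <= K%:R * K%:R * CZ * L by rewrite !mulr_ge0.
move=> p2; have := ler_wpM2l KL p2; have := ler_wpM2l L0 p2.
by rewrite /increment_const; lra.
Qed.

(** The increment of x is quadratic in Taylor's formula, which would make the
    defect quadratic in the unknown bound S.  It is kept linear by using the
    diameter bound of the set B for one of the two factors. *)
Lemma tame_rem_delta (q S : R) (x : R -> W) (s u t : R) :
  0 <= q -> 0 <= S ->
  t0 <= s -> s <= u -> u <= t -> t <= t1 -> t - s <= 1 -> hpow alpha (t - s) <= q ->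
  B (x s) -> B (x u) -> `|Rem x s u| <= S * hpow alpha (u - s) ^+ 3 ->
  `|Rem x s t| <= `|Rem x s u| + `|Rem x u t|
      + (defect_const + defect_const * q * S) * hpow alpha (t - s) ^+ 3.
Proof.
move=> q0 S0 h1 h2 h3 h4 h5 pq Bs Bu hS; have Lge0 := L0.
have ut1 : u <= t1 := le_trans h3 h4.
have st : 0 <= t - s <= 1 by rewrite subr_ge0 (le_trans h2).
have us : 0 <= u - s <= 1 by move: h5; rewrite subr_ge0 h2; lra.
have p0 := hpow_ge0 alpha (t - s).
have p1 := hpow_le1 halpha st.
have tp := le_hpow_sq halpha st.
have [d1 d2] := tame_increment h1 h2 ut1 (proj2 (andP us)) Bs.
have pu0 := hpow_ge0 alpha (u - s).
have pup : hpow alpha (u - s) <= hpow alpha (t - s).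
  by apply: hpow_le => //; [lra|rewrite lerB].
have diam := tame_diam hT Bs Bu.
set p := hpow alpha (t - s) in p0 p1 tp pq pup *.
set pu := hpow alpha (u - s) in pu0 pup d1 d2 hS *.
set r := `|Rem x s u| in d1 d2 hS *.
have r0 : 0 <= r by exact: normr_ge0.
have rS : r <= q * S * p ^+ 2.
  apply: le_trans hS _; rewrite [q * S]mulrC -mulrA; apply: ler_wpM2l => //.
  rewrite exprS; apply: ler_pM => //; first by rewrite exprn_ge0.
    exact: le_trans pq.
  by apply: lerXn2r => //; rewrite nnegrE.
have pp : p ^+ 2 <= p by rewrite expr2 ler_piMr.
have b10 := increment_const_ge0.
have D2 : `|x u - x s| <= increment_const * p + r.
  by apply: le_trans d2 _; rewrite lerD2r ler_wpM2l.
have D1 : `|x u - x s - \sum_(k < K) (Z u - Z s) 0 k *: V k (x s)| <= increment_const * p ^+ 2 + r.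
  apply: le_trans d1 _; rewrite lerD2r ler_wpM2l//.
  by apply: lerXn2r => //; rewrite nnegrE.
pose A := L * square_const * (1 + q * S).
have qS0 : 0 <= q * S by exact: mulr_ge0.
have [b20 b21 b22 b23] : [/\ 1 <= square_const, increment_const <= square_const,
    increment_const ^+ 2 + increment_const <= square_const & increment_const + L + 1 <= square_const].
  exact: (sqr_dominates b10 L0).
have Lb2 : 0 <= L * square_const by rewrite mulr_ge0// (le_trans ler01).
have A0 : 0 <= A by rewrite mulr_ge0// addr_ge0.
have lip : `|x u - x s| <= square_const * (1 + q * S) * p.
  have : q * S * p ^+ 2 <= q * S * p by exact: ler_wpM2l.
  move=> hq; apply: le_trans D2 _.
  have : increment_const * p <= square_const * p by rewrite ler_wpM2r.
  have : q * S * p <= square_const * (q * S * p) by rewrite ler_peMl// mulr_ge0.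
  lra.
have tay j : `|V j (x u) - V j (x s) - \sum_(k < K) (Z u - Z s) 0 k *: F k j (x s)|
     <= A * p ^+ 2.
  apply: le_trans (tame_taylor hT j (fun k => (Z u - Z s) 0 k) Bs Bu) _.
  rewrite /A -2!mulrA; apply: ler_wpM2l => //.
  (* one factor is bounded by the first-order expansion, the other by L *)
  have sq : `|x u - x s| ^+ 2 <= increment_const ^+ 2 * p ^+ 2 + (increment_const + L) * r.
    have dx0 := normr_ge0 (x u - x s).
    have i1 : `|x u - x s| * `|x u - x s| <= `|x u - x s| * (increment_const * p + r).
      by apply: ler_wpM2l.
    have i2 : increment_const * p * `|x u - x s| <= increment_const * p * (increment_const * p + r).
      by apply: ler_wpM2l => //; rewrite mulr_ge0.
    have i3 : r * `|x u - x s| <= r * L by apply: ler_wpM2l.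
    have i4 : increment_const * r * p <= increment_const * r by rewrite ler_piMr// mulr_ge0.
    lra.
  apply: le_trans (lerD sq D1) _.
  have i5 : (increment_const + L + 1) * r <= (increment_const + L + 1) * (q * S * p ^+ 2).
    by apply: ler_wpM2l => //; lra.
  have p20 : 0 <= p ^+ 2 by rewrite exprn_ge0.
  have i6 : (increment_const + L + 1) * (q * S * p ^+ 2) <= square_const * (q * S * p ^+ 2).
    apply: ler_wpM2r; first by rewrite mulr_ge0.
    exact: b23.
  have i7 : (increment_const ^+ 2 + increment_const) * p ^+ 2 <= square_const * p ^+ 2.
    by apply: ler_wpM2r.
  lra.
have dG := @le_germ_delta W (fun r j => V j (x r)) (fun r k j => F k j (x r))
  CZ A s u t hc CZ0 A0 hb h1 h2 h3 h4 tay.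
have {}dG := dG _.
set g := germ _ _ in dG.
have lipF k j : `|F k j (x u) - F k j (x s)| <= A * p.
  apply: le_trans (tame_lipF hT k j Bs Bu) _.
  by rewrite /A -2!mulrA; apply: ler_wpM2l => //; rewrite mulrA.
have {}dG := dG lipF.
have drift : `|(t - u) *: (V0 (x u) - V0 (x s))| <= A * p ^+ 3.
  rewrite normrZ ger0_norm ?subr_ge0//.
  have -> : A * p ^+ 3 = p ^+ 2 * (A * p) by ring.
  apply: ler_pM => //; first by rewrite subr_ge0.
    by apply: le_trans tp; rewrite lerB.
  apply: le_trans (tame_lipV0 hT Bs Bu) _.
  by rewrite /A -2!mulrA; apply: ler_wpM2l => //; rewrite mulrA.
have -> : Rem x s t = Rem x s u + Rem x u t -
   ((g s t - g s u - g u t) - (t - u) *: (V0 (x u) - V0 (x s))).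
  rewrite /davie_rem -/g.
  have -> : (t - s) *: V0 (x s) = (t - u) *: V0 (x s) + (u - s) *: V0 (x s).
    by rewrite -scalerDl addrA addrNK.
  rewrite scalerBr.
  set v1 := (t - u) *: V0 (x s); set v2 := (u - s) *: V0 (x s).
  set v3 := (t - u) *: V0 (x u).
  have -> : x t - x s = x u - x s + (x t - x u) by rewrite [RHS]addrC addrA addrNK.
  rewrite [in RHS](addrACA (x u - x s)) -[in RHS]opprD -[RHS]addrA -[in RHS]opprD.
  congr (_ - _); rewrite opprB [in RHS]addrA.
  rewrite [RHS](AC (2*2*3*2) ((5*(8*2))*((1*6)*((3*7)*(4*9))))) /=.
  by rewrite !subrr !addr0.
apply: le_trans (ler_normB _ _) _; apply: lerD; first exact: ler_normD.
apply: le_trans (ler_normB _ _) _.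
apply: le_trans (lerD dG drift) _.
rewrite -/p /defect_const /A; move: square_const => b2.
by rewrite le_eqVlt; apply/orP; left; apply/eqP; ring.
Qed.


(** The finite constant C0 of the hypothesis is forgotten in the conclusion.  The
    interval is short enough for the part of the defect proportional to the
    unknown bound to be absorbed by the contraction. *)
Lemma davie_bootstrap (q a b C0 : R) (x : R -> W) :
  0 <= q -> defect_const * q <= (1 - sewing_ratio alpha) / 2 ->
  t0 <= a -> b <= t1 -> b - a <= 1 -> hpow alpha (b - a) <= q -> 0 <= C0 ->
  (forall s, a <= s -> s <= b -> B (x s)) ->
  (forall s t, a <= s -> s <= t -> t <= b ->
     `|Rem x s t| <= C0 * hpow alpha (t - s) ^+ 3) ->
  forall s t, a <= s -> s <= t -> t <= b ->
    `|Rem x s t| <= davie_const * hpow alpha (t - s) ^+ 3 /\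
    `|x t - x s| <= davie_const * hpow alpha (t - s).
Proof.
move=> q0 hq ta bt ba1 pq C00 hB hC s t as_ st tb.
have th1 := sewing_ratio_lt1 halpha.
have b10 := increment_const_ge0; have b30 := defect_const_ge0.
have den : 0 < 1 - sewing_ratio alpha by lra.
have key : forall s t, a <= s -> s <= t -> t <= b ->
    `|Rem x s t| <= defect_const / (1 - sewing_ratio alpha - defect_const * q) * hpow alpha (t - s) ^+ 3.
  apply: (@sewing_bound R alpha (fun s t => `|Rem x s t|) a b C0) => //.
  - by rewrite mulr_ge0.
  - by lra.
  - move=> S S0 hS {}s {}t {}as_ {}st {}tb.
    have m1 : s <= (s + t) / 2 by lra.
    have m2 : (s + t) / 2 <= t by lra.
    apply: tame_rem_delta => //.
    + exact: le_trans as_.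
    + exact: le_trans bt.
    + by lra.
    + by apply: le_trans pq; apply: hpow_le => //; lra.
    + by apply: hB => //; lra.
    + by apply: hB; lra.
    + by apply: hS => //; lra.
have M0 : defect_const / (1 - sewing_ratio alpha - defect_const * q)
    <= 2 * defect_const / (1 - sewing_ratio alpha).
  rewrite [2 * _]mulrC -[X in _ <= X]mulrA; apply: ler_wpM2l => //.
  rewrite -[X in _ <= X]invrK lef_pV2 ?posrE ?invr_gt0 ?divr_gt0//; last by lra.
  by rewrite invf_div; lra.
have st1 : 0 <= t - s <= 1 by rewrite subr_ge0 st; lra.
have p0 := hpow_ge0 alpha (t - s); have p1 := hpow_le1 halpha st1.
have K1 := key s t as_ st tb.
have M1 : 2 * defect_const / (1 - sewing_ratio alpha) <= davie_const by rewrite lerDr.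
have p30 : 0 <= hpow alpha (t - s) ^+ 3 by rewrite exprn_ge0.
have K2 : `|Rem x s t| <= 2 * defect_const / (1 - sewing_ratio alpha) * hpow alpha (t - s) ^+ 3.
  by apply: le_trans K1 _; rewrite ler_wpM2r.
split; first by apply: le_trans K2 _; rewrite ler_wpM2r.
have Bs : B (x s) by apply: hB => //; lra.
have [_ i] := tame_increment (le_trans ta as_) st (le_trans tb bt) (proj2 (andP st1)) Bs.
apply: le_trans i _; rewrite /davie_const mulrDl lerD2l.
apply: le_trans K2 _; apply: ler_wpM2l.
  by apply: divr_ge0; [apply: mulr_ge0|exact: ltW].
by rewrite exprS; apply: ler_piMr => //; apply: exprn_ile1.
Qed.

End Bootstrap.

End Germ.

(** * Taylor estimates for smooth functions on balls *)

Section Smooth.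
Variables (R : realType) (E : normedModType R).
Implicit Types (g f : E -> R).

Lemma Ck_on_pred (W : normedModType R) n (D : set E) (f : E -> W) :
  Ck_on n.+1 D f -> Ck_on n D f.
Proof.
elim: n f => [|n IH] f [h1 h2] /=.
  by move=> x Dx; apply: differentiable_continuous; exact: h1.
by split => // v; apply: IH; exact: h2.
Qed.

Lemma smooth_differentiable (W : normedModType R) (D : set E) (f : E -> W) x :
  smooth_on D f -> D x -> differentiable f x.
Proof. by move=> /(_ 1) [h _] Dx; exact: h. Qed.

Lemma smooth_diff (W : normedModType R) (D : set E) (f : E -> W) v :
  smooth_on D f -> smooth_on D (fun x => 'd f x v : W).
Proof. by move=> h n; have [_] := h n.+1; exact. Qed.

Lemma smooth_cst (a : R) : smooth_on [set: E] (fun=> a).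
Proof.
move=> n; elim: n a => [|n IH] a /=; first by move=> x _; exact: cvg_cst.
split => [x _|v]; first exact: differentiable_cst.
suff -> : (fun x : E => 'd (fun=> a : R) x v : R) = (fun=> 0) by exact: IH.
by apply/funext => x; rewrite diff_cst.
Qed.

Lemma Ck_onD n f g : Ck_on n setT f -> Ck_on n setT g ->
  Ck_on n setT (fun x => f x + g x).
Proof.
elim: n f g => [|n IH] f g /=.
  by move=> hf hg x _; apply: cvgD; [exact: hf|exact: hg].
move=> [f1 f2] [g1 g2]; split => [x _|v].
  by apply: differentiableD; [exact: f1|exact: g1].
suff -> : (fun x => 'd (fun x => f x + g x) x v : R) = (fun x => 'd f x v + 'd g x v).
  by apply: IH.
by apply/funext => x; rewrite (diffD (f1 x I) (g1 x I)).
Qed.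

Lemma smoothD f g : smooth_on setT f -> smooth_on setT g ->
  smooth_on setT (fun x => f x + g x).
Proof. by move=> hf hg n; exact: Ck_onD. Qed.

Lemma smoothM f g : smooth_on setT f -> smooth_on setT g ->
  smooth_on setT (fun x => f x * g x).
Proof.
suff H n : Ck_on n setT f -> Ck_on n setT g -> Ck_on n setT (fun x => f x * g x).
  by move=> hf hg n; apply: H.
elim: n f g => [|n IH] f g /=.
  by move=> hf hg x _; apply: cvgM; [exact: hf|exact: hg].
move=> [f1 f2] [g1 g2]; split => [x _|v].
  by apply: differentiableM; [exact: f1|exact: g1].
have Cf : Ck_on n setT f by apply: Ck_on_pred; split.
have Cg : Ck_on n setT g by apply: Ck_on_pred; split.
suff -> : (fun x => 'd (fun x => f x * g x) x v : R) =
    (fun x => f x * 'd g x v + g x * 'd f x v) by apply: Ck_onD; apply: IH.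
by apply/funext => x; rewrite (diffM (f1 x I) (g1 x I)).
Qed.

Lemma smooth_sum (n : nat) (F : 'I_n -> E -> R) :
  (forall i, smooth_on setT (F i)) -> smooth_on setT (fun x => \sum_(i < n) F i x).
Proof.
elim: n F => [|n IH] F h.
  by under eq_fun do rewrite big_ord0; exact: smooth_cst.
under eq_fun do rewrite big_ord_recl; apply: smoothD => //.
exact: IH.
Qed.

Lemma smoothN f : smooth_on setT f -> smooth_on setT (fun x => - f x).
Proof.
move=> h; under eq_fun do rewrite -mulN1r; apply: smoothM => //; exact: smooth_cst.
Qed.

(** The mean value inequality, the source of all estimates of this part. *)
Lemma segment_bound (phi dphi : R -> R) (C : R) :
  (forall t : R, is_derive t (1 : R) phi (dphi t)) ->
  (forall t, 0 <= t -> t <= 1 -> `|dphi t| <= C) ->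
  `|phi 1 - phi 0| <= C.
Proof.
move=> hd hC.
have hc : {within `[0, 1], continuous phi}.
  by apply: derivable_within_continuous => t _; case: (hd t).
have [t] := @MVT_segment R phi dphi 0 1 ler01 (fun t _ => hd t) hc.
by rewrite in_itv /= => /andP[t0 t1] ->; rewrite subr0 mulr1; exact: hC.
Qed.

Lemma is_derive_line g (x h : E) (t : R) : differentiable g (x + t *: h) ->
  is_derive t (1 : R) (fun t : R => g (x + t *: h)) ('d g (x + t *: h) h).
Proof.
move=> dg.
have H : is_diff t (fun t : R => x + t *: h) (fun s : R => s *: h).
  have h1 := @is_diff_cst R R E x t.
  have h2 := @is_diff_scalel R E t h.
  have h3 := @is_diffD R R E _ _ _ _ t h1 h2.
  by apply: is_diff_eq h3 _; apply/funext => s /=; rewrite /= add0r.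
have dl : differentiable (fun t : R => x + t *: h) t by case: H.
have := differentiable_comp dl dg.
move=> dc; have := @diff_derivable _ _ _ _ _ (1 : R) dc.
move=> /derivableP; rewrite deriveE// diff_comp//=.
by rewrite (@diff_val _ _ _ _ _ _ _ H) scale1r.
Qed.

End Smooth.

Lemma exists_common_bound (R : realType) (T : finType) (P : T -> R -> Prop) :
  (forall i C C', C <= C' -> P i C -> P i C') ->
  (forall i, exists2 C, 0 <= C & P i C) -> exists2 C, 0 <= C & forall i, P i C.
Proof.
move=> mono H; have [f f0 fP] : exists2 f : T -> R, forall i, 0 <= f i & forall i, P i (f i).
  have /choice[f Hf] : forall i, exists C, 0 <= C /\ P i C.
    by move=> i; have [C C0 PC] := H i; exists C.
  by exists f => i; have [] := Hf i.
exists (\sum_i f i) => [|i]; first by apply: sumr_ge0.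
apply: mono (fP i); rewrite (bigD1 i)//= lerDl; apply: sumr_ge0 => //.
Qed.

(** Finite dimension, in the form in which it is used: derivatives are bounded
    through finitely many partial derivatives, which are bounded on compact balls. *)
Record coordinates (R : realType) (E : normedModType R) (n : nat)
    (c : 'I_n -> E -> R) (e : 'I_n -> E) : Prop := Coordinates {
  coord_lin : forall i a x y, c i (a *: x + y) = a * c i x + c i y ;
  coord_expand : forall x, x = \sum_i c i x *: e i ;
  coord_le : forall i x, `|c i x| <= `|x| ;
  coord_norm : forall x C, 0 <= C -> (forall i, `|c i x| <= C) -> `|x| <= C ;
  coord_compact : forall rho : R, compact [set x : E | `|x| <= rho]
}.

Section Bounds.
Variables (R : realType) (E : normedModType R) (n : nat).
Variables (c : 'I_n -> E -> R) (e : 'I_n -> E).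
Hypothesis hE : coordinates c e.
Implicit Types (g : E -> R) (rho : R).

Lemma coordD i x y : c i (x + y) = c i x + c i y.
Proof. by have := coord_lin hE i 1 x y; rewrite scale1r mul1r. Qed.

Lemma coordZ i a x : c i (a *: x) = a * c i x.
Proof.
have c0 : c i 0 = 0.
  by apply: (addrI (c i 0)); rewrite -coordD !addr0.
by have := coord_lin hE i a x 0; rewrite !addr0 c0 addr0.
Qed.

Lemma coordB i x y : c i (x - y) = c i x - c i y.
Proof. by rewrite coordD -scaleN1r coordZ mulN1r. Qed.

Lemma coord_differentiable i x : differentiable (c i) x.
Proof.
have lin : linear (c i : E -> R^o) by move=> a u v; rewrite (coord_lin hE).
pose L : {linear E -> R^o} := HB.pack (c i : E -> R^o) (GRing.isLinear.Build _ _ _ _ _ lin).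
suff cL : continuous L by exact: (@linear_differentiable _ E R^o L x cL).
apply/bounded_linear_continuous/bounded_funP => r; exists r => y.
exact: le_trans (coord_le hE i y).
Qed.

Lemma diff_coord i x v : 'd (c i) x v = c i v.
Proof.
have lin : linear (c i : E -> R^o) by move=> a u v'; rewrite (coord_lin hE).
pose L : {linear E -> R^o} := HB.pack (c i : E -> R^o) (GRing.isLinear.Build _ _ _ _ _ lin).
have cL : continuous L.
  by move=> y; exact: (differentiable_continuous (coord_differentiable i y)).
by have -> := @diff_lin _ E R^o L x cL.
Qed.

Lemma diff_expand (W : normedModType R) (f : E -> W) x h :
  'd f x h = \sum_i c i h *: 'd f x (e i) :> W.
Proof.
rewrite {1}(coord_expand hE h) linear_sum; apply: eq_bigr => i _.
by rewrite linearZ.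
Qed.

Lemma bounded_on_ball g rho : smooth_on setT g ->
  exists2 C, 0 <= C & forall x, `|x| <= rho -> `|g x| <= C.
Proof.
move=> hg.
have cg : {within [set x : E | `|x| <= rho], continuous g}.
  by apply: continuous_subspaceT => x; exact: (hg 0%N).
have /compact_bounded [M [Mr HM]] := continuous_compact cg (@coord_compact _ _ _ _ _ hE rho).
exists (`|M| + 1) => [|x xr]; first by rewrite addr_ge0.
have /HM : M < `|M| + 1 by rewrite (le_lt_trans (ler_norm _))// ltrDl.
by apply; exists x.
Qed.

Lemma diff_bound g rho : smooth_on setT g ->
  exists2 C, 0 <= C & forall x h, `|x| <= rho -> `|'d g x h| <= C * `|h|.
Proof.
move=> hg.
have [||C C0 HC] := @exists_common_bound R 'I_n
  (fun i C => forall x, `|x| <= rho -> `|'d g x (e i)| <= C).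
- by move=> i C C' CC' H x /H /le_trans; apply.
- by move=> i; apply: bounded_on_ball; exact: smooth_diff.
exists (n%:R * C) => [|x h xr]; first by rewrite mulr_ge0.
rewrite diff_expand -mulrA; apply: ler_norm_sum_const => i.
by rewrite normrZ mulrC; apply: ler_pM => //; [exact: HC|exact: coord_le hE _ _].
Qed.

Lemma ball_convex rho (x h : E) (t : R) : 0 <= t -> t <= 1 ->
  `|x| <= rho -> `|x + h| <= rho -> `|x + t *: h| <= rho.
Proof.
move=> t0 t1 h1 h2.
have -> : x + t *: h = (1 - t) *: x + t *: (x + h).
  by rewrite scalerBl scale1r scalerDr addrA addrNK.
apply: le_trans (ler_normD _ _) _; rewrite !normrZ !ger0_norm ?subr_ge0//.
by nra.
Qed.

Lemma smooth_lipschitz g rho : smooth_on setT g ->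
  exists2 C, 0 <= C & forall x y, `|x| <= rho -> `|y| <= rho ->
    `|g y - g x| <= C * `|y - x|.
Proof.
move=> hg; have [C C0 HC] := diff_bound rho hg; exists C => // x y xr yr.
have := @segment_bound R (fun t : R => g (x + t *: (y - x)))
  (fun t : R => 'd g (x + t *: (y - x)) (y - x)) (C * `|y - x|).
rewrite scale1r scale0r addr0 subrKC; apply => [t|t t0 t1].
  by apply: is_derive_line; exact: smooth_differentiable hg _.
by apply: HC; apply: ball_convex => //; rewrite subrKC.
Qed.

Lemma diff_lipschitz g rho : smooth_on setT g ->
  exists2 C, 0 <= C & forall x y h, `|x| <= rho -> `|y| <= rho ->
    `|'d g y h - 'd g x h| <= C * `|y - x| * `|h|.
Proof.
move=> hg.
have [||C C0 HC] := @exists_common_bound R 'I_n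
  (fun i C => forall x y, `|x| <= rho -> `|y| <= rho ->
     `|'d g y (e i) - 'd g x (e i)| <= C * `|y - x|).
- by move=> i C C' CC' H x y xr yr; apply: le_trans (H x y xr yr) _; rewrite ler_wpM2r.
- by move=> i; apply: smooth_lipschitz; exact: smooth_diff.
exists (n%:R * C) => [|x y h xr yr]; first by rewrite mulr_ge0.
rewrite (diff_expand g y) (diff_expand g x) -sumrB -!mulrA.
apply: ler_norm_sum_const => i.
rewrite -scalerBr normrZ mulrC mulrA; apply: ler_pM => //; [exact: HC|exact: coord_le hE _ _].
Qed.

(** The four-point estimates follow by the mean value inequality along the two
    opposite sides of the quadrilateral, parametrized simultaneously. *)
Lemma is_derive_two_lines g (x h a b : E) (t : R) : smooth_on setT g ->
  is_derive t (1 : R) (fun t : R => g (x + a + t *: (h + b)) - g (x + t *: h))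
    ('d g (x + a + t *: (h + b)) (h + b) - 'd g (x + t *: h) h).
Proof.
by move=> hg; apply: is_deriveB; apply: is_derive_line; exact: smooth_differentiable hg _.
Qed.

(** For a = eps * j and a + b = eps * j' the left-hand side is eps times the
    increment of a difference quotient of g; whence the interest of a bound in
    which every term contains a or b. *)
Lemma smooth_four_point g rho : smooth_on setT g ->
  exists2 C, 0 <= C & forall x h a b,
    `|x| <= rho -> `|x + h| <= rho -> `|x + a| <= rho -> `|x + a + (h + b)| <= rho ->
    `|g (x + a + (h + b)) - g (x + h) - (g (x + a) - g x)|
      <= C * (`|b| + `|a| * `|h|).
Proof.
move=> hg; have [C1 C10 H1] := diff_bound rho hg.
have [C2 C20 H2] := diff_lipschitz rho hg.
exists (C1 + C2 + 2 * C2 * `|rho|) => [|x h a b h1 h2 h3 h4].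
  by rewrite !addr_ge0// !mulr_ge0.
have := segment_bound (fun t => is_derive_two_lines x h a b t hg).
move=> /(_ (C2 * `|a| * `|h| + (C1 + 2 * C2 * `|rho|) * `|b|)).
rewrite !scale1r !scale0r !addr0 => H.
have a0 := normr_ge0 a; have b0 := normr_ge0 b; have hh0 := normr_ge0 h.
have hr : `|h| <= 2 * `|rho|.
  have hx : `|h| = `|x + h - x| by rewrite [x + h]addrC addrK.
  by rewrite hx; have := ler_normB (x + h) x; have := ler_norm rho; lra.
apply: le_trans (H _) _; last first.
  have ah := mulr_ge0 a0 hh0; have C2r := mulr_ge0 C20 (normr_ge0 rho).
  have := mulr_ge0 C10 ah; have := mulr_ge0 C2r ah; have := mulr_ge0 C20 b0.
  by lra.
move=> t t0 t1.
have Pr := ball_convex t0 t1 h3 h4; have Qr := ball_convex t0 t1 h1 h2.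
have -> : 'd g (x + a + t *: (h + b)) (h + b) - 'd g (x + t *: h) h =
   ('d g (x + a + t *: (h + b)) h - 'd g (x + t *: h) h) + 'd g (x + a + t *: (h + b)) b.
  by rewrite linearD addrAC.
apply: le_trans (ler_normD _ _) _.
have i1 := H2 _ _ h Qr Pr; have i2 := H1 _ b Pr.
have i3 : `|x + a + t *: (h + b) - (x + t *: h)| <= `|a| + `|b|.
  have -> : x + a + t *: (h + b) - (x + t *: h) = a + t *: b.
    by rewrite scalerDr opprD [LHS](AC (2*2*2) ((1*5)*((3*6)*(2*4)))) /= !subrr !add0r.
  apply: le_trans (ler_normD _ _) _; rewrite lerD2l normrZ ger0_norm//.
  by rewrite ler_piMl.
have i4 : C2 * `|x + a + t *: (h + b) - (x + t *: h)| * `|h| <= C2 * (`|a| + `|b|) * `|h|.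
  by rewrite ler_wpM2r// ler_wpM2l.
have i5 : C2 * `|b| * `|h| <= C2 * `|b| * (2 * `|rho|) by rewrite ler_wpM2l// mulr_ge0.
by lra.
Qed.

Lemma is_derive_sub_linear (phi : R -> R) (t d k : R) :
  is_derive t (1 : R) phi d -> is_derive t (1 : R) (fun t => phi t - t * k) (d - k).
Proof.
move=> hd.
have h1 := @is_deriveM R R id (cst k) t (1 : R) 1 0 (is_derive_id t (1 : R))
  (is_derive_cst k t (1 : R)).
have h2 := is_deriveB hd h1.
by apply: is_derive_eq h2 _; rewrite /= scaler0 add0r /GRing.scale/= mulr1.
Qed.

Lemma smooth_taylor g rho : smooth_on setT g ->
  exists2 C, 0 <= C & forall x h, `|x| <= rho -> `|x + h| <= rho ->
    `|g (x + h) - g x - 'd g x h| <= C * `|h| ^+ 2.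
Proof.
move=> hg; have [C C0 HC] := diff_lipschitz rho hg; exists C => // x h h1 h2.
have dphi (t : R) := is_derive_sub_linear ('d g x h)
  (is_derive_line (smooth_differentiable hg (I : setT (x + t *: h)))).
have := segment_bound dphi.
move=> /(_ (C * `|h| ^+ 2)).
rewrite !scale1r !scale0r !addr0 mul1r mul0r subr0 addrAC; apply => t t0 t1.
apply: le_trans (HC _ _ _ h1 (ball_convex t0 t1 h1 h2)) _.
rewrite addrC addKr normrZ ger0_norm//.
have := normr_ge0 h => hh; rewrite expr2 [X in _ <= X]mulrA ler_wpM2r// ler_wpM2l//.
by rewrite ler_piMl.
Qed.

Lemma diff_four_point g rho : smooth_on setT g ->
  exists2 C, 0 <= C & forall x h a b k,
    `|x| <= rho -> `|x + h| <= rho -> `|x + a| <= rho -> `|x + a + (h + b)| <= rho ->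
    `|'d g (x + a + (h + b)) k - 'd g (x + h) k - ('d g (x + a) k - 'd g x k)|
      <= C * (`|b| + `|a| * `|h|) * `|k|.
Proof.
move=> hg.
have [||C C0 HC] := @exists_common_bound R 'I_n (fun i C => forall x h a b,
    `|x| <= rho -> `|x + h| <= rho -> `|x + a| <= rho -> `|x + a + (h + b)| <= rho ->
    `|'d g (x + a + (h + b)) (e i) - 'd g (x + h) (e i)
      - ('d g (x + a) (e i) - 'd g x (e i))| <= C * (`|b| + `|a| * `|h|)).
- move=> i C C' CC' H x h a b h1 h2 h3 h4; apply: le_trans (H _ _ _ _ h1 h2 h3 h4) _.
  by rewrite ler_wpM2r// addr_ge0// mulr_ge0.
- by move=> i; apply: smooth_four_point; exact: smooth_diff.
exists (n%:R * C) => [|x h a b k h1 h2 h3 h4]; first by rewrite mulr_ge0.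
rewrite !(diff_expand g _ k) -!sumrB -!mulrA.
apply: ler_norm_sum_const => i.
rewrite -!scalerBr normrZ mulrC mulrA; apply: ler_pM => //; [exact: HC|exact: coord_le hE _ _].
Qed.

(** Variation of the Taylor remainder when its base point moves by a and its
    increment by b.  Every term contains a or b, so that dividing by eps is
    harmless when both are of order eps. *)
Lemma smooth_four_taylor g rho : smooth_on setT g ->
  exists2 C, 0 <= C & forall x h a b,
    `|x| <= rho -> `|x + h| <= rho -> `|x + a| <= rho -> `|x + a + (h + b)| <= rho ->
    `|g (x + a + (h + b)) - g (x + a) - 'd g (x + a) (h + b)
      - (g (x + h) - g x - 'd g x h)|
      <= C * (`|h| * `|b| + `|a| * `|h| ^+ 2 + `|b| ^+ 2).
Proof.
move=> hg; have [C1 C10 H1] := diff_four_point rho hg.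
have [C2 C20 H2] := diff_lipschitz rho hg.
exists (C1 + C2) => [|x h a b h1 h2 h3 h4]; first by rewrite addr_ge0.
have dphi (t : R) := is_derive_sub_linear ('d g (x + a) (h + b) - 'd g x h)
  (is_derive_two_lines x h a b t hg).
have := segment_bound dphi.
move=> /(_ ((C1 + C2) * (`|h| * `|b| + `|a| * `|h| ^+ 2 + `|b| ^+ 2))).
rewrite !scale1r !scale0r !addr0 mul1r mul0r subr0 => H.
have -> : g (x + a + (h + b)) - g (x + a) - 'd g (x + a) (h + b)
      - (g (x + h) - g x - 'd g x h) =
  g (x + a + (h + b)) - g (x + h) - ('d g (x + a) (h + b) - 'd g x h) - (g (x + a) - g x).
  by ring.
apply: H => t t0 t1.
have Pr := ball_convex t0 t1 h3 h4; have Qr := ball_convex t0 t1 h1 h2.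
have -> : 'd g (x + a + t *: (h + b)) (h + b) - 'd g (x + t *: h) h -
    ('d g (x + a) (h + b) - 'd g x h) =
  ('d g (x + a + t *: (h + b)) h - 'd g (x + t *: h) h - ('d g (x + a) h - 'd g x h))
  + ('d g (x + a + t *: (h + b)) b - 'd g (x + a) b).
  by rewrite !linearD /=; ring.
apply: le_trans (ler_normD _ _) _.
have Pr' := Pr; rewrite scalerDr in Pr'.
have i1 := H1 x (t *: h) a (t *: b) h h1 Qr h3 Pr'.
rewrite -scalerDr in i1.
have i2 := H2 (x + a) _ b h3 Pr.
have e2 : x + a + t *: (h + b) - (x + a) = t *: (h + b) by rewrite addrC addKr.
rewrite e2 in i2.
have le_t (v : E) : `|t *: v| <= `|v| by rewrite normrZ ger0_norm// ler_piMl.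
have i3 := le_t b; have i4 := le_t h.
have i5 : `|t *: (h + b)| <= `|h| + `|b| := le_trans (le_t _) (ler_normD _ _).
have hh := normr_ge0 h; have hb := normr_ge0 b; have ha := normr_ge0 a.
have i6 : C1 * (`|t *: b| + `|a| * `|t *: h|) * `|h| <= C1 * (`|b| + `|a| * `|h|) * `|h|.
  by rewrite ler_wpM2r// ler_wpM2l// lerD// ler_wpM2l.
have i7 : C2 * `|t *: (h + b)| * `|b| <= C2 * (`|h| + `|b|) * `|b|.
  by rewrite ler_wpM2r// ler_wpM2l.
have j1 : 0 <= C2 * (`|a| * `|h| ^+ 2) by rewrite !mulr_ge0// exprn_ge0.
have j2 : 0 <= C1 * `|b| ^+ 2 by rewrite mulr_ge0// exprn_ge0.
by lra.
Qed.

End Bounds.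

(** * Smooth vector fields and the system solved by a difference quotient *)

Section VectorFields.
Variables (R : realType) (E : normedModType R) (n : nat).
Variables (c : 'I_n -> E -> R) (e : 'I_n -> E).
Hypothesis hE : coordinates c e.

Definition smooth_field (f : E -> E) : Prop :=
  forall i, smooth_on setT (fun x => c i (f x)).

Lemma smooth_field_differentiable (f : E -> E) x :
  smooth_field f -> differentiable f x.
Proof.
move=> hf; have -> : f = \sum_(i < n) (fun y => c i (f y) *: e i).
  by apply/funext => y; rewrite fct_sumE; exact: coord_expand hE _.
apply: differentiable_sum => i; apply: differentiableZl.
exact: smooth_differentiable (hf i) _.
Qed.

Lemma coord_of_diff (V : normedModType R) (f : V -> E) x h i :
  differentiable f x -> c i ('d f x h) = 'd (fun y => c i (f y)) x h.
Proof.
move=> df; have dc := coord_differentiable hE i (f x).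
have -> : (fun y => c i (f y)) = c i \o f by [].
by rewrite (diff_comp df dc) /= (diff_coord hE).
Qed.

Lemma differentiable_coord_comp (V : normedModType R) (f : V -> E) x i :
  differentiable f x -> differentiable (fun y => c i (f y)) x.
Proof.
move=> df; have -> : (fun y => c i (f y)) = c i \o f by [].
by apply: differentiable_comp => //; exact: coord_differentiable hE _ _.
Qed.

Lemma smooth_field_directional (f g : E -> E) :
  smooth_field f -> smooth_field g -> smooth_field (fun x => 'd f x (g x)).
Proof.
move=> hf hg i.
have -> : (fun x => c i ('d f x (g x))) =
   (fun x => \sum_(l < n) c l (g x) * 'd (fun y => c i (f y)) x (e l)).
  apply/funext => x; rewrite coord_of_diff; last exact: smooth_field_differentiable.
  by rewrite (diff_expand hE).
by apply: smooth_sum => l; apply: smoothM => //; exact: smooth_diff.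
Qed.

Lemma coordinatewise_bound (T : Type) (P : T -> Prop) (X : T -> E) (B : T -> R) :
  (forall a, 0 <= B a) ->
  (forall i, exists2 C, 0 <= C & forall a, P a -> `|c i (X a)| <= C * B a) ->
  exists2 C, 0 <= C & forall a, P a -> `|X a| <= C * B a.
Proof.
move=> B0 H.
have [||C C0 HC] := @exists_common_bound R 'I_n
  (fun i C => forall a, P a -> `|c i (X a)| <= C * B a) => //.
  by move=> i C C' CC' hC a Pa; apply: le_trans (hC a Pa) _; rewrite ler_wpM2r.
exists C => // a Pa; apply: coord_norm hE _ _ _ _; first by rewrite mulr_ge0.
by move=> i; exact: HC.
Qed.

(** All the estimates on a field used later, with one common constant, so that
    finite families of fields can be treated at once. *)
Record field_bounds (C rho : R) (f : E -> E) : Prop := FieldBounds {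
  fb_bound : forall x, `|x| <= rho -> `|f x| <= C ;
  fb_lip : forall x y, `|x| <= rho -> `|y| <= rho -> `|f y - f x| <= C * `|y - x| ;
  fb_diff : forall x h, `|x| <= rho -> `|'d f x h| <= C * `|h| ;
  fb_diff_lip : forall x y h, `|x| <= rho -> `|y| <= rho ->
    `|'d f y h - 'd f x h| <= C * (`|y - x| * `|h|) ;
  fb_four : forall x h a b,
    `|x| <= rho -> `|x + h| <= rho -> `|x + a| <= rho -> `|x + a + (h + b)| <= rho ->
    `|f (x + a + (h + b)) - f (x + h) - (f (x + a) - f x)| <= C * (`|b| + `|a| * `|h|) ;
  fb_taylor : forall x h, `|x| <= rho -> `|x + h| <= rho ->
    `|f (x + h) - f x - 'd f x h| <= C * `|h| ^+ 2 ;
  fb_four_taylor : forall x h a b,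
    `|x| <= rho -> `|x + h| <= rho -> `|x + a| <= rho -> `|x + a + (h + b)| <= rho ->
    `|f (x + a + (h + b)) - f (x + a) - 'd f (x + a) (h + b)
      - (f (x + h) - f x - 'd f x h)|
      <= C * (`|h| * `|b| + `|a| * `|h| ^+ 2 + `|b| ^+ 2)
}.

Lemma field_bounds_mono C C' rho f : C <= C' ->
  field_bounds C rho f -> field_bounds C' rho f.
Proof.
move=> CC' [h1 h2 h3 h4 h5 h6 h7].
have step (u B : R) : 0 <= B -> u <= C * B -> u <= C' * B.
  by move=> B0 /le_trans; apply; rewrite ler_wpM2r.
split.
- by move=> x /h1 /le_trans; apply.
- by move=> x y xr yr; apply: step => //; exact: h2.
- by move=> x h xr; apply: step => //; exact: h3.
- by move=> x y h xr yr; apply: step; [rewrite mulr_ge0|exact: h4].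
- by move=> x h a b *; apply: step; [rewrite addr_ge0 ?mulr_ge0|exact: h5].
- by move=> x h *; apply: step; [rewrite exprn_ge0|exact: h6].
- move=> x h a b *; apply: step; last exact: h7.
  by rewrite !addr_ge0// ?mulr_ge0// exprn_ge0.
Qed.

Lemma smooth_field_bounds f rho : smooth_field f ->
  exists2 C, 0 <= C & field_bounds C rho f.
Proof.
move=> hf; have df x : differentiable f x by exact: smooth_field_differentiable.
have [C1 C10 h1] : exists2 C, 0 <= C & forall x, `|x| <= rho -> `|f x| <= C * 1.
  apply: coordinatewise_bound => // i; have [C C0 HC] := bounded_on_ball hE rho (hf i).
  by exists C => // x /HC; rewrite mulr1.
have [C2 C20 h2] : exists2 C, 0 <= C & forall a : E * E,
    `|a.1| <= rho /\ `|a.2| <= rho -> `|f a.2 - f a.1| <= C * `|a.2 - a.1|.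
  apply: coordinatewise_bound => // i; have [C C0 HC] := smooth_lipschitz hE rho (hf i).
  by exists C => // -[x y] /= [xr yr]; rewrite (coordB hE); exact: HC.
have [C3 C30 h3] : exists2 C, 0 <= C & forall a : E * E,
    `|a.1| <= rho -> `|'d f (a.1) a.2| <= C * `|a.2|.
  apply: coordinatewise_bound => // i; have [C C0 HC] := diff_bound hE rho (hf i).
  by exists C => // -[x y] /= xr; rewrite coord_of_diff//; exact: HC.
have [C4 C40 h4] : exists2 C, 0 <= C & forall a : E * E * E,
    `|a.1.1| <= rho /\ `|a.1.2| <= rho ->
    `|'d f (a.1.2) a.2 - 'd f (a.1.1) a.2| <= C * (`|a.1.2 - a.1.1| * `|a.2|).
  apply: coordinatewise_bound => [a|i]; first by rewrite mulr_ge0.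
  have [C C0 HC] := diff_lipschitz hE rho (hf i).
  exists C => // -[[x y] h] /= [xr yr]; rewrite (coordB hE) !coord_of_diff// mulrA.
  exact: HC.
pose P4 (a : E * E * E * E) : Prop := [/\ `|a.1.1.1| <= rho, `|a.1.1.1 + a.1.1.2| <= rho,
  `|a.1.1.1 + a.1.2| <= rho & `|a.1.1.1 + a.1.2 + (a.1.1.2 + a.2)| <= rho].
have [C5 C50 h5] : exists2 C, 0 <= C & forall a : E * E * E * E, P4 a ->
    `|f (a.1.1.1 + a.1.2 + (a.1.1.2 + a.2)) - f (a.1.1.1 + a.1.1.2)
      - (f (a.1.1.1 + a.1.2) - f a.1.1.1)| <= C * (`|a.2| + `|a.1.2| * `|a.1.1.2|).
  apply: coordinatewise_bound => [a|i]; first by rewrite addr_ge0// mulr_ge0.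
  have [C C0 HC] := smooth_four_point hE rho (hf i).
  by exists C => // -[[[x h] a] b] /= [? ? ? ?]; rewrite !(coordB hE); exact: HC.
have [C6 C60 h6] : exists2 C, 0 <= C & forall a : E * E,
    `|a.1| <= rho /\ `|a.1 + a.2| <= rho ->
    `|f (a.1 + a.2) - f a.1 - 'd f (a.1) a.2| <= C * `|a.2| ^+ 2.
  apply: coordinatewise_bound => [a|i]; first by rewrite exprn_ge0.
  have [C C0 HC] := smooth_taylor hE rho (hf i).
  by exists C => // -[x h] /= [? ?]; rewrite !(coordB hE) coord_of_diff//; exact: HC.
have [C7 C70 h7] : exists2 C, 0 <= C & forall a : E * E * E * E, P4 a ->
    `|f (a.1.1.1 + a.1.2 + (a.1.1.2 + a.2)) - f (a.1.1.1 + a.1.2)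
      - 'd f (a.1.1.1 + a.1.2) (a.1.1.2 + a.2)
      - (f (a.1.1.1 + a.1.1.2) - f a.1.1.1 - 'd f (a.1.1.1) a.1.1.2)| <=
    C * (`|a.1.1.2| * `|a.2| + `|a.1.2| * `|a.1.1.2| ^+ 2 + `|a.2| ^+ 2).
  apply: coordinatewise_bound => [a|i].
    by rewrite !addr_ge0// ?mulr_ge0// exprn_ge0.
  have [C C0 HC] := smooth_four_taylor hE rho (hf i).
  exists C => // -[[[x h] a] b] /= [? ? ? ?]; rewrite !(coordB hE) !coord_of_diff//.
  exact: HC.
exists (C1 + C2 + C3 + C4 + C5 + C6 + C7); first by rewrite !addr_ge0.
have step (C u B : R) : 0 <= B -> C <= C1 + C2 + C3 + C4 + C5 + C6 + C7 ->
    u <= C * B -> u <= (C1 + C2 + C3 + C4 + C5 + C6 + C7) * B.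
  by move=> B0 CC /le_trans; apply; rewrite ler_wpM2r.
split.
- by move=> x xr; rewrite -[X in _ <= X]mulr1; apply: step (h1 x xr) => //; lra.
- by move=> x y xr yr; apply: step (h2 (x, y) (conj xr yr)) => //; lra.
- by move=> x h xr; apply: step (h3 (x, h) xr) => //; lra.
- move=> x y h xr yr; apply: step (h4 (x, y, h) (conj xr yr)); last by lra.
  by rewrite mulr_ge0.
- move=> x h a b p1 p2 p3 p4.
  apply: step (h5 (x, h, a, b) (And4 p1 p2 p3 p4)); last by lra.
  by rewrite addr_ge0// mulr_ge0.
- by move=> x h xr yr; apply: step (h6 (x, h) (conj xr yr)); [rewrite exprn_ge0|lra].
- move=> x h a b p1 p2 p3 p4.
  apply: step (h7 (x, h, a, b) (And4 p1 p2 p3 p4)); last by lra.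
  by rewrite !addr_ge0// ?mulr_ge0// exprn_ge0.
Qed.

End VectorFields.

Lemma sum_pair (R : realType) (U W : normedModType R) (T : finType) (F : T -> U * W) :
  \sum_j F j = (\sum_j (F j).1, \sum_j (F j).2).
Proof.
apply: (big_ind3 (fun (w : U * W) u v => w = (u, v))) => //.
- by move=> _ u v _ u' v' -> ->.
- by move=> j _; case: (F j).
Qed.

Section DifferenceQuotient.
Variables (R : realType) (E : normedModType R).

Lemma prod_norm_le (u v : E) (C : R) : `|u| <= C -> `|v| <= C -> `|((u, v) : E * E)| <= C.
Proof. by move=> hu hv; rewrite prod_normE /= ge_max hu hv. Qed.

Lemma le_prod_norm (w : E * E) : `|w.1| <= `|w| /\ `|w.2| <= `|w|.
Proof. by rewrite prod_normE !le_max !lexx orbT. Qed.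

(** If x and y solve the system of f, then (x, (y - x) / eps) solves the system of
    this field; its limit for eps = 0 is the tangent field (f, Df). *)
Definition quotient_field (eps : R) (f : E -> E) (w : E * E) : E * E :=
  (f w.1, eps^-1 *: (f (w.1 + eps *: w.2) - f w.1)).

(** The bounds do not depend on eps.  In the second component every estimate is a
    four-point estimate divided by eps; the Taylor clause also uses that the
    directional derivative of a quotient field is the quotient field of the
    directional derivative. *)
Lemma quotient_field_tame (K : nat) (C rho eps : R) (V : 'I_K -> E -> E) (V0 : E -> E) :
  0 <= C -> 0 < eps -> eps <= 1 ->
  (forall j, field_bounds C (rho + 2) (V j)) ->
  (forall k j, field_bounds C (rho + 2) (fun x => 'd (V j) x (V k x))) ->
  field_bounds C (rho + 2) V0 ->
  (forall j x, differentiable (V j) x) ->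
  tame (5 * C + 2 * `|rho| + 4) [set w : E * E | `|w.1| <= rho /\ `|w.2| <= 2]
    (fun j => quotient_field eps (V j))
    (fun k j => quotient_field eps (fun x => 'd (V j) x (V k x)))
    (quotient_field eps V0).
Proof.
move=> C0 e0 e1 hV hF hV0 dV.
set B := [set w | _].
have ball (w : E * E) : B w -> [/\ `|w.1| <= rho + 2, `|w.1 + eps *: w.2| <= rho + 2
    & `|eps *: w.2| <= eps * `|w.2|].
  move=> [w1 w2]; have ew : `|eps *: w.2| = eps * `|w.2|.
    by rewrite normrZ gtr0_norm.
  split; [lra| |by rewrite ew].
  apply: le_trans (ler_normD _ _) _; rewrite ew.
  have : eps * `|w.2| <= 1 * 2 by apply: ler_pM => //; exact: ltW.
  lra.
have quot (u : E) (M : R) : `|u| <= eps * M -> `|eps^-1 *: u| <= M.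
  by move=> hu; rewrite normrZ gtr0_norm ?invr_gt0// ler_pdivrMl.
have bound f w : field_bounds C (rho + 2) f -> B w ->
    `|quotient_field eps f w| <= 5 * C + 2 * `|rho| + 4.
  move=> hf Bw; have [w1 w2 w3] := ball w Bw; have r0 := normr_ge0 rho.
  apply: prod_norm_le; first by have := fb_bound hf w1; lra.
  apply: (@le_trans _ _ (2 * C)); last by lra.
  apply: quot; apply: le_trans (fb_lip hf w1 w2) _.
  rewrite [_ + _ - _]addrC addKr.
  have [_ w4] := Bw; have : C * `|eps *: w.2| <= C * (eps * 2).
    by rewrite ler_wpM2l// (le_trans w3)// ler_wpM2l// ltW.
  lra.
have decomp (w w' : E * E) : B w -> B w' ->
   let h := w'.1 - w.1 in let a := eps *: w.2 in let b := eps *: (w'.2 - w.2) in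
   [/\ w'.1 = w.1 + h, w'.1 + eps *: w'.2 = w.1 + a + (h + b),
      `|h| <= `|w' - w|, `|a| <= eps * 2 & `|b| <= eps * `|w' - w| ].
  move=> Bw Bw' h a b; have [l1 l2] := le_prod_norm (w' - w).
  have [_ w2] := Bw; have [_ _ w3] := ball w Bw.
  split => //.
  - by rewrite /h subrKC.
  - rewrite /a /b /h scalerBr.
    by rewrite [RHS](AC (2*(2*2)) ((3*5)*((1*4)*(2*6)))) /= !subrr !addr0.
  - by apply: le_trans w3 _; rewrite ler_wpM2l// ltW.
  - by rewrite /b normrZ gtr0_norm// ler_wpM2l// ltW.
have ball' (w w' : E * E) : B w -> B w' ->
   let h := w'.1 - w.1 in let a := eps *: w.2 in let b := eps *: (w'.2 - w.2) in
   [/\ `|w.1| <= rho + 2, `|w.1 + h| <= rho + 2, `|w.1 + a| <= rho + 2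
     & `|w.1 + a + (h + b)| <= rho + 2].
  move=> Bw Bw' h a b; have [d1 d2 _ _ _] := decomp w w' Bw Bw'.
  have [b1 b2 _] := ball w Bw; have [b3 b4 _] := ball w' Bw'.
  by rewrite -d1 -d2.
have lip f w w' : field_bounds C (rho + 2) f -> B w -> B w' ->
    `|quotient_field eps f w' - quotient_field eps f w|
      <= (5 * C + 2 * `|rho| + 4) * `|w' - w|.
  move=> hf Bw Bw'; have [d1 d2 d3 d4 d5] := decomp w w' Bw Bw'.
  have [b1 b2 b3 b4] := ball' w w' Bw Bw'.
  set h := w'.1 - w.1 in d1 d2 d3 b2 b4; set a := eps *: w.2 in d2 d4 b3 b4.
  set b := eps *: (w'.2 - w.2) in d2 d5 b4.
  have N0 := normr_ge0 (w' - w); have r0 := normr_ge0 rho.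
  have rN := mulr_ge0 r0 N0; have CN := mulr_ge0 C0 N0.
  apply: prod_norm_le => /=.
    rewrite d1; apply: le_trans (fb_lip hf b1 b2) _.
    rewrite [_ + _ - _]addrC addKr; have := ler_wpM2l C0 d3; lra.
  apply: (@le_trans _ _ (3 * C * `|w' - w|)); last by lra.
  rewrite -scalerBr; apply: quot; rewrite d2 d1 -/a.
  apply: le_trans (fb_four hf b1 b2 b3 b4) _.
  have ah : `|a| * `|h| <= eps * 2 * `|w' - w| by apply: ler_pM.
  have : C * (`|b| + `|a| * `|h|) <= C * (eps * `|w' - w| + eps * 2 * `|w' - w|).
    by rewrite ler_wpM2l// lerD.
  lra.
split.
- move=> w w' Bw Bw'; have [_ _ d3 _ _] := decomp w w' Bw Bw'.
  have [w1 w2] := Bw; have [w1' w2'] := Bw'.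
  have := ler_norm rho; have r0 := normr_ge0 rho => hr.
  apply: prod_norm_le; apply: le_trans (ler_normB _ _) _ => /=; lra.
- by move=> j w; exact: bound.
- by move=> k j w; exact: bound.
- by move=> w; exact: bound.
- by move=> k j w w'; exact: lip.
- by move=> w w'; exact: lip.
move=> j w w' z Bw Bw'; have [d1 d2 d3 d4 d5] := decomp w w' Bw Bw'.
have [b1 b2 b3 b4] := ball' w w' Bw Bw'.
set r := `|w' - w - \sum_k z k *: quotient_field eps (V k) w|.
rewrite !sum_pair /=.
set r1 := w'.1 - w.1 - \sum_k z k *: V k w.1.
set r2 := w'.2 - w.2 - \sum_k z k *: (eps^-1 *: (V k (w.1 + eps *: w.2) - V k w.1)).
have [n1 n2] : `|r1| <= r /\ `|r2| <= r.
  have := le_prod_norm (w' - w - \sum_k z k *: quotient_field eps (V k) w).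
  by rewrite -/r sum_pair.
set h := w'.1 - w.1 in d1 d2 d3 b2 b4 r1 n1; set a := eps *: w.2 in d2 d4 b3 b4 r2 n2 *.
set b := eps *: (w'.2 - w.2) in d2 d5 b4.
have N0 := normr_ge0 (w' - w); have r0 := normr_ge0 rho.
have R0 : 0 <= r by apply: le_trans n1.
have N2 : 0 <= `|w' - w| ^+ 2 by rewrite exprn_ge0.
have rN := mulr_ge0 r0 N2; have CN := mulr_ge0 C0 N2.
have rR := mulr_ge0 r0 R0; have CR := mulr_ge0 C0 R0.
have hh : `|h| ^+ 2 <= `|w' - w| ^+ 2 by rewrite lerXn2r ?nnegrE.
apply: prod_norm_le => /=.
  have -> : V j w'.1 - V j w.1 - \sum_k z k *: 'd (V j) (w.1) (V k w.1) =
     (V j (w.1 + h) - V j w.1 - 'd (V j) (w.1) h) + 'd (V j) (w.1) r1.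
    rewrite -d1 /r1 (linearB _ h) addrA addrNK (linear_sum ('d (V j) (w.1))).
    by congr (_ - _); apply: eq_bigr => k _; rewrite linearZ.
  apply: le_trans (ler_normD _ _) _.
  have := fb_taylor (hV j) b1 b2; have := fb_diff (hV j) r1 b1.
  have := ler_wpM2l C0 hh; have := ler_wpM2l C0 n1; lra.
rewrite d2 d1.
have -> : \sum_k z k *: (eps^-1 *: ('d (V j) (w.1 + a) (V k (w.1 + a)) - 'd (V j) (w.1) (V k w.1)))
   = eps^-1 *: ('d (V j) (w.1 + a) (\sum_k z k *: V k (w.1 + a))
                - 'd (V j) (w.1) (\sum_k z k *: V k w.1)).
  rewrite (linear_sum ('d (V j) (w.1 + a))) (linear_sum ('d (V j) (w.1))).
  rewrite -sumrB scaler_sumr; apply: eq_bigr => k _.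
  by rewrite !linearZ /= -scalerDr.
rewrite -!scalerBr; apply: (@le_trans _ _ (5 * C * `|w' - w| ^+ 2 + 3 * C * r)); last by lra.
apply: quot.
have eb : h + b - \sum_k z k *: V k (w.1 + a) = r1 + eps *: r2.
  rewrite /r1 /r2 scalerBr -/b scaler_sumr.
  have -> : \sum_k eps *: (z k *: (eps^-1 *: (V k (w.1 + a) - V k w.1))) =
     \sum_k z k *: V k (w.1 + a) - \sum_k z k *: V k w.1.
    rewrite -sumrB; apply: eq_bigr => k _.
    by rewrite -scalerBr !scalerA mulrAC mulfV ?gt_eqF// mul1r.
  set s1 := \sum_k _; set s2 := \sum_k _.
  by rewrite opprB [RHS](AC (2*(1*2)) ((1*3*5)*(2*4))) /= addNr addr0.
set Sa := \sum_k _ in eb *; set S0 := \sum_k _ in r1 n1 eb *.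
have -> : V j (w.1 + a + (h + b)) - V j (w.1 + h) - (V j (w.1 + a) - V j w.1) -
     ('d (V j) (w.1 + a) Sa - 'd (V j) (w.1) S0) =
   (V j (w.1 + a + (h + b)) - V j (w.1 + a) - 'd (V j) (w.1 + a) (h + b)
      - (V j (w.1 + h) - V j w.1 - 'd (V j) (w.1) h))
   + (('d (V j) (w.1 + a) r1 - 'd (V j) (w.1) r1) + eps *: 'd (V j) (w.1 + a) r2).
  have -> : 'd (V j) (w.1 + a) r1 - 'd (V j) (w.1) r1 + eps *: 'd (V j) (w.1 + a) r2 =
     'd (V j) (w.1 + a) (h + b) - 'd (V j) (w.1 + a) Sa - ('d (V j) (w.1) h - 'd (V j) (w.1) S0).
    have -> : 'd (V j) (w.1) h - 'd (V j) (w.1) S0 = 'd (V j) (w.1) r1 by rewrite -linearB.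
    have -> : 'd (V j) (w.1 + a) (h + b) - 'd (V j) (w.1 + a) Sa =
       'd (V j) (w.1 + a) r1 + eps *: 'd (V j) (w.1 + a) r2.
      by rewrite -linearB eb linearD linearZ.
    by rewrite addrAC.
  move: ('d (V j) (w.1 + a) Sa) ('d (V j) (w.1) S0) => x1 x2.
  move: ('d (V j) (w.1 + a) (h + b)) ('d (V j) (w.1) h) => x3 x4.
  move: (V j _) (V j _) (V j _) (V j _) => y1 y2 y3 y4.
  rewrite !opprB !addrA.
  rewrite [RHS](AC (1*1*1*1*1*1*1*1*1*1) ((1*6*5*2*9*8)*((3*7)*(4*10)))) /=.
  by rewrite addNr subrr !addr0.
apply: le_trans (ler_normD _ _) _.
have T1 := fb_four_taylor (hV j) b1 b2 b3 b4.
have T2 : `|'d (V j) (w.1 + a) r1 - 'd (V j) (w.1) r1| <= C * (eps * 2 * r).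
  apply: le_trans (fb_diff_lip (hV j) r1 b1 b3) _; rewrite ler_wpM2l//.
  by rewrite [w.1 + a]addrC addrK; apply: ler_pM.
have T3 : `|eps *: 'd (V j) (w.1 + a) r2| <= eps * (C * r).
  rewrite normrZ gtr0_norm// ler_pM2l//.
  by apply: le_trans (fb_diff (hV j) r2 b3) _; rewrite ler_wpM2l.
have T4 := ler_normD ('d (V j) (w.1 + a) r1 - 'd (V j) (w.1) r1) (eps *: 'd (V j) (w.1 + a) r2).
have h0 := normr_ge0 h; have a0 := normr_ge0 a; have bb0 := normr_ge0 b.
set N := `|w' - w| in d3 d5 N0 N2 hh *.
have Q1 : `|h| * `|b| <= eps * N ^+ 2.
  by apply: le_trans (ler_pM h0 bb0 d3 d5) _; rewrite mulrCA.
have Q2 : `|a| * `|h| ^+ 2 <= eps * 2 * N ^+ 2.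
  by apply: ler_pM => //; rewrite exprn_ge0.
have Q3 : `|b| ^+ 2 <= eps * N ^+ 2.
  apply: (@le_trans _ _ ((eps * N) ^+ 2)).
    by rewrite lerXn2r ?nnegrE// mulr_ge0// ltW.
  by rewrite exprMn ler_wpM2r// expr2 ler_piMl// ltW.
have Q4 := ler_wpM2l C0 (lerD (lerD Q1 Q2) Q3).
have eN : 0 <= eps * (C * N ^+ 2) by rewrite !mulr_ge0// ltW.
lra.
Qed.

End DifferenceQuotient.

(** * Expansions of difference quotients of solutions *)

Section Difference.
Variables (R : realType) (E : normedModType R) (K : nat).
Variables (alpha t0 t1 : R) (Z : R -> 'rV[R]_K) (ZZ : R -> R -> 'M[R]_K).
Hypothesis halpha : 3^-1 < alpha <= 2^-1.

Lemma germ_pair (Y1 Y2 : R -> 'I_K -> E) (Y1' Y2' : R -> 'I_K -> 'I_K -> E) s t :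
  germ Z ZZ (fun r j => (Y1 r j, Y2 r j) : E * E) (fun r k j => (Y1' r k j, Y2' r k j)) s t
  = (germ Z ZZ Y1 Y1' s t, germ Z ZZ Y2 Y2' s t).
Proof.
rewrite /germ !sum_pair; congr (_, _); congr (_ + _);
  by apply: eq_bigr => k _; rewrite sum_pair.
Qed.

Lemma germ_scaleB (a : R) (Y1 Y2 : R -> 'I_K -> E) (Y1' Y2' : R -> 'I_K -> 'I_K -> E) s t :
  germ Z ZZ (fun r j => a *: (Y1 r j - Y2 r j)) (fun r k j => a *: (Y1' r k j - Y2' r k j)) s t
  = a *: (germ Z ZZ Y1 Y1' s t - germ Z ZZ Y2 Y2' s t).
Proof.
have aux (u : 'I_K -> R) (f g : 'I_K -> E) :
    \sum_j u j *: (a *: (f j - g j)) = a *: (\sum_j u j *: f j - \sum_j u j *: g j).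
  rewrite -sumrB scaler_sumr; apply: eq_bigr => j _.
  by rewrite -scalerBr !scalerA mulrC.
rewrite /germ /= aux; under eq_bigr do rewrite aux.
by rewrite -scaler_sumr sumrB -scalerDr addrACA opprD.
Qed.

(** The expansion is linear in the path and the fields, so that the remainder of
    the difference quotient is the difference quotient of the remainders. *)
Lemma davie_rem_quotient (eps : R) (V : 'I_K -> E -> E) (F : 'I_K -> 'I_K -> E -> E)
    (V0 : E -> E) (x y : R -> E) (s t : R) : eps != 0 ->
  davie_rem Z ZZ (fun j => quotient_field eps (V j))
    (fun k j => quotient_field eps (F k j)) (quotient_field eps V0)
    (fun r => (x r, eps^-1 *: (y r - x r))) s t =
  (davie_rem Z ZZ V F V0 x s t,
   eps^-1 *: (davie_rem Z ZZ V F V0 y s t - davie_rem Z ZZ V F V0 x s t)).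
Proof.
move=> e0; rewrite /davie_rem /quotient_field /=.
have xy r : x r + eps *: (eps^-1 *: (y r - x r)) = y r.
  by rewrite scalerA mulfV// scale1r subrKC.
under eq_fun do under eq_fun do rewrite xy.
under [X in germ _ _ _ X]eq_fun do under eq_fun do under eq_fun do rewrite xy.
rewrite germ_pair germ_scaleB xy.
congr (_, _); rewrite /=.
rewrite scalerA mulrC -scalerA -!scalerBr -scalerDr -scalerBr; congr (_ *: _).
rewrite scalerBr; set vx := (t - s) *: V0 (x s); set vy := (t - s) *: V0 (y s).
move: (germ _ _ _ _ _ _) (germ _ _ _ _ _ _) vx vy => gy gx vx vy.
rewrite !opprD !opprK !addrA.
by rewrite [LHS](AC 8 (1*3*5*7*2*4*6*8)) /=.
Qed.

(** The a priori bound for the system of (x, (y - x) / eps).  The set B on which the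
    fields are tame constrains the second component to a ball of radius 2; a path
    starting in the unit ball moves by at most 1 / 2 on a short interval, which
    closes the continuity argument. *)
Lemma difference_bound (CZ rho : R) (n : nat) (c : 'I_n -> E -> R) (e : 'I_n -> E)
    (V : 'I_K -> E -> E) (V0 : E -> E) :
  coordinates c e -> (forall j, smooth_field c (V j)) -> smooth_field c V0 ->
  0 <= CZ -> rough_path_bound alpha t0 t1 Z ZZ CZ -> chen t0 t1 Z ZZ ->
  exists2 h, 0 < h <= 1 & exists2 M, 0 <= M &
  let Rem := davie_rem Z ZZ V (fun k j x => 'd (V j) x (V k x)) V0 in
  forall (a b eps C0 : R) (x y : R -> E),
  t0 <= a -> a <= b -> b <= t1 -> b - a <= h -> 0 < eps -> eps <= 1 -> 0 <= C0 ->
  (forall t, a <= t -> t <= b -> `|x t| <= rho) ->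
  (forall s t, a <= s -> s <= t -> t <= b ->
     [/\ `|x t - x s| <= C0 * hpow alpha (t - s), `|y t - y s| <= C0 * hpow alpha (t - s),
      `|Rem x s t| <= C0 * hpow alpha (t - s) ^+ 3 &
      `|Rem y s t| <= C0 * hpow alpha (t - s) ^+ 3]) ->
  `|y a - x a| <= eps ->
  forall s t, a <= s -> s <= t -> t <= b ->
  [/\ `|y s - x s| <= 2 * eps, `|x t - x s| <= M * hpow alpha (t - s),
     `|Rem x s t| <= M * hpow alpha (t - s) ^+ 3 &
     `|Rem y s t - Rem x s t| <= M * eps * hpow alpha (t - s) ^+ 3].
Proof.
move=> hE hV hV0 CZ0 hb hc.
have hF k j : smooth_field c (fun x => 'd (V j) x (V k x)).
  exact: (smooth_field_directional hE (hV j) (hV k)).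
have [C1 C10 H1] : exists2 C, 0 <= C & forall j, field_bounds C (rho + 2) (V j).
  apply: exists_common_bound => [j C C'|j]; first exact: field_bounds_mono.
  exact: (smooth_field_bounds hE _ (hV _)).
have [C2 C20 H2] : exists2 C, 0 <= C & forall kj : 'I_K * 'I_K,
    field_bounds C (rho + 2) (fun x => 'd (V kj.2) x (V kj.1 x)).
  apply: exists_common_bound => [j C C'|[k j]]; first exact: field_bounds_mono.
  exact: (smooth_field_bounds hE _ (hF k j)).
have [C3 C30 H3] := smooth_field_bounds hE (rho + 2) hV0.
pose C := C1 + C2 + C3; have C0 : 0 <= C by rewrite !addr_ge0.
pose L := 5 * C + 2 * `|rho| + 4.
have L0 : 0 <= L by rewrite !addr_ge0// mulr_ge0.
have hT eps : 0 < eps -> eps <= 1 ->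
    tame L [set w : E * E | `|w.1| <= rho /\ `|w.2| <= 2]
    (fun j => quotient_field eps (V j))
    (fun k j => quotient_field eps (fun x => 'd (V j) x (V k x)))
    (quotient_field eps V0).
  move=> e0 e1; apply: quotient_field_tame => //.
  - by move=> j; apply: field_bounds_mono (H1 j); rewrite /C; lra.
  - by move=> k j; apply: field_bounds_mono (H2 (k, j)); rewrite /C; lra.
  - by apply: field_bounds_mono H3; rewrite /C; lra.
  - by move=> j x; exact: (smooth_field_differentiable hE x (hV j)).
have th1 := sewing_ratio_lt1 halpha.
have b30 : 0 <= defect_const K CZ L := defect_const_ge0 K CZ0 L0.
have M0 : 0 <= davie_const K alpha CZ L := davie_const_ge0 K halpha CZ0 L0.
set M := davie_const K alpha CZ L in M0.
(* The first entry makes the contraction absorb the defect, the second makes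
   the path move by at most 1 / 2. *)
pose q := Num.min ((1 - sewing_ratio alpha) / 2 / (defect_const K CZ L + 1)) (2^-1 / (M + 1)).
have q0 : 0 < q.
  by rewrite lt_min !divr_gt0 ?invr_gt0//; lra.
have q1 : defect_const K CZ L * q <= (1 - sewing_ratio alpha) / 2.
  apply: (@le_trans _ _ ((defect_const K CZ L + 1) * q)); first by rewrite ler_wpM2r ?lerDl ?ltW.
  by rewrite mulrC -ler_pdivlMr ?ge_min ?lexx//; lra.
have q2 : M * q <= 2^-1.
  apply: (@le_trans _ _ ((M + 1) * q)); first by rewrite ler_wpM2r ?lerDl ?ltW.
  by rewrite mulrC -ler_pdivlMr ?ge_min ?lexx ?orbT//; lra.
have [h [h0 h1 hq]] := hpow_small halpha q0.
exists h; first by rewrite h0.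
exists M => // Rem a b eps D x y ta ab bt bah e0 e1 D0 xr hD ya.
have en0 : eps != 0 by rewrite gt_eqF.
pose w t : E * E := (x t, eps^-1 *: (y t - x t)).
have wn (u : E) (m : R) : (`|eps^-1 *: u| <= m) = (`|u| <= eps * m).
  by rewrite normrZ gtr0_norm ?invr_gt0// ler_pdivrMl.
pose B := [set w : E * E | `|w.1| <= rho /\ `|w.2| <= 2].
pose RemW := davie_rem Z ZZ (fun j => quotient_field eps (V j))
    (fun k j => quotient_field eps (fun x => 'd (V j) x (V k x)))
    (quotient_field eps V0) w.
have RemWE s t : RemW s t = (Rem x s t, eps^-1 *: (Rem y s t - Rem x s t)).
  exact: davie_rem_quotient.
(* This constant blows up as eps tends to 0; the a priori bound only asks it to be
   finite. *)
pose D' := D + eps^-1 * (D + D).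
have D'0 : 0 <= D' by rewrite addr_ge0// mulr_ge0 ?addr_ge0// invr_ge0 ltW.
have HD' s t : a <= s -> s <= t -> t <= b -> `|RemW s t| <= D' * hpow alpha (t - s) ^+ 3.
  move=> as_ st tb; have [_ _ r1 r2] := hD s t as_ st tb.
  have p30 : 0 <= hpow alpha (t - s) ^+ 3 by rewrite exprn_ge0// hpow_ge0.
  rewrite RemWE; apply: prod_norm_le.
    by apply: le_trans r1 _; rewrite ler_wpM2r// lerDl mulr_ge0 ?addr_ge0// invr_ge0 ltW.
  rewrite wn; apply: le_trans (ler_normB _ _) _.
  have eD := mulr_ge0 (mulr_ge0 (ltW e0) D0) p30.
  rewrite /D' mulrDl mulrDr !mulrA mulfV// mul1r; lra.
have boot b' : a <= b' -> b' <= b -> (forall t, a <= t -> t <= b' -> `|(w t).2| <= 2) ->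
   forall s t, a <= s -> s <= t -> t <= b' ->
    `|RemW s t| <= M * hpow alpha (t - s) ^+ 3 /\ `|w t - w s| <= M * hpow alpha (t - s).
  move=> ab' b'b hw s t as_ st tb'.
  apply: (@davie_bootstrap R K alpha t0 t1 Z ZZ halpha CZ L CZ0 L0 hb hc _ B _ _ _
    (hT eps e0 e1) q a b' D' w) => //.
  - exact: ltW.
  - exact: le_trans bt.
  - by lra.
  - by apply: le_trans hq; apply: hpow_le; [|lra|lra].
  - by move=> r ar rb'; split; [apply: xr => //; exact: le_trans b'b|exact: hw].
  - by move=> s' t' *; apply: HD' => //; exact: le_trans b'b.
have half b' : a <= b' -> b' <= b -> (forall t, a <= t -> t <= b' -> `|(w t).2| <= 2) ->
   forall t, a <= t -> t <= b' -> `|(w t).2| <= 3 / 2.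
  move=> ab' b'b hw t at_ tb'.
  have [_ i] := boot b' ab' b'b hw a t (lexx _) at_ tb'.
  have [_ i2] := le_prod_norm (w t - w a).
  have i3 : M * hpow alpha (t - a) <= M * q.
    rewrite ler_wpM2l//; apply: le_trans hq; apply: hpow_le => //; [lra|lra].
  have i4 : `|(w a).2| <= 1 by rewrite wn mulr1.
  have := ler_normD ((w t).2 - (w a).2) (w a).2.
  rewrite subrK /=; have := le_trans i2 (le_trans i (le_trans i3 q2)); rewrite /=; lra.
have [eta [eta0 eta1 etaq]] : exists eta, [/\ 0 < eta, eta <= 1 &
    hpow alpha eta <= eps / (4 * (D + 1))].
  by apply: hpow_small => //; rewrite divr_gt0// mulr_gt0//; lra.
have etaD : 2 * D * hpow alpha eta <= eps / 2.
  have : (4 * (D + 1)) * hpow alpha eta <= eps.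
    by rewrite mulrC -ler_pdivlMr// mulr_gt0//; lra.
  have := hpow_ge0 alpha eta; lra.
(* By the Hoelder bound the second component moves by at most 1 / 2 over a time
   eta, which takes it from 3 / 2 to 2; the bound 3 / 2 is then recovered. *)
have stepping (m : nat) t : a <= t -> t <= b -> t <= a + m%:R * eta -> `|(w t).2| <= 2.
  elim: m t => [|m IH] t at_ tb.
    rewrite mul0r addr0 => ta'; have -> : t = a by apply/eqP; rewrite eq_le ta' at_.
    by rewrite wn; lra.
  move=> tm; have [tm'|tm'] := leP t (a + m%:R * eta); first exact: IH.
  set b' := a + m%:R * eta in tm' IH.
  have ab' : a <= b' by rewrite lerDl mulr_ge0// ltW.
  have b'b : b' <= b by apply: le_trans tb; exact: ltW.
  have hb' : `|(w b').2| <= 3 / 2.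
    by apply: (half b') => // r ar rb'; apply: IH => //; exact: le_trans b'b.
  have [d1 d2 _ _] := hD b' t ab' (ltW tm') tb.
  have d3 : hpow alpha (t - b') <= hpow alpha eta.
    apply: hpow_le => //; first by rewrite subr_ge0 ltW.
    by move: tm; rewrite -[m.+1]addn1 natrD mulrDl mul1r addrA -/b'; lra.
  have d4 : D * hpow alpha (t - b') <= D * hpow alpha eta by rewrite ler_wpM2l.
  have d5 : `|(w t).2 - (w b').2| <= 2^-1.
    rewrite /= -scalerBr wn.
    have -> : y t - x t - (y b' - x b') = y t - y b' - (x t - x b').
      by rewrite !opprB addrACA [in RHS]addrACA; congr (_ + _); rewrite addrC.
    by apply: le_trans (ler_normB _ _) _; lra.
  have := ler_normD ((w t).2 - (w b').2) (w b').2; rewrite subrK /=; move: d5 hb' => /=.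
  lra.
have w2 t : a <= t -> t <= b -> `|(w t).2| <= 2.
  move=> at_ tb; pose m := (Num.truncn ((t - a) / eta)).+1.
  apply: (stepping m) => //; rewrite -lerBlDl -ler_pdivrMr//.
  by apply: ltW; rewrite /m truncnS_gt.
move=> s t as_ st tb.
have [k1 k2] := boot b ab (lexx _) w2 s t as_ st tb.
have [k3 k4] := le_prod_norm (RemW s t); have [k5 _] := le_prod_norm (w t - w s).
split.
- by have := w2 s as_ (le_trans st tb); rewrite wn mulrC.
- exact: le_trans k5 k2.
- by have := le_trans k3 k1; rewrite RemWE.
- by have := le_trans k4 k1; rewrite RemWE wn mulrA [eps * M]mulrC.
Qed.

End Difference.

(** * Increments of rough integrals *)

Section RiemannSum.
Variables (R : realType) (W : normedModType R) (G : R -> R -> W).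

Fixpoint riemann_sum (s : R) (P : seq R) : W :=
  if P is u :: P' then G s u + riemann_sum u P' else 0.

Lemma riemann_sum_cat s P Q :
  riemann_sum s (P ++ Q) = riemann_sum s P + riemann_sum (last s P) Q.
Proof. by elim: P s => [|u P IH] s /=; rewrite ?add0r// IH addrA. Qed.

Lemma riemann_sumE (d s : R) (P : seq R) :
  \sum_(0 <= n < size P) G (nth d (s :: P) n) (nth d (s :: P) n.+1) = riemann_sum s P.
Proof.
elim: P s => [|u P IH] s; first by rewrite big_nil.
by rewrite /= big_nat_recl//= -IH.
Qed.

Variables (alpha t0 t1 A : R).
Hypothesis halpha : 3^-1 < alpha <= 2^-1.
Hypothesis A0 : 0 <= A.
Hypothesis hG : forall s u t, t0 <= s -> s <= u -> u <= t -> t <= t1 ->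
  `|G s t - G s u - G u t| <= A * hpow alpha (t - s) ^+ 3.

Local Notation M := (A / (1 - sewing_ratio alpha)).

Lemma sewing_const_ge0 : 0 <= M.
Proof. by rewrite divr_ge0// subr_ge0 ltW// sewing_ratio_lt1. Qed.

(** The constant M is the fixed point of M = sewing_ratio * M + A, so that it is
    reproduced at every bisection. *)
Lemma dyadic_partition n s t : t0 <= s -> s < t -> t <= t1 ->
  exists P, [/\ itv_partition s t P, path (fun u v => v - u <= (t - s) / 2 ^+ n) s P &
    `|riemann_sum s P - G s t| <= M * hpow alpha (t - s) ^+ 3].
Proof.
elim: n s t => [|n IH] s t h1 h2 h3.
  exists [:: t]; split; first exact: itv_partition1.
    by rewrite /= expr0 divr1 lexx.
  by rewrite /= addr0 subrr normr0 mulr_ge0 ?sewing_const_ge0// exprn_ge0// hpow_ge0.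
have m1 : s < (s + t) / 2 by lra.
have m2 : (s + t) / 2 < t by lra.
have [P [P1 P2 P3]] := IH _ _ h1 m1 (le_trans (ltW m2) h3).
have [Q [Q1 Q2 Q3]] := IH _ _ (le_trans h1 (ltW m1)) m2 h3.
have lastP : last s P = (s + t) / 2 by case: P1 => _ /eqP.
exists (P ++ Q); split; first exact: itv_partition_cat P1 Q1.
  rewrite cat_path lastP; apply/andP; split.
    apply: sub_path P2 => u v; rewrite exprS invfM mulrA.
    by have -> : (s + t) / 2 - s = (t - s) / 2 by field.
  apply: sub_path Q2 => u v; rewrite exprS invfM mulrA.
  by have -> : t - (s + t) / 2 = (t - s) / 2 by field.
rewrite riemann_sum_cat lastP.
have -> : riemann_sum s P + riemann_sum ((s + t) / 2) Q - G s t =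
  (riemann_sum s P - G s ((s + t) / 2)) + (riemann_sum ((s + t) / 2) Q - G ((s + t) / 2) t)
  - (G s t - G s ((s + t) / 2) - G ((s + t) / 2) t).
  set x := riemann_sum _ _; set y := riemann_sum _ _.
  rewrite !opprB !addrA.
  by rewrite [RHS](AC (1*1*1*1*1*1*1) (1*3*7*((2*6)*(4*5)))) /= addNr add0r addNr addr0.
apply: le_trans (ler_normB _ _) _.
have h := ler_normD (riemann_sum s P - G s ((s + t) / 2))
  (riemann_sum ((s + t) / 2) Q - G ((s + t) / 2) t).
apply: le_trans (lerD (le_trans h (lerD P3 Q3)) (hG h1 (ltW m1) (ltW m2) h3)) _.
rewrite midpoint_hpow//; last exact: le_trans (ltW m1) (ltW m2).
rewrite le_eqVlt; apply/orP; left; apply/eqP; field.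
by rewrite gt_eqF// subr_gt0 sewing_ratio_lt1.
Qed.

Lemma fine_partition (d s t : R) : 0 < d -> t0 <= s -> s <= t -> t <= t1 ->
  exists P, [/\ itv_partition s t P, path (fun u v => v - u < d) s P &
    `|riemann_sum s P - G s t| <= M * hpow alpha (t - s) ^+ 3].
Proof.
move=> d0 h1; rewrite le_eqVlt => /predU1P[<-{t} h3|h2 h3].
  exists [::]; split; [by split => /=|by []|rewrite /=].
  have := hG h1 (lexx _) (lexx _) h3.
  by rewrite !subrr (hpow0 halpha)// expr0n /= !mulr0 sub0r normrN.
have [P [P1 P2 P3]] := dyadic_partition
  (Num.truncn ((t - s) / d)).+1 h1 h2 h3.
exists P; split => //; apply: sub_path P2 => u v /le_lt_trans; apply.
rewrite ltr_pdivrMr ?exprn_gt0// mulrC -ltr_pdivrMr//.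
apply: lt_trans (truncnS_gt _) _.
by rewrite -natrX ltr_nat ltn_expl.
Qed.

End RiemannSum.

Section RoughIntegral.
Variables (R : realType) (K : nat).
Variables (alpha t0 t1 : R) (Z : R -> 'rV[R]_K) (ZZ : R -> R -> 'M[R]_K).
Hypothesis halpha : 3^-1 < alpha <= 2^-1.
Variables (W : normedModType R) (Y : R -> 'I_K -> W) (Y' : R -> 'I_K -> 'I_K -> W).
Variable (A : R).
Hypothesis A0 : 0 <= A.
Hypothesis hG : forall s u t, t0 <= s -> s <= u -> u <= t -> t <= t1 ->
  `|germ Z ZZ Y Y' s t - germ Z ZZ Y Y' s u - germ Z ZZ Y Y' u t|
     <= A * hpow alpha (t - s) ^+ 3.

Local Notation M := (A / (1 - sewing_ratio alpha)).

Lemma rough_integral_approx s t (I : W) :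
  is_rough_integral Z ZZ s t Y Y' I -> forall e, 0 < e -> exists2 d, 0 < d &
  forall P, itv_partition s t P -> path (fun u v => v - u < d) s P ->
    `|riemann_sum (germ Z ZZ Y Y') s P - I| < e.
Proof.
move=> hI e e0; have [d d0 H] := hI e e0; exists d => // P P1 P2.
rewrite -(riemann_sumE _ t); apply: H => // n nP.
exact: (pathP t P2).
Qed.

(** Refining a partition of [r, t] that contains s separates the integral over
    [r, s] from a sum over [s, t], which stays close to a single germ. *)
Lemma rough_integral_increment_l r s t (I1 I2 : W) :
  t0 <= r -> r <= s -> s <= t -> t <= t1 ->
  is_rough_integral Z ZZ r s Y Y' I1 -> is_rough_integral Z ZZ r t Y Y' I2 ->
  `|I2 - I1 - germ Z ZZ Y Y' s t| <= M * hpow alpha (t - s) ^+ 3.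
Proof.
move=> h1 h2 h3 h4 hI1 hI2; apply/ler_addgt0Pr => e e0.
have [d1 d10 H1] := rough_integral_approx hI1 (divr_gt0 e0 (ltr0Sn R 1)).
have [d2 d20 H2] := rough_integral_approx hI2 (divr_gt0 e0 (ltr0Sn R 1)).
pose d := Num.min d1 d2; have d0 : 0 < d by rewrite lt_min d10.
have sub1 u v : v - u < d -> v - u < d1 by rewrite lt_min => /andP[].
have sub2 u v : v - u < d -> v - u < d2 by rewrite lt_min => /andP[].
have [P [P1 P2 _]] := fine_partition halpha A0 hG d0 h1 h2 (le_trans h3 h4).
have [Q [Q1 Q2 Q3]] := fine_partition halpha A0 hG d0 (le_trans h1 h2) h3 h4.
have lastP : last r P = s by case: P1 => _ /eqP.
have k1 := H1 P P1 (sub_path sub1 P2).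
have k2 := H2 (P ++ Q) (itv_partition_cat P1 Q1).
have {}k2 := k2 _; rewrite cat_path lastP (sub_path sub2 P2) (sub_path sub2 Q2) in k2.
have {k2} := k2 isT; rewrite riemann_sum_cat lastP.
move: k1 Q3; set x := riemann_sum _ _ _; set y := riemann_sum _ _ _ => k1 k3 k2.
have -> : I2 - I1 - germ Z ZZ Y Y' s t = (y - germ Z ZZ Y Y' s t) + ((x - I1) - (x + y - I2)).
  move: (germ Z ZZ Y Y' s t) => g; rewrite !opprB !opprD !addrA.
  by rewrite [RHS](AC (1*1*1*1*1*1*1) (5*4*2*((1*7)*(3*6)))) /= !subrr !addr0.
apply: le_trans (ler_normD _ _) _; apply: lerD => //.
by apply: le_trans (ler_normB _ _) _; lra.
Qed.

(** The momentum equation integrates up to the final time, whence this variant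
    with a common right end point. *)
Lemma rough_integral_increment_r s t r (I1 I2 : W) :
  t0 <= s -> s <= t -> t <= r -> r <= t1 ->
  is_rough_integral Z ZZ s r Y Y' I1 -> is_rough_integral Z ZZ t r Y Y' I2 ->
  `|I1 - I2 - germ Z ZZ Y Y' s t| <= M * hpow alpha (t - s) ^+ 3.
Proof.
move=> h1 h2 h3 h4 hI1 hI2; apply/ler_addgt0Pr => e e0.
have [d1 d10 H1] := rough_integral_approx hI1 (divr_gt0 e0 (ltr0Sn R 1)).
have [d2 d20 H2] := rough_integral_approx hI2 (divr_gt0 e0 (ltr0Sn R 1)).
pose d := Num.min d1 d2; have d0 : 0 < d by rewrite lt_min d10.
have sub1 u v : v - u < d -> v - u < d1 by rewrite lt_min => /andP[].
have sub2 u v : v - u < d -> v - u < d2 by rewrite lt_min => /andP[].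
have [P [P1 P2 P3]] := fine_partition halpha A0 hG d0 h1 h2 (le_trans h3 h4).
have [Q [Q1 Q2 _]] := fine_partition halpha A0 hG d0 (le_trans h1 h2) h3 h4.
have lastP : last s P = t by case: P1 => _ /eqP.
have k2 := H2 Q Q1 (sub_path sub2 Q2).
have k1 := H1 (P ++ Q) (itv_partition_cat P1 Q1).
have {}k1 := k1 _; rewrite cat_path lastP (sub_path sub1 P2) (sub_path sub1 Q2) in k1.
have {k1} := k1 isT; rewrite riemann_sum_cat lastP.
move: k2 P3; set x := riemann_sum _ _ _; set y := riemann_sum _ _ _ => k2 k3 k1.
have -> : I1 - I2 - germ Z ZZ Y Y' s t = (y - germ Z ZZ Y Y' s t) + ((x - I2) - (y + x - I1)).
  move: (germ Z ZZ Y Y' s t) => g; rewrite !opprB !opprD !addrA.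
  by rewrite [RHS](AC (1*1*1*1*1*1*1) (5*4*2*((1*6)*(3*7)))) /= !subrr !addr0.
apply: le_trans (ler_normD _ _) _; apply: lerD => //.
by apply: le_trans (ler_normB _ _) _; lra.
Qed.

End RoughIntegral.

(** * Phase space and Hamiltonian vector fields *)

Lemma diff_oppE (R : realType) (V W : normedModType R) (f : V -> W) x h :
  differentiable f x -> 'd (fun y => - f y) x h = - 'd f x h :> W.
Proof. by move=> df; rewrite (diffN df). Qed.

Section Phase.
Variables (R : realType) (N : nat).
Local Notation E := (phase R N).

Definition phase_coord (i : 'I_(N + N)) (x : E) : R :=
  match fintype.split i with inl j => x.1 0 j | inr j => x.2 0 j end.

Definition phase_basis (i : 'I_(N + N)) : E :=
  match fintype.split i with inl j => (delta_mx 0 j, 0) | inr j => (0, delta_mx 0 j) end.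

Lemma phase_coordl j x : phase_coord (lshift N j) x = x.1 0 j.
Proof. by rewrite /phase_coord (unsplitK (inl j)). Qed.

Lemma phase_coordr j x : phase_coord (rshift N j) x = x.2 0 j.
Proof. by rewrite /phase_coord (unsplitK (inr j)). Qed.

Lemma row_norm_leP (u : 'rV[R]_N) (C : R) : 0 <= C ->
  (`|u| <= C) <-> (forall j, `|u 0 j| <= C).
Proof.
move=> C0; have -> : `|u| = mx_norm u by []; rewrite mx_normrE; split => [/bigmax_leP [_ H] j|H].
  exact: (H (0, j)).
by apply/bigmax_leP; split => // -[i j] _ /=; rewrite ord1.
Qed.

Lemma phase_norm_leP (x : E) (C : R) : 0 <= C ->
  (`|x| <= C) <-> (`|x.1| <= C /\ `|x.2| <= C).
Proof. by move=> C0; rewrite prod_normE ge_max; split => [/andP|[-> ->]]. Qed.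

Lemma row_ball_compact (rho : R) : compact [set u : 'rV[R]_N | `|u| <= rho].
Proof.
have [r0|r0] := leP 0 rho; last first.
  suff -> : [set u : 'rV[R]_N | `|u| <= rho] = set0 by exact: compact0.
  apply/seteqP; split => // u /= hu; have := le_lt_trans hu r0.
  by rewrite normr_lt0.
have := @rV_compact R N (fun=> `[- rho, rho]%classic) (fun=> @segment_compact R _ _).
congr compact; apply/seteqP; split => u /=.
  move=> H; apply/row_norm_leP => // j; rewrite ler_norml.
  by have := H j; rewrite in_itv.
move=> /(row_norm_leP _ r0) H j; have := H j.
by rewrite in_itv /= ler_norml.
Qed.

Lemma phase_coordinates : coordinates phase_coord phase_basis.
Proof.
split.
- by move=> i a x y; rewrite /phase_coord; case: (fintype.split i) => j /=; rewrite !mxE.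
- move=> x; rewrite big_split_ord /=.
  rewrite [X in X + _](@sum_pair R 'rV[R]_N 'rV[R]_N).
  rewrite [X in _ + X](@sum_pair R 'rV[R]_N 'rV[R]_N) /=.
  case: x => q p; congr (_, _) => /=.
    rewrite [X in _ + X]big1 ?addr0; last first.
      by move=> j _; rewrite /phase_basis (unsplitK (inr j)) scaler0.
    rewrite {1}(row_sum_delta q); apply: eq_bigr => j _.
    by rewrite phase_coordl /phase_basis (unsplitK (inl j)).
  rewrite [X in X + _]big1 ?add0r; last first.
    by move=> j _; rewrite /phase_basis (unsplitK (inl j)) scaler0.
  rewrite {1}(row_sum_delta p); apply: eq_bigr => j _.
  by rewrite phase_coordr /phase_basis (unsplitK (inr j)).
- move=> i x; have [h1 h2] := proj1 (phase_norm_leP x (normr_ge0 x)) (lexx _).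
  rewrite /phase_coord; case: (fintype.split i) => j.
    exact: (proj1 (row_norm_leP _ (normr_ge0 x)) h1).
  exact: (proj1 (row_norm_leP _ (normr_ge0 x)) h2).
- move=> x C C0 H; apply/phase_norm_leP => //; split; apply/row_norm_leP => // j.
    by rewrite -phase_coordl.
  by rewrite -phase_coordr.
- move=> rho; have := compact_setX (@row_ball_compact rho) (@row_ball_compact rho).
  congr compact; apply/seteqP; split => -[q p] /=; rewrite prod_normE ge_max.
    by move=> [-> ->].
  by move=> /andP[].
Qed.

(** The symplectic gradient, hence the coefficients of the pair of equations for
    (q, p). *)
Definition ham (H : E -> R) (x : E) : E := (dHdp H x, - dHdq H x).

Lemma ham_smooth (H : E -> R) : smooth_on setT H -> smooth_field phase_coord (ham H).
Proof.
move=> hH i.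
have dH x : differentiable H x by exact: smooth_differentiable hH _.
rewrite -[i]splitK; case: (fintype.split i) => j /=.
  have -> : (fun x => phase_coord (lshift N j) (ham H x)) =
     (fun x => 'd H x ((0, delta_mx 0 j) : E)).
    by apply/funext => x; rewrite phase_coordl /ham/= mxE deriveE.
  exact: smooth_diff.
have -> : (fun x => phase_coord (rshift N j) (ham H x)) =
   (fun x => - 'd H x ((delta_mx 0 j, 0) : E)).
  by apply/funext => x; rewrite phase_coordr /ham/= mxE mxE deriveE.
by apply: smoothN; exact: smooth_diff.
Qed.

Lemma ham_differentiable (H : E -> R) x : smooth_on setT H -> differentiable (ham H) x.
Proof.
move=> hH; exact: (smooth_field_differentiable phase_coordinates x (ham_smooth hH)).
Qed.

Lemma diff_fst (V : normedModType R) (f : V -> E) x h :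
  differentiable f x -> ('d f x h).1 = 'd (fun y => (f y).1) x h.
Proof.
move=> df; have lin : linear (fst : E -> 'rV[R]_N) by move=> a u v.
pose L : {linear E -> 'rV[R]_N} := HB.pack (fst : E -> 'rV[R]_N)
  (GRing.isLinear.Build _ _ _ _ _ lin).
have cL : continuous L by move=> y; exact: cvg_fst.
have dL := @linear_differentiable _ E _ L (f x) cL.
have -> : (fun y => (f y).1) = L \o f by [].
by rewrite (diff_comp df dL) /= diff_lin.
Qed.

Lemma diff_snd (V : normedModType R) (f : V -> E) x : differentiable f x ->
  differentiable (fun y => (f y).2) x /\
  forall h, ('d f x h).2 = 'd (fun y => (f y).2) x h.
Proof.
move=> df; have lin : linear (snd : E -> 'rV[R]_N) by move=> a u v.
pose L : {linear E -> 'rV[R]_N} := HB.pack (snd : E -> 'rV[R]_N)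
  (GRing.isLinear.Build _ _ _ _ _ lin).
have cL : continuous L by move=> y; exact: cvg_snd.
have dL := @linear_differentiable _ E _ L (f x) cL.
have -> : (fun y => (f y).2) = L \o f by [].
split=> [|h]; first exact: (differentiable_comp df dL).
by rewrite (diff_comp df dL) /= diff_lin.
Qed.

Lemma diff_dHdp (H : E -> R) x h : smooth_on setT H ->
  'd (dHdp H) x h = ('d (ham H) x h).1.
Proof. by move=> hH; rewrite diff_fst//; exact: ham_differentiable. Qed.

Lemma diff_dHdq (H : E -> R) x h : smooth_on setT H ->
  'd (dHdq H) x h = - ('d (ham H) x h).2.
Proof.
move=> hH; have [dq qE] := diff_snd (ham_differentiable x hH).
have hN : dHdq H = (fun y => - (ham H y).2).
  by apply/funext => y; rewrite /ham /= opprK.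
by rewrite hN diff_oppE// qE.
Qed.

End Phase.

(** * Increments of the drift integral *)

Section Drift.
Variables (R : realType) (alpha t0 t1 C : R) (f : R -> R).
Hypothesis halpha : 3^-1 < alpha <= 2^-1.
Hypothesis C0 : 0 <= C.
Hypothesis hf : forall s t, t0 <= s -> s <= t -> t <= t1 ->
  `|f t - f s| <= C * hpow alpha (t - s).

Local Notation mu := (@lebesgue_measure R).

Lemma holder_within_continuous : {within `[t0, t1], continuous f}.
Proof.
apply/subspace_continuousP => x /=; rewrite in_itv /= => /andP[x0 x1].
apply/cvgrPdist_le => e e0.
have [h [h0 _ hh]] := hpow_small halpha (divr_gt0 e0 (ltr_wpDl C0 ltr01)).
have Cp t : 0 <= t -> t <= h -> C * hpow alpha t <= e.
  move=> tt0 th; have : hpow alpha t <= e / (C + 1).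
    by apply: le_trans hh; exact: hpow_le.
  rewrite ler_pdivlMr ?ltr_wpDl// => hp.
  apply: le_trans hp; rewrite mulrC; apply: ler_wpM2l; last by rewrite lerDl.
  exact: hpow_ge0.
rewrite /= near_withinE; near=> y; rewrite /= in_itv /= => /andP[y0 y1].
have yx : `|x - y| <= h by near: y; apply: (@cvgr_dist_le _ _ _ (nbhs x) _ id x) => //.
have [xy|yx'] := leP x y.
  rewrite distrC; apply: le_trans (hf x0 xy y1) _; apply: Cp; first by rewrite subr_ge0.
  by rewrite -[y - x]ger0_norm ?subr_ge0// distrC.
apply: le_trans (hf y0 (ltW yx') x1) _; apply: Cp; first by rewrite subr_ge0 ltW.
by rewrite -[x - y]ger0_norm ?subr_ge0// ltW.
Unshelve. all: by end_near. Qed.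

Lemma holder_integrable s t : t0 <= s -> t <= t1 -> mu.-integrable `[s, t] (EFin \o f).
Proof.
move=> h1 h2; have := continuous_compact_integrable (@segment_compact R t0 t1)
  holder_within_continuous.
apply: integrableS => //.
by apply: subset_itv; rewrite bnd_simp.
Qed.

Lemma drift_bound s t : t0 <= s -> s <= t -> t <= t1 ->
  `|\int[mu]_(r in `[s, t]) f r - (t - s) * f s| <= C * hpow alpha (t - s) * (t - s).
Proof.
move=> h1 h2 h3.
have hI := holder_integrable h1 h3.
have mi : fine (mu `[s, t]) = t - s.
  rewrite lebesgue_measure_itv /= lte_fin; case: ltP => //= ts.
  by apply/eqP; rewrite eq_sym subr_eq0 eq_le ts.
have cI (k : R) : mu.-integrable `[s, t] (EFin \o cst k).
  apply: continuous_compact_integrable; first exact: segment_compact.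
  by apply: continuous_subspaceT => x; exact: cvg_cst.
have cE (k : R) : \int[mu]_(r in `[s, t]) (cst k) r = k * (t - s).
  by rewrite Rintegral_cst// mi.
have p0 := hpow_ge0 alpha (t - s).
have near_fs r : r \in `[s, t] -> `|f r - f s| <= C * hpow alpha (t - s).
  rewrite in_itv /= => /andP[sr rt].
  apply: le_trans (hf h1 sr (le_trans rt h3)) _; rewrite ler_wpM2l//.
  by apply: hpow_le => //; lra.
have up : \int[mu]_(r in `[s, t]) f r <= (f s + C * hpow alpha (t - s)) * (t - s).
  rewrite -cE; apply: le_Rintegral => // r rst.
  have := near_fs r rst; rewrite ler_norml /= => /andP[_]; lra.
have dn : (f s - C * hpow alpha (t - s)) * (t - s) <= \int[mu]_(r in `[s, t]) f r.
  rewrite -cE; apply: le_Rintegral => // r rst.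
  have := near_fs r rst; rewrite ler_norml /= => /andP[+ _]; lra.
move: (Rintegral _ _ _) (f s) up dn => I fs up dn.
by clear -up dn; rewrite ler_norml; apply/andP; split; lra.
Qed.

Lemma drift_increment_l r s t : t0 <= r -> r <= s -> s <= t -> t <= t1 ->
  `|\int[mu]_(u in `[r, t]) f u - \int[mu]_(u in `[r, s]) f u - (t - s) * f s|
    <= C * hpow alpha (t - s) * (t - s).
Proof.
move=> h1 h2 h3 h4.
rewrite Rintegral_itvB ?bnd_simp//; last exact: holder_integrable.
rewrite Rintegral_itv_obnd_cbnd; first by apply: drift_bound => //; exact: le_trans h2.
apply: integrableS (holder_integrable (le_trans h1 h2) h4) => //.
by apply: subset_itv; rewrite bnd_simp.
Qed.

Lemma drift_increment_r s t r : t0 <= s -> s <= t -> t <= r -> r <= t1 ->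
  `|\int[mu]_(u in `[s, r]) f u - \int[mu]_(u in `[t, r]) f u - (t - s) * f s|
    <= C * hpow alpha (t - s) * (t - s).
Proof.
move=> h1 h2 h3 h4.
have e1 : \int[mu]_(u in `[s, r]) f u - \int[mu]_(u in `[s, t]) f u =
   \int[mu]_(u in `[t, r]) f u.
  rewrite Rintegral_itvB ?bnd_simp//; last exact: holder_integrable.
  rewrite Rintegral_itv_obnd_cbnd//.
  apply: integrableS (holder_integrable (le_trans h1 h2) h4) => //.
  by apply: subset_itv; rewrite bnd_simp.
by rewrite -e1 subKr; apply: drift_bound => //; exact: le_trans h4.
Qed.

End Drift.

(** * Second-order expansion of the solutions *)

Section Controlled.
Variables (R : realType) (K : nat).
Variables (alpha t0 t1 : R) (Z : R -> 'rV[R]_K) (ZZ : R -> R -> 'M[R]_K).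
Hypothesis halpha : 3^-1 < alpha <= 2^-1.

Lemma holder2_hpow (W : normedModType R) (G : R -> R -> W) :
  holder2 t0 t1 alpha G -> exists2 C, 0 <= C &
  forall s t, t0 <= s -> s <= t -> t <= t1 -> `|G s t| <= C * hpow alpha (t - s).
Proof.
move=> [C HC]; exists `|C| => // s t h1 h2 h3; apply: le_trans (HC s t h1 h2 h3) _.
by rewrite ler_wpM2r ?ler_norm// powR_ge0.
Qed.

Lemma holder2_hpow_sq (W : normedModType R) (G : R -> R -> W) :
  holder2 t0 t1 (2 * alpha) G -> exists2 C, 0 <= C &
  forall s t, t0 <= s -> s <= t -> t <= t1 -> `|G s t| <= C * hpow alpha (t - s) ^+ 2.
Proof.
move=> [C HC]; exists `|C| => // s t h1 h2 h3; apply: le_trans (HC s t h1 h2 h3) _.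
by rewrite hpow_sq ?subr_ge0// ler_wpM2r ?ler_norm// exprn_ge0// hpow_ge0.
Qed.

Lemma le_mx_norm m n (M : 'M[R]_(m, n)) i j : `|M i j| <= `|M|.
Proof.
have -> : `|M| = mx_norm M by [].
rewrite mx_normrE; apply: (le_trans _ (le_bigmax _ (fun ij => `|M ij.1 ij.2|) (i, j))).
by [].
Qed.

Lemma geometric_rough_path_bound : geometric_rough_path alpha t0 t1 Z ZZ ->
  (exists2 CZ, 0 <= CZ & rough_path_bound alpha t0 t1 Z ZZ CZ) /\ chen t0 t1 Z ZZ.
Proof.
move=> hZ; split.
  have [C1 C10 H1] := holder2_hpow (rough_path_holder1 hZ).
  have [C2 C20 H2] := holder2_hpow_sq (rough_path_holder2 hZ).
  exists (C1 + C2); first exact: addr_ge0.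
  move=> s t h1 h2 h3; split=> [j|k j].
    apply: le_trans (le_mx_norm _ 0 j) _; apply: le_trans (H1 s t h1 h2 h3) _.
    by rewrite ler_wpM2r ?hpow_ge0// lerDl.
  apply: le_trans (le_mx_norm _ k j) _; apply: le_trans (H2 s t h1 h2 h3) _.
  by rewrite ler_wpM2r ?exprn_ge0 ?hpow_ge0// lerDr.
move=> s u t h1 h2 h3 h4 k j; rewrite (rough_path_chen hZ h1 h2 h3 h4) !mxE.
by rewrite big_ord1 !mxE.
Qed.

(** The Hoelder bound on the Gubinelli derivative bounds it on the whole interval;
    with the first-order expansion this confines the path to a ball, where the
    fields are controlled. *)
Lemma controlled_path_bounds (E : normedModType R) (n : nat) (c : 'I_n -> E -> R)
    (e : 'I_n -> E) (V : 'I_K -> E -> E) (V0 : E -> E) (CZ : R) (x : R -> E) :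
  coordinates c e -> (forall j, smooth_field c (V j)) -> smooth_field c V0 ->
  0 <= CZ -> rough_path_bound alpha t0 t1 Z ZZ CZ -> chen t0 t1 Z ZZ ->
  controlled alpha t0 t1 Z x (fun r k => V k (x r)) ->
  exists2 rho, (forall t, t0 <= t -> t <= t1 -> `|x t| <= rho) &
  exists2 C, 0 <= C &
   [/\ forall s t, t0 <= s -> s <= t -> t <= t1 -> `|x t - x s| <= C * hpow alpha (t - s),
    forall s t, t0 <= s -> s <= t -> t <= t1 -> `|V0 (x t) - V0 (x s)| <= C * hpow alpha (t - s)
    & let G := germ Z ZZ (fun r j => V j (x r)) (fun r k j => 'd (V j) (x r) (V k (x r))) in
    forall s u t, t0 <= s -> s <= u -> u <= t -> t <= t1 ->
    `|G s t - G s u - G u t| <= C * hpow alpha (t - s) ^+ 3 ].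
Proof.
move=> hE hV hV0 CZ0 hb hc [hx1 hx2].
have [C1 C10 H1] : exists2 C, 0 <= C & forall k, forall s t, t0 <= s -> s <= t -> t <= t1 ->
    `|V k (x t) - V k (x s)| <= C * hpow alpha (t - s).
  apply: exists_common_bound => [k C C' CC' H s t *|k].
    by apply: le_trans (H s t _ _ _) _ => //; rewrite ler_wpM2r// hpow_ge0.
  exact: holder2_hpow (hx1 k).
have [C2 C20 H2] := holder2_hpow_sq hx2.
pose P := hpow alpha (t1 - t0); have P0 : 0 <= P by exact: hpow_ge0.
have [B B0 HB] : exists2 B, 0 <= B & forall k, `|V k (x t0)| <= B.
  apply: exists_common_bound => [k C C' CC' /le_trans|k]; first exact.
  by exists `|V k (x t0)|.
have pP s t : t0 <= s -> s <= t -> t <= t1 -> hpow alpha (t - s) <= P.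
  by move=> *; apply: hpow_le => //; lra.
have VB k s : t0 <= s -> s <= t1 -> `|V k (x s)| <= B + C1 * P.
  move=> h1 h2; have -> : V k (x s) = V k (x t0) + (V k (x s) - V k (x t0)) by rewrite subrKC.
  apply: le_trans (ler_normD _ _) _; apply: lerD; first exact: HB.
  apply: le_trans (H1 k t0 s _ _ _) _ => //.
  by rewrite ler_wpM2l// pP.
pose C3 := C2 * P + K%:R * (CZ * (B + C1 * P)).
have BP0 : 0 <= B + C1 * P by rewrite addr_ge0// mulr_ge0.
have C30 : 0 <= C3 by rewrite addr_ge0 ?mulr_ge0.
have Hx s t : t0 <= s -> s <= t -> t <= t1 -> `|x t - x s| <= C3 * hpow alpha (t - s).
  move=> h1 h2 h3; have [b1 _] := hb s t h1 h2 h3.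
  have p0 := hpow_ge0 alpha (t - s).
  have -> : x t - x s = (x t - x s - \sum_(k < K) (Z t - Z s) 0 k *: V k (x s)) +
     \sum_(k < K) (Z t - Z s) 0 k *: V k (x s) by rewrite subrK.
  apply: le_trans (ler_normD _ _) _; rewrite /C3 mulrDl; apply: lerD.
    apply: le_trans (H2 s t h1 h2 h3) _; rewrite -mulrA ler_wpM2l// expr2 ler_wpM2r//.
    exact: pP.
  rewrite -mulrA; apply: ler_norm_sum_const => k; rewrite normrZ mulrAC.
  by apply: ler_pM => //; apply: VB => //; exact: le_trans h3.
pose rho := `|x t0| + C3 * P.
have hrho t : t0 <= t -> t <= t1 -> `|x t| <= rho.
  move=> h1 h2; have -> : x t = x t0 + (x t - x t0) by rewrite subrKC.
  apply: le_trans (ler_normD _ _) _; rewrite lerD2l.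
  apply: le_trans (Hx t0 t _ _ _) _ => //.
  by rewrite ler_wpM2l// pP.
have [C4 C40 H4] : exists2 C, 0 <= C & forall j, field_bounds C rho (V j).
  apply: exists_common_bound => [j C C'|j]; first exact: field_bounds_mono.
  exact: (smooth_field_bounds hE _ (hV j)).
have [C5 C50 H5] : exists2 C, 0 <= C & forall kj : 'I_K * 'I_K,
    field_bounds C rho (fun x => 'd (V kj.2) x (V kj.1 x)).
  apply: exists_common_bound => [j C C'|[k j]]; first exact: field_bounds_mono.
  exact: (smooth_field_bounds hE _ (smooth_field_directional hE (hV j) (hV k))).
have [C6 C60 H6] := smooth_field_bounds hE rho hV0.
pose A := C4 * (C3 ^+ 2 + C2) + C5 * C3.
have A0 : 0 <= A by apply: addr_ge0; apply: mulr_ge0 => //; rewrite addr_ge0// sqr_ge0.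
have k0 : 0 <= K%:R * (1 + K%:R) * CZ :> R by rewrite !mulr_ge0// addr_ge0.
exists rho => //.
exists (C3 + C6 * C3 + K%:R * (1 + K%:R) * CZ * A).
  by rewrite !addr_ge0// ?mulr_ge0.
split.
- move=> s t h1 h2 h3; apply: le_trans (Hx s t h1 h2 h3) _.
  by rewrite ler_wpM2r ?hpow_ge0// -addrA lerDl addr_ge0// mulr_ge0.
- move=> s t h1 h2 h3.
  have := fb_lip H6 (hrho s h1 (le_trans h2 h3)) (hrho t (le_trans h1 h2) h3).
  move=> /le_trans; apply; have := ler_wpM2l C60 (Hx s t h1 h2 h3).
  move=> /le_trans; apply; rewrite mulrA ler_wpM2r ?hpow_ge0//.
  by rewrite addrAC lerDr addr_ge0// mulr_ge0.
move=> G s u t h1 h2 h3 h4.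
have us : hpow alpha (u - s) <= hpow alpha (t - s) by apply: hpow_le => //; lra.
have p0 := hpow_ge0 alpha (u - s).
have us2 : hpow alpha (u - s) ^+ 2 <= hpow alpha (t - s) ^+ 2.
  by rewrite lerXn2r ?nnegrE// (le_trans p0).
have ut1 := le_trans h3 h4.
have xs := hrho s h1 (le_trans h2 ut1); have xu := hrho u (le_trans h1 h2) ut1.
have dx := Hx s u h1 h2 ut1.
apply: (@le_trans _ _ (K%:R * (1 + K%:R) * CZ * A * hpow alpha (t - s) ^+ 3)).
  apply: (le_germ_delta halpha hc CZ0 A0 hb h1 h2 h3 h4) => [j|k j].
    set r := x u - x s - \sum_(k < K) (Z u - Z s) 0 k *: V k (x s).
    have rb : `|r| <= C2 * hpow alpha (u - s) ^+ 2 by exact: H2.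
    have -> : V j (x u) - V j (x s) -
        \sum_(k < K) (Z u - Z s) 0 k *: 'd (V j) (x s) (V k (x s)) =
      (V j (x s + (x u - x s)) - V j (x s) - 'd (V j) (x s) (x u - x s)) + 'd (V j) (x s) r.
      rewrite subrKC /r (linearB _ (x u - x s)) addrA subrK.
      rewrite (linear_sum ('d (V j) (x s))).
      by congr (_ - _); apply: eq_bigr => k _; rewrite linearZ.
    apply: le_trans (ler_normD _ _) _.
    have i1 : `|V j (x s + (x u - x s)) - V j (x s) - 'd (V j) (x s) (x u - x s)|
       <= C4 * `|x u - x s| ^+ 2.
      by apply: (fb_taylor (H4 j)) => //; rewrite subrKC.
    have i2 := fb_diff (H4 j) r xs.
    have i3 : `|x u - x s| ^+ 2 <= C3 ^+ 2 * hpow alpha (u - s) ^+ 2.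
      by rewrite -exprMn lerXn2r ?nnegrE// mulr_ge0.
    have i4 := ler_wpM2l C40 i3; have i5 := ler_wpM2l C40 rb.
    have q0 : 0 <= hpow alpha (u - s) ^+ 2 by exact: exprn_ge0.
    have i6 : A * hpow alpha (u - s) ^+ 2 <= A * hpow alpha (t - s) ^+ 2 by rewrite ler_wpM2l.
    apply: le_trans i6.
    have i7 : 0 <= C5 * C3 * hpow alpha (u - s) ^+ 2 by rewrite !mulr_ge0.
    by rewrite /A; lra.
  apply: le_trans (fb_lip (H5 (k, j)) xs xu) _.
  apply: le_trans (ler_wpM2l C50 dx) _; rewrite mulrA.
  apply: ler_pM => //; first by rewrite mulr_ge0.
  by rewrite lerDr mulr_ge0// addr_ge0// sqr_ge0.
by rewrite ler_wpM2r ?exprn_ge0 ?hpow_ge0// lerDr addr_ge0// mulr_ge0.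
Qed.

End Controlled.

Lemma norm_fst_sub (R : realType) (U W : normedModType R) (u v w : U * W) :
  `|u.1 - v.1 - w.1| <= `|u - v - w|.
Proof. by rewrite [X in _ <= X]prod_normE le_max lexx. Qed.

Lemma norm_snd_sub (R : realType) (U W : normedModType R) (u v w : U * W) :
  `|u.2 - v.2 - w.2| <= `|u - v - w|.
Proof. by rewrite [X in _ <= X]prod_normE le_max lexx orbT. Qed.

Lemma row_subE (R : realType) (n : nat) (u v : 'rV[R]_n) i : (u - v) 0 i = u 0 i - v 0 i.
Proof. by rewrite !mxE. Qed.

Lemma row_oppE (R : realType) (n : nat) (u : 'rV[R]_n) i : (- u) 0 i = - u 0 i.
Proof. by rewrite mxE. Qed.

Section GermComponents.
Variables (R : realType) (K : nat) (Z : R -> 'rV[R]_K) (ZZ : R -> R -> 'M[R]_K).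

Lemma germ_components (U W : normedModType R) (Y : R -> 'I_K -> U * W)
    (Y' : R -> 'I_K -> 'I_K -> U * W) s t :
  germ Z ZZ Y Y' s t =
    (germ Z ZZ (fun r j => (Y r j).1) (fun r k j => (Y' r k j).1) s t,
     germ Z ZZ (fun r j => (Y r j).2) (fun r k j => (Y' r k j).2) s t).
Proof.
rewrite /germ !(sum_pair (U := U) (W := W)) /=; congr (_, _); congr (_ + _);
  by apply: eq_bigr => k _; rewrite (sum_pair (U := U) (W := W)).
Qed.

Lemma germN (W : normedModType R) (Y : R -> 'I_K -> W)
    (Y' : R -> 'I_K -> 'I_K -> W) s t :
  germ Z ZZ (fun r j => - Y r j) (fun r k j => - Y' r k j) s t = - germ Z ZZ Y Y' s t.
Proof.
rewrite /germ opprD -!sumrN; congr (_ + _); apply: eq_bigr => j _; first by rewrite scalerN.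
by rewrite -sumrN; apply: eq_bigr => i _; rewrite scalerN.
Qed.

End GermComponents.

Section Davie.
Variables (R : realType) (N K : nat).
Variables (alpha t0 t1 : R) (Z : R -> 'rV[R]_K) (ZZ : R -> R -> 'M[R]_K).
Hypothesis halpha : 3^-1 < alpha <= 2^-1.
Variables (H : phase R N -> R) (Hs : 'I_K -> phase R N -> R).
Hypotheses (hH : smooth_on setT H) (hHs : forall j, smooth_on setT (Hs j)).

Definition ham_rem : (R -> phase R N) -> R -> R -> phase R N :=
  davie_rem Z ZZ (fun j => ham (Hs j))
    (fun k j y => 'd (ham (Hs j)) y (ham (Hs k) y)) (ham H).

(** Intervals of length more than 1 are included, at the cost of a factor that
    depends on the total length. *)
Lemma drift_le_hpow_cube (s t : R) : t0 <= s -> s <= t -> t <= t1 ->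
  hpow alpha (t - s) * (t - s) <= (1 + (t1 - t0)) * hpow alpha (t - s) ^+ 3.
Proof.
move=> h1 h2 h3; have p0 := hpow_ge0 alpha (t - s).
rewrite exprS mulrCA ler_wpM2l//.
have ts : 0 <= t - s by rewrite subr_ge0.
have q0 : 0 <= hpow alpha (t - s) ^+ 2 by rewrite exprn_ge0.
have [l1|l1] := leP (t - s) 1.
  apply: (@le_trans _ _ (hpow alpha (t - s) ^+ 2)).
    by apply: le_hpow_sq => //; rewrite ts.
  by rewrite ler_peMl// lerDl; lra.
have p1 : 1 <= hpow alpha (t - s) ^+ 2.
  rewrite -[X in X <= _](expr1n R 2) lerXn2r ?nnegrE//.
  by have := hpow_le halpha ler01 (ltW l1); rewrite {1}/hpow powR1.
apply: (@le_trans _ _ (1 + (t1 - t0))); first by lra.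
by rewrite ler_peMr//; lra.
Qed.

(** Each component of the remainder splits into a drift increment and an increment
    of a rough integral minus its germ.  For p the integrals end at t1, so that
    increments are differences of integrals in the opposite order. *)
Lemma solution_davie (CZ : R) (x : R -> phase R N) :
  0 <= CZ -> rough_path_bound alpha t0 t1 Z ZZ CZ -> chen t0 t1 Z ZZ ->
  rough_hamilton_solution alpha t0 t1 Z ZZ H Hs x ->
  exists2 rho, (forall t, t0 <= t -> t <= t1 -> `|x t| <= rho) &
  exists2 C, 0 <= C & forall s t, t0 <= s -> s <= t -> t <= t1 ->
    `|x t - x s| <= C * hpow alpha (t - s) /\
    `|ham_rem x s t| <= C * hpow alpha (t - s) ^+ 3.
Proof.
move=> CZ0 hb hc [hx hq hp].
have [rho hrho [C C0 [H1 H2 H3]]] := controlled_path_bounds halpha (@phase_coordinates R N)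
  (fun j => ham_smooth (hHs j)) (ham_smooth hH) CZ0 hb hc hx.
exists rho => //.
pose M := C / (1 - sewing_ratio alpha).
have M0 : 0 <= M by exact: sewing_const_ge0.
pose T := 1 + (t1 - t0).
exists (C + `|C * T| + M); first by rewrite !addr_ge0.
move=> s t h1 h2 h3; have p0 := hpow_ge0 alpha (t - s).
have p30 : 0 <= hpow alpha (t - s) ^+ 3 by rewrite exprn_ge0.
split.
  apply: le_trans (H1 s t h1 h2 h3) _; rewrite ler_wpM2r// -addrA lerDl.
  by rewrite addr_ge0.
have drift : C * hpow alpha (t - s) * (t - s) <= `|C * T| * hpow alpha (t - s) ^+ 3.
  rewrite -mulrA; apply: le_trans (ler_wpM2l C0 (drift_le_hpow_cube h1 h2 h3)) _.
  by rewrite mulrA ler_wpM2r// ler_norm.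
have st1 := le_trans h2 h3; have tt0 := le_trans h1 h2.
pose GE := germ Z ZZ (fun r j => ham (Hs j) (x r))
  (fun r k j => 'd (ham (Hs j)) (x r) (ham (Hs k) (x r))).
pose G1 := germ Z ZZ (fun r j => dHdp (Hs j) (x r))
  (fun r k j => 'd (dHdp (Hs j)) (x r) (hamilton_gubinelli Hs x r k)).
pose G2 := germ Z ZZ (fun r j => dHdq (Hs j) (x r))
  (fun r k j => 'd (dHdq (Hs j)) (x r) (hamilton_gubinelli Hs x r k)).
have G1E u v : G1 u v = (GE u v).1.
  rewrite /GE germ_components /=; congr (germ _ _ _ _ _ _); apply/funext => r.
  by apply/funext => k; apply/funext => j; exact: diff_dHdp.
have G2E u v : - G2 u v = (GE u v).2.
  rewrite /GE germ_components -germN /=; congr (germ _ _ _ _ _ _); apply/funext => r.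
  by apply/funext => k; apply/funext => j; rewrite diff_dHdq// opprK.
have Q1 u v w : t0 <= u -> u <= v -> v <= w -> w <= t1 ->
    `|G1 u w - G1 u v - G1 v w| <= C * hpow alpha (w - u) ^+ 3.
  move=> k1 k2 k3 k4; apply: le_trans (H3 u v w k1 k2 k3 k4).
  by rewrite !G1E; exact: norm_fst_sub.
have Q2 u v w : t0 <= u -> u <= v -> v <= w -> w <= t1 ->
    `|G2 u w - G2 u v - G2 v w| <= C * hpow alpha (w - u) ^+ 3.
  move=> k1 k2 k3 k4; apply: le_trans (H3 u v w k1 k2 k3 k4).
  have -> : G2 u w - G2 u v - G2 v w = - (- G2 u w - - G2 u v - - G2 v w).
    by move: (G2 u w) (G2 u v) (G2 v w) => g1 g2 g3; rewrite !opprD !opprK.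
  by rewrite normrN !G2E; exact: norm_snd_sub.
have D1 i u v : t0 <= u -> u <= v -> v <= t1 ->
    `|dHdp H (x v) 0 i - dHdp H (x u) 0 i| <= C * hpow alpha (v - u).
  move=> k1 k2 k3; apply: le_trans (H2 u v k1 k2 k3).
  have -> : dHdp H (x v) 0 i - dHdp H (x u) 0 i = (dHdp H (x v) - dHdp H (x u) - 0) 0 i.
    by rewrite subr0 row_subE.
  apply: le_trans (le_mx_norm _ _ _) _.
  by have := norm_fst_sub (ham H (x v)) (ham H (x u)) 0; rewrite [_ - _ - 0 in X in _ <= X]subr0.
have D2 i u v : t0 <= u -> u <= v -> v <= t1 ->
    `|dHdq H (x v) 0 i - dHdq H (x u) 0 i| <= C * hpow alpha (v - u).
  move=> k1 k2 k3; apply: le_trans (H2 u v k1 k2 k3).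
  have -> : dHdq H (x v) 0 i - dHdq H (x u) 0 i
      = - (- dHdq H (x v) - - dHdq H (x u) - 0) 0 i.
    by rewrite subr0 row_subE !row_oppE opprB opprK addrC.
  rewrite normrN; apply: le_trans (le_mx_norm _ _ _) _.
  by have := norm_snd_sub (ham H (x v)) (ham H (x u)) 0; rewrite [_ - _ - 0 in X in _ <= X]subr0.
have remE : ham_rem x s t = ((x t).1 - (x s).1 - (G1 s t + (t - s) *: dHdp H (x s)),
    (x t).2 - (x s).2 - (- G2 s t + (t - s) *: - dHdq H (x s))).
  by rewrite G1E G2E.
have main : `|ham_rem x s t| <= (`|C * T| + M) * hpow alpha (t - s) ^+ 3.
  have B0 : 0 <= (`|C * T| + M) * hpow alpha (t - s) ^+ 3.
    by rewrite mulr_ge0// addr_ge0.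
  rewrite remE; apply/phase_norm_leP => //; split => /=.
    have [Is hIs es] := hq s h1 st1; have [It hIt et] := hq t tt0 h3.
    have i1 := rough_integral_increment_l halpha C0 Q1 (lexx t0) h1 h2 h3 hIs hIt.
    have i2 : `|vec_integral t0 t (fun r => dHdp H (x r))
        - vec_integral t0 s (fun r => dHdp H (x r)) - (t - s) *: dHdp H (x s)|
        <= C * hpow alpha (t - s) * (t - s).
      apply/row_norm_leP => [|i]; first by rewrite !mulr_ge0// subr_ge0.
      have := drift_increment_l halpha C0 (D1 i) (lexx t0) h1 h2 h3.
      by rewrite !mxE.
    have -> : (x t).1 - (x s).1 - (G1 s t + (t - s) *: dHdp H (x s)) =
      (vec_integral t0 t (fun r => dHdp H (x r)) - vec_integral t0 s (fun r => dHdp H (x r))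
        - (t - s) *: dHdp H (x s)) + (It - Is - G1 s t).
      have -> : (x t).1 - (x s).1 = ((x t).1 - (x t0).1) - ((x s).1 - (x t0).1).
        by rewrite opprB addrA subrK.
      rewrite et es.
      move: (vec_integral _ _ _) (vec_integral _ _ _) (_ *: _) (G1 s t) => v1 v2 v3 g.
      by rewrite !opprD !addrA [RHS](AC (1*1*1*1*1*1) (1*4*2*5*6*3)).
    apply: le_trans (ler_normD _ _) _; rewrite mulrDl; apply: lerD => //.
    exact: le_trans i2 drift.
  have [Is hIs es] := hp s h1 st1; have [It hIt et] := hp t tt0 h3.
  have i1 := rough_integral_increment_r halpha C0 Q2 h1 h2 h3 (lexx t1) hIs hIt.
  have i2 : `|vec_integral s t1 (fun r => dHdq H (x r))
      - vec_integral t t1 (fun r => dHdq H (x r)) - (t - s) *: dHdq H (x s)|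
      <= C * hpow alpha (t - s) * (t - s).
    apply/row_norm_leP => [|i]; first by rewrite !mulr_ge0// subr_ge0.
    have := drift_increment_r halpha C0 (D2 i) h1 h2 h3 (lexx t1).
    by rewrite !mxE.
  have -> : (x t).2 - (x s).2 - (- G2 s t + (t - s) *: - dHdq H (x s)) =
    - ((vec_integral s t1 (fun r => dHdq H (x r)) - vec_integral t t1 (fun r => dHdq H (x r))
      - (t - s) *: dHdq H (x s)) + (Is - It - G2 s t)).
    have -> : (x t).2 - (x s).2 = ((x t1).2 - (x s).2) - ((x t1).2 - (x t).2).
      by rewrite opprB [RHS]addrC addrA subrK.
    rewrite et es scalerN.
    move: (vec_integral _ _ _) (vec_integral _ _ _) (_ *: _) (G2 s t) => v1 v2 v3 g.
    rewrite !opprD !opprK !addrA.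
    by rewrite [RHS](AC (1*1*1*1*1*1) (1*4*2*5*6*3)).
  rewrite normrN; apply: le_trans (ler_normD _ _) _; rewrite mulrDl; apply: lerD => //.
  exact: le_trans i2 drift.
by apply: le_trans main _; rewrite ler_wpM2r// -addrA lerDr.
Qed.

End Davie.

(** * Hamiltonian fields and alternating forms *)

Lemma is_derive_diff (R : realType) (E W : normedModType R) (f : E -> W) x v :
  differentiable f x -> is_derive x v f ('d f x v).
Proof. by move=> df; rewrite -deriveE//; apply/derivableP; exact: diff_derivable. Qed.

Section Symplectic.
Variables (R : realType) (E : normedModType R) (n : nat).
Variables (c : 'I_n -> E -> R) (e : 'I_n -> E).
Hypothesis hE : coordinates c e.

(** The symmetric second difference approximates D_v D_u g: first by the four-point
    Taylor estimate, then by Taylor's formula for the derivative in direction u. *)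
Lemma second_difference (g : E -> R) (x u v : E) : smooth_on setT g ->
  exists2 C, 0 <= C & forall s, 0 < s -> s <= 1 ->
    `|g (x + s *: v + s *: u) - g (x + s *: v) - g (x + s *: u) + g x
      - s ^+ 2 * 'd (fun y => 'd g y u) x v| <= C * s ^+ 3.
Proof.
move=> hg; pose rho := `|x| + `|u| + `|v|.
have [C1 C10 H1] := smooth_four_taylor hE rho hg.
have [C2 C20 H2] := smooth_taylor hE rho (smooth_diff u hg).
exists (C1 * (`|v| * `|u| ^+ 2) + C2 * `|v| ^+ 2) => [|s s0 s1].
  by rewrite addr_ge0 ?mulr_ge0// ?exprn_ge0.
have ns w : `|s *: w| = s * `|w| by rewrite normrZ gtr0_norm.
have le_s (w : E) : `|s *: w| <= `|w| by rewrite ns ler_piMl.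
have u0 := normr_ge0 u; have v0 := normr_ge0 v; have x0 := normr_ge0 x.
have b1 : `|x| <= rho by rewrite /rho; lra.
have b2 : `|x + s *: u| <= rho.
  by apply: le_trans (ler_normD _ _) _; have := le_s u; rewrite /rho; lra.
have b3 : `|x + s *: v| <= rho.
  by apply: le_trans (ler_normD _ _) _; have := le_s v; rewrite /rho; lra.
have b4 : `|x + s *: v + (s *: u + 0)| <= rho.
  rewrite addr0; apply: le_trans (ler_normD _ _) _.
  by have := le_s u; have := ler_normD x (s *: v); have := le_s v; rewrite /rho; lra.
have T1 := H1 x (s *: u) (s *: v) 0 b1 b2 b3 b4.
have T2 := H2 x (s *: v) b1 b3.
rewrite !addr0 normr0 mulr0 add0r expr0n /= addr0 !ns in T1.
rewrite ns in T2.
have T3 : s * `|'d g (x + s *: v) u - 'd g x u - 'd (fun y => 'd g y u) x (s *: v)|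
    <= s * (C2 * (s * `|v|) ^+ 2) by rewrite ler_wpM2l// ltW.
rewrite -[X in X * `|_ - _ - _|]gtr0_norm// -normrM in T3.
have -> : g (x + s *: v + s *: u) - g (x + s *: v) - g (x + s *: u) + g x
      - s ^+ 2 * 'd (fun y => 'd g y u) x v =
   (g (x + s *: v + s *: u) - g (x + s *: v) - 'd g (x + s *: v) (s *: u)
     - (g (x + s *: u) - g x - 'd g x (s *: u)))
   + s * ('d g (x + s *: v) u - 'd g x u - 'd (fun y => 'd g y u) x (s *: v)).
  by rewrite !linearZ /= /GRing.scale /=; ring.
apply: le_trans (ler_normD _ _) _; apply: le_trans (lerD T1 T3) _.
by rewrite le_eqVlt; apply/orP; left; apply/eqP; ring.
Qed.

(** The second difference is symmetric in u and v. *)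
Lemma schwarz (g : E -> R) (x u v : E) : smooth_on setT g ->
  'd (fun y => 'd g y u) x v = 'd (fun y => 'd g y v) x u.
Proof.
move=> hg.
have [C1 C10 H1] := second_difference x u v hg.
have [C2 C20 H2] := second_difference x v u hg.
set d1 := 'd (fun y => 'd g y u) x v in H1 *.
set d2 := 'd (fun y => 'd g y v) x u in H2 *.
apply/eqP; rewrite -subr_eq0 -normr_le0; apply/ler_addgt0Pr => eps eps0; rewrite add0r.
pose s := Num.min 1 (eps / (C1 + C2 + 1)).
have C120 : 0 < C1 + C2 + 1 by lra.
have s0 : 0 < s by rewrite lt_min ltr01 divr_gt0.
have s1 : s <= 1 by rewrite ge_min lexx.
have se : (C1 + C2) * s <= eps.
  apply: (@le_trans _ _ ((C1 + C2 + 1) * s)); first by rewrite ler_wpM2r ?lerDl ?ltW.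
  by rewrite mulrC -ler_pdivlMr// ge_min lexx orbT.
apply: le_trans se.
have h1 := H1 s s0 s1; have h2 := H2 s s0 s1.
rewrite (addrAC x (s *: u)) in h2.
have s20 : 0 < s ^+ 2 by rewrite exprn_gt0.
rewrite -(ler_pM2l s20) -[X in X * `|_|]gtr0_norm// -normrM.
move: h1 h2; set D := g (x + s *: v + s *: u); set g1 := g (x + s *: v).
set g2 := g (x + s *: u) => h1 h2.
have -> : s ^+ 2 * (d1 - d2) = (D - g2 - g1 + g x - s ^+ 2 * d2) - (D - g1 - g2 + g x - s ^+ 2 * d1).
  by ring.
apply: le_trans (ler_normB _ _) _; apply: le_trans (lerD h2 h1) _.
by rewrite le_eqVlt; apply/orP; left; apply/eqP; ring.
Qed.

Lemma schwarz_field (f : E -> E) (x u v : E) : smooth_field c f ->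
  'd (fun y => 'd f y u) x v = 'd (fun y => 'd f y v) x u.
Proof.
move=> hf.
have df y : differentiable f y by exact: (smooth_field_differentiable hE y hf).
have hw w : smooth_field c (fun y => 'd f y w).
  move=> i; have -> : (fun y => c i ('d f y w)) = (fun y => 'd (fun z => c i (f z)) y w).
    by apply/funext => y; rewrite (coord_of_diff hE).
  exact: smooth_diff (hf i).
have dw w y : differentiable (fun y => 'd f y w) y.
  exact: (smooth_field_differentiable hE y (hw w)).
rewrite [LHS](coord_expand hE) [RHS](coord_expand hE); apply: eq_bigr => i _.
rewrite !(coord_of_diff hE)//.
have eq w : (fun y => c i ('d f y w)) = (fun y => 'd (fun z => c i (f z)) y w).
  by apply/funext => y; rewrite (coord_of_diff hE).
by rewrite !eq schwarz.
Qed.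

Record alternating_form (om : E -> E -> R) (Com : R) : Prop := AlternatingForm {
  form_linear : forall w a u v, om (a *: u + v) w = a * om u w + om v w ;
  form_anti : forall u v, om u v = - om v u ;
  form_bound : forall u v, `|om u v| <= Com * (`|u| * `|v|)
}.

Variables (om : E -> E -> R) (Com : R).
Hypothesis hom : alternating_form om Com.

Lemma aformDl u v w : om (u + v) w = om u w + om v w.
Proof. by have := form_linear hom w 1 u v; rewrite scale1r mul1r. Qed.

Lemma aform0l w : om 0 w = 0.
Proof. by apply: (addrI (om 0 w)); rewrite -aformDl !addr0. Qed.

Lemma aformZl a u w : om (a *: u) w = a * om u w.
Proof. by have := form_linear hom w a u 0; rewrite !addr0 aform0l addr0. Qed.

Lemma aformDr u v w : om w (u + v) = om w u + om w v.
Proof. by rewrite !(form_anti hom w) aformDl opprD. Qed.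

Lemma aformZr a u w : om w (a *: u) = a * om w u.
Proof. by rewrite !(form_anti hom w) aformZl mulrN. Qed.

Lemma aform_suml (T : finType) (f : T -> E) w : om (\sum_j f j) w = \sum_j om (f j) w.
Proof. by apply: (big_morph (om^~ w)) => [u v|]; [exact: aformDl|exact: aform0l]. Qed.

Lemma aform_sumr (T : finType) (f : T -> E) w : om w (\sum_j f j) = \sum_j om w (f j).
Proof.
rewrite (form_anti hom) aform_suml -sumrN; apply: eq_bigr => j _.
by rewrite -(form_anti hom).
Qed.

Lemma aform_coord u w : om u w = \sum_i c i u * om (e i) w.
Proof.
rewrite {1}(coord_expand hE u) aform_suml; apply: eq_bigr => i _; exact: aformZl.
Qed.

Lemma is_derive_scalar_sum (m : nat) (g dg : 'I_m -> E -> R) (a : 'I_m -> R) x v :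
  (forall i, is_derive x v (g i) (dg i x)) ->
  is_derive x v (fun y => \sum_i g i y * a i) (\sum_i dg i x * a i).
Proof.
move=> h.
have h2 i : is_derive x v (fun y => g i y * a i) (dg i x * a i).
  have -> : (fun y => g i y * a i) = a i \*: g i.
    by apply/funext => y; rewrite /= mulrC.
  by rewrite mulrC; exact: is_deriveZ.
have -> : (fun y => \sum_i g i y * a i) = \sum_i (fun y => g i y * a i).
  by apply/funext => y; rewrite fct_sumE.
exact: is_derive_sum.
Qed.

Lemma is_derive_form (f : E -> E) x v w : differentiable f x ->
  is_derive x v (fun y => om (f y) w) (om ('d f x v) w).
Proof.
move=> df; have -> : (fun y => om (f y) w) = (fun y => \sum_i c i (f y) * om (e i) w).
  by apply/funext => y; exact: aform_coord.
rewrite aform_coord.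
apply: (is_derive_scalar_sum (dg := fun i x => c i ('d f x v))) => i.
rewrite (coord_of_diff hE)//; apply: is_derive_diff.
exact: (differentiable_coord_comp hE i df).
Qed.

Definition hamiltonian_field (H : E -> R) (V : E -> E) : Prop :=
  forall x w, om (V x) w = - 'd H x w.

(** The derivative of a Hamiltonian field is the Hessian, up to the form. *)
Lemma form_diff_field (H : E -> R) (V : E -> E) x v w :
  smooth_on setT H -> smooth_field c V -> hamiltonian_field H V ->
  om ('d V x v) w = - 'd (fun y => 'd H y w) x v.
Proof.
move=> hH hV HV; have dV := smooth_field_differentiable hE x hV.
have h1 := is_derive_form v w dV.
have h2 : is_derive x v (fun y => om (V y) w) (- 'd (fun y => 'd H y w) x v).
  have -> : (fun y => om (V y) w) = - (fun y => 'd H y w).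
    by apply/funext => y; rewrite HV.
  apply: is_deriveN; apply: is_derive_diff.
  exact: (smooth_differentiable (smooth_diff w hH)).
by rewrite -(@derive_val _ _ _ _ _ _ _ h1) (@derive_val _ _ _ _ _ _ _ h2).
Qed.

(** Symmetry of the Hessian, by [form_diff_field]. *)
Lemma diff_field_sp (H : E -> R) (V : E -> E) x v w :
  smooth_on setT H -> smooth_field c V -> hamiltonian_field H V ->
  om ('d V x v) w + om v ('d V x w) = 0.
Proof.
move=> hH hV HV; rewrite (form_anti hom v) !(form_diff_field _ _ _ hH hV HV) (schwarz x w v hH) opprK.
by rewrite addrC subrr.
Qed.

Section Fields.
Variables (H G : E -> R) (V W : E -> E).
Hypotheses (hH : smooth_on setT H) (hG : smooth_on setT G).
Hypotheses (hV : smooth_field c V) (hW : smooth_field c W).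
Hypotheses (HV : hamiltonian_field H V) (GW : hamiltonian_field G W).

(** By [diff_field_sp] the form of DV W and w is the derivative of G along DV w;
    this is a function of y only through scalar products, to which the product
    rule applies. *)
Lemma form_directional x v w :
  om ('d (fun y => 'd V y (W y)) x v) w =
  - om (W x) ('d (fun y => 'd V y w) x v) - om ('d W x v) ('d V x w).
Proof.
have hF := smooth_field_directional hE hV hW.
have h1 := is_derive_form v w (smooth_field_differentiable hE x hF).
have dV y : differentiable V y by exact: (smooth_field_differentiable hE y hV).
have hVw : smooth_field c (fun y => 'd V y w).
  move=> i; have -> : (fun y => c i ('d V y w)) = (fun y => 'd (fun z => c i (V z)) y w).
    by apply/funext => y; rewrite (coord_of_diff hE).
  exact: smooth_diff (hV i).
have dVw := smooth_field_differentiable hE x hVw.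
have E1 : (fun y => om ('d V y (W y)) w) = (fun y => \sum_i c i ('d V y w) * 'd G y (e i)).
  apply/funext => y; have := diff_field_sp y (W y) w hH hV HV => /eqP; rewrite addr_eq0 => /eqP ->.
  by rewrite GW opprK (diff_expand hE G); apply: eq_bigr.
have h2 : is_derive x v (fun y => \sum_i c i ('d V y w) * 'd G y (e i))
   (\sum_i (c i ('d V x w) * 'd (fun y => 'd G y (e i)) x v
            + 'd G x (e i) * 'd (fun y => c i ('d V y w)) x v)).
  have -> : (fun y => \sum_i c i ('d V y w) * 'd G y (e i)) =
     \sum_i ((fun y => c i ('d V y w)) * (fun y => 'd G y (e i))).
    by apply/funext => y; rewrite fct_sumE.
  apply: is_derive_sum => i; apply: is_deriveM; apply: is_derive_diff.
    exact: smooth_differentiable (hVw i) _.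
  exact: (smooth_differentiable (smooth_diff (e i) hG)).
rewrite -(@derive_val _ _ _ _ _ _ _ h1) E1 (@derive_val _ _ _ _ _ _ _ h2) big_split /=.
rewrite GW opprK addrC; congr (_ + _).
  rewrite (diff_expand hE G); apply: eq_bigr => i _.
  by rewrite (coord_of_diff hE)// mulrC.
rewrite -(form_anti hom) aform_coord; apply: eq_bigr => i _; congr (_ * _).
by rewrite (form_anti hom) (form_diff_field _ _ _ hG hW GW) opprK.
Qed.

(** The terms with second derivatives of V cancel by symmetry; only products of
    first derivatives remain. *)
Lemma form_directional_sp x v w :
  om ('d (fun y => 'd V y (W y)) x v) w + om v ('d (fun y => 'd V y (W y)) x w) =
  - om ('d W x v) ('d V x w) - om ('d V x v) ('d W x w).
Proof.
rewrite (form_anti hom v) !form_directional (schwarz_field x w v hV).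
by rewrite (form_anti hom ('d V x v)); ring.
Qed.

End Fields.

End Symplectic.

(** * Second-order expansion of the linearized flow *)

Lemma diff_comp_apply (R : realType) (U V W : normedModType R) (f : U -> V) (g : V -> W)
    (x : U) (v : U) : differentiable f x -> differentiable g (f x) ->
  'd (g \o f) x v = 'd g (f x) ('d f x v).
Proof. by move=> df dg; rewrite (diff_comp df dg). Qed.

Lemma diff_id_apply (R : realType) (V : normedModType R) (x v : V) : 'd (@id V) x v = v.
Proof. by rewrite (@diff_val _ _ _ _ _ _ _ (is_diff_id x)). Qed.

Section Directional.
Variables (R : realType) (V W : normedModType R).

Lemma is_derive_small_quotient (f : V -> W) x v d : is_derive x v f d ->
  forall e, 0 < e -> exists2 delta, 0 < delta & forall h, 0 < h -> h < delta ->
    `|f (x + h *: v) - f x - h *: d| <= e * h.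
Proof.
move=> [fd fE] e e0.
have hc : (fun h => h^-1 *: ((f \o shift x) (h *: v) - f x)) @ 0^' --> d.
  by rewrite -fE; exact: fd.
have /nbhs_ballP [delta /= d0 Hd] : nbhs (0 : R) (fun h => h != 0 ->
    `|d - h^-1 *: ((f \o shift x) (h *: v) - f x)| <= e).
  exact: (@cvgr_dist_le _ _ _ _ _ _ _ hc e e0).
exists delta => // h h0 hd.
have := Hd h; rewrite /ball /= sub0r normrN gtr0_norm// => /(_ hd).
rewrite gt_eqF// => /(_ isT) /=; rewrite [h *: v + x]addrC => H.
have -> : f (x + h *: v) - f x - h *: d = h *: (h^-1 *: (f (x + h *: v) - f x) - d).
  by rewrite scalerBr scalerA mulfV ?gt_eqF// scale1r.
by rewrite normrZ gtr0_norm// mulrC ler_wpM2r ?(ltW h0)// distrC.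
Qed.

Lemma is_derive_le (f : V -> W) x v d (C delta : R) : is_derive x v f d -> 0 < delta ->
  (forall h, 0 < h -> h < delta -> `|f (x + h *: v) - f x| <= C * h) -> `|d| <= C.
Proof.
move=> fd delta0 hC; apply/ler_addgt0Pr => e e0.
have [delta' d0' H] := is_derive_small_quotient fd e0.
pose h := Num.min delta delta' / 2.
have m0 : 0 < Num.min delta delta' by rewrite lt_min delta0.
have h0 : 0 < h by rewrite divr_gt0.
have hm : h < Num.min delta delta' by rewrite /h; lra.
have [hd hd'] : h < delta /\ h < delta' by move: hm; rewrite lt_min => /andP[].
have h1 := hC h h0 hd; have h2 := H h h0 hd'.
have : `|h *: d| <= (C + e) * h.
  have -> : h *: d = (f (x + h *: v) - f x) - (f (x + h *: v) - f x - h *: d).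
    by rewrite opprB addrC subrK.
  by apply: le_trans (ler_normB _ _) _; lra.
by rewrite normrZ gtr0_norm// mulrC ler_pM2r.
Qed.

Lemma is_derive_quotient_le (f : V -> W) x v d (m : R) : is_derive x v f d -> `|d| < m ->
  exists2 delta, 0 < delta & forall h, 0 < h -> h < delta ->
    `|f (x + h *: v) - f x| <= m * h.
Proof.
move=> fd dm; have [|delta d0 H] := is_derive_small_quotient fd (e := m - `|d|).
  by rewrite subr_gt0.
exists delta => // h h0 hd.
have -> : f (x + h *: v) - f x = (f (x + h *: v) - f x - h *: d) + h *: d by rewrite subrK.
apply: le_trans (ler_normD _ _) _; have := H h h0 hd.
by rewrite normrZ (gtr0_norm h0); lra.
Qed.

Lemma nbhs_line (D : set V) x v : nbhs x D ->
  exists2 delta, 0 < delta & forall h : R, 0 < h -> h < delta -> D (x + h *: v).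
Proof.
move=> /nbhs_ballP [r /= r0 Hr].
exists (r / (`|v| + 1)) => [|h h0 hr]; first by rewrite divr_gt0// ltr_wpDl.
apply: Hr; rewrite -ball_normE /ball_ /= opprD addrA subrr add0r normrN normrZ gtr0_norm//.
move: hr; rewrite ltr_pdivlMr ?ltr_wpDl//; have := normr_ge0 v; lra.
Qed.

Lemma diff_near_eq (f g : V -> W) x v : differentiable f x -> differentiable g x ->
  (\forall y \near x, f y = g y) -> 'd f x v = 'd g x v.
Proof.
move=> df dg fg; have fx := nbhs_singleton fg.
have [delta d0 H] := nbhs_line v fg.
have := is_deriveB (is_derive_diff v df) (is_derive_diff v dg).
move=> h; have h2 := is_derive_le (C := 0) h d0.
apply/eqP; rewrite -subr_eq0 -normr_le0; apply: h2 => r r0 rd.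
by rewrite /= !fctE (H r r0 rd) fx !subrr normr0 mul0r.
Qed.

End Directional.

Lemma diff_near_comp (R : realType) (U V W : normedModType R) (f : U -> V) (g : V -> W)
    (h : U -> W) (x u : U) :
  differentiable f x -> differentiable g (f x) -> differentiable h x ->
  (\forall y \near x, h y = g (f y)) -> 'd h x u = 'd g (f x) ('d f x u).
Proof.
move=> df dg dh hE; rewrite -diff_comp_apply//; apply: diff_near_eq => //.
exact: differentiable_comp.
Qed.

Section FlowDerivative.
Variables (R : realType) (E : normedModType R) (n K : nat).
Variables (c : 'I_n -> E -> R) (e : 'I_n -> E).
Hypothesis hE : coordinates c e.
Variables (alpha t0 t1 : R) (Z : R -> 'rV[R]_K) (ZZ : R -> R -> 'M[R]_K) (CZ : R).
Hypothesis halpha : 3^-1 < alpha <= 2^-1.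
Hypotheses (CZ0 : 0 <= CZ) (hb : rough_path_bound alpha t0 t1 Z ZZ CZ).
Hypothesis hc : chen t0 t1 Z ZZ.
Variables (V : 'I_K -> E -> E) (V0 : E -> E).
Hypotheses (hV : forall j, smooth_field c (V j)) (hV0 : smooth_field c V0).

Local Notation F := (fun k j x => 'd (V j) x (V k x)).
Local Notation Rem := (davie_rem Z ZZ V F V0).

Variables (phi : R -> E -> E) (D : set E) (x0 : E) (rho : R).
Hypotheses (oD : open D) (Dx0 : D x0).
Hypothesis dphi : forall t, t0 <= t -> t <= t1 -> differentiable (phi t) x0.
Hypothesis hrho : forall t, t0 <= t -> t <= t1 -> `|phi t x0| <= rho.
Hypothesis hdavie : forall z, D z -> exists2 C, 0 <= C &
  forall s t, t0 <= s -> s <= t -> t <= t1 ->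
    `|phi t z - phi s z| <= C * hpow alpha (t - s) /\
    `|Rem (phi^~ z) s t| <= C * hpow alpha (t - s) ^+ 3.

Local Notation J t v := ('d (phi t) x0 v).

(** The remainder in the expansion of the linearized flow, that is, the derivative
    of [davie_rem] in the initial condition. *)
Definition linearized_rem (v : E) (s t : R) : E :=
  J t v - J s v - (germ Z ZZ (fun r j => 'd (V j) (phi r x0) (J r v))
     (fun r k j => 'd (F k j) (phi r x0) (J r v)) s t
     + (t - s) *: 'd V0 (phi s x0) (J s v)).

Lemma is_derive_comp_flow (f : E -> E) t v : differentiable f (phi t x0) ->
  t0 <= t -> t <= t1 ->
  is_derive x0 v (fun z => f (phi t z)) ('d f (phi t x0) (J t v)).
Proof.
move=> df h1 h2; have dp := dphi h1 h2.
rewrite -(diff_comp_apply v dp df).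
by apply: is_derive_diff; exact: (differentiable_comp dp df).
Qed.

(** For fixed s and t the remainder is a smooth function of the flow at these two
    times, so that it can be differentiated in the initial condition without any
    uniformity in time. *)
Lemma is_derive_rem v s t : t0 <= s -> s <= t -> t <= t1 ->
  is_derive x0 v (fun z => Rem (phi^~ z) s t) (linearized_rem v s t).
Proof.
move=> h1 h2 h3; have s1 := le_trans h2 h3; have tt0 := le_trans h1 h2.
have dV j y : differentiable (V j) y by exact: (smooth_field_differentiable hE y (hV j)).
have dF k j y : differentiable (F k j) y.
  exact: (smooth_field_differentiable hE y (smooth_field_directional hE (hV j) (hV k))).
have dV0 y : differentiable V0 y by exact: (smooth_field_differentiable hE y hV0).
have sumD (m : nat) (g : 'I_m -> E -> E) (dg : 'I_m -> E) (a : 'I_m -> R) :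
    (forall i, is_derive x0 v (g i) (dg i)) ->
    is_derive x0 v (fun z => \sum_i a i *: g i z) (\sum_i a i *: dg i).
  move=> hg; have -> : (fun z => \sum_i a i *: g i z) = \sum_i (a i \*: g i).
    by apply/funext => z; rewrite fct_sumE.
  by apply: is_derive_sum => i; apply: is_deriveZ.
have hG : is_derive x0 v (fun z => germ Z ZZ (fun r j => V j (phi r z))
      (fun r k j => F k j (phi r z)) s t)
    (germ Z ZZ (fun r j => 'd (V j) (phi r x0) (J r v))
     (fun r k j => 'd (F k j) (phi r x0) (J r v)) s t).
  apply: is_deriveD.
    by apply: sumD => j; apply: is_derive_comp_flow.
  have := @is_derive_sum R E E K (fun k z => \sum_j ZZ s t k j *: F k j (phi s z)) x0 v
    (fun k => \sum_j ZZ s t k j *: 'd (F k j) (phi s x0) (J s v)).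
  have -> : \sum_(k < K) (fun z => \sum_j ZZ s t k j *: F k j (phi s z)) =
     (fun z => \sum_(k < K) \sum_j ZZ s t k j *: F k j (phi s z)).
    by apply/funext => z; rewrite fct_sumE.
  by apply => k; apply: sumD => j; apply: is_derive_comp_flow.
have hp r : t0 <= r -> r <= t1 -> is_derive x0 v (phi r) (J r v).
  by move=> *; apply: is_derive_diff; exact: dphi.
apply: is_deriveB; first by apply: is_deriveB; apply: hp.
apply: is_deriveD => //; apply: is_deriveZ.
exact: is_derive_comp_flow.
Qed.

(** The bound of [difference_bound] is uniform in eps, so that it passes to the
    derivative.  The length h comes from the bound rho on the whole path and not from
    the size of J at time a: since J is linear, v can be scaled to satisfy the
    smallness condition. *)
Lemma flow_derivative_bound : exists2 h, 0 < h <= 1 & exists2 M, 0 <= M &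
  forall a b, t0 <= a -> a <= b -> b <= t1 -> b - a <= h ->
  forall v, `|J a v| < 1 ->
  forall s t, a <= s -> s <= t -> t <= b ->
    `|J s v| <= 2 /\ `|linearized_rem v s t| <= M * hpow alpha (t - s) ^+ 3.
Proof.
have [h h01 [M M0 H]] := difference_bound halpha rho hE hV hV0 CZ0 hb hc.
exists h => //; exists M => // a b ta ab bt bah v Jv s t as_ st tb.
have a1 := le_trans ab bt; have s0 := le_trans ta as_.
have tt1 := le_trans tb bt; have s1 := le_trans st tt1.
have hp r : t0 <= r -> r <= t1 -> is_derive x0 v (phi r) (J r v).
  by move=> *; apply: is_derive_diff; exact: dphi.
have [d1 d10 Hd1] := is_derive_quotient_le (hp a ta a1) Jv.
have [d2 d20 Hd2] := nbhs_line v (open_nbhs_nbhs (conj oD Dx0)).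
have [Cx Cx0 Hx] := hdavie Dx0.
pose delta := Num.min (Num.min d1 d2) 1.
have delta0 : 0 < delta by rewrite !lt_min d10 d20 ltr01.
have main eps : 0 < eps -> eps < delta ->
   `|phi s (x0 + eps *: v) - phi s x0| <= 2 * eps /\
   `|Rem (phi^~ (x0 + eps *: v)) s t - Rem (phi^~ x0) s t|
      <= M * hpow alpha (t - s) ^+ 3 * eps.
  move=> e0; rewrite !lt_min => /andP[/andP[ed1 ed2] /ltW e1].
  have Dy := Hd2 eps e0 ed2; have [Cy Cy0 Hy] := hdavie Dy.
  have [|||k1 k2 k3 k4] // := H a b eps (Cx + Cy) (phi^~ x0) (phi^~ (x0 + eps *: v))
    ta ab bt bah e0 e1 (addr_ge0 Cx0 Cy0) _ _ _ s t as_ st tb.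
  - by move=> r ar rb; apply: hrho; [exact: le_trans ar|exact: le_trans rb bt].
  - move=> s' t' k1 k2 k3.
    have [x1 x2] := Hx s' t' (le_trans ta k1) k2 (le_trans k3 bt).
    have [y1 y2] := Hy s' t' (le_trans ta k1) k2 (le_trans k3 bt).
    have p0 := hpow_ge0 alpha (t' - s').
    have p3 : 0 <= hpow alpha (t' - s') ^+ 3 by rewrite exprn_ge0.
    split.
    + by apply: le_trans x1 _; rewrite ler_wpM2r// lerDl.
    + by apply: le_trans y1 _; rewrite ler_wpM2r// lerDr.
    + by apply: le_trans x2 _; rewrite ler_wpM2r// lerDl.
    + by apply: le_trans y2 _; rewrite ler_wpM2r// lerDr.
  - by have := Hd1 eps e0 ed1; rewrite mul1r.
  by split => //; rewrite mulrAC.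
split.
  by apply: (is_derive_le (hp s s0 s1) delta0) => eps e0 ed; have [] := main eps e0 ed.
apply: (is_derive_le (is_derive_rem v s0 st tt1) delta0) => eps e0 ed.
by have [] := main eps e0 ed.
Qed.

End FlowDerivative.

(** * Conservation of the form along the linearized flow *)

(** The sewing bound for an additive quantity, whose defect vanishes. *)
Lemma superlinear_constant (R : realType) (alpha : R) (f : R -> R) (a b C : R) :
  3^-1 < alpha <= 2^-1 -> 0 <= C -> a <= b ->
  (forall s t, a <= s -> s <= t -> t <= b -> `|f t - f s| <= C * hpow alpha (t - s) ^+ 3) ->
  f b = f a.
Proof.
move=> halpha C0 ab hf.
have := @sewing_bound R alpha (fun s t => `|f t - f s|) a b C 0 0 C0 (lexx _) (lexx _) _ hf _
  a b (lexx _) ab (lexx _).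
rewrite mul0r mul0r normr_le0 subr_eq0 => H; apply/eqP; apply: H.
  by rewrite addr0; exact: sewing_ratio_lt1.
move=> S S0 hS s t as_ st tb; rewrite !(mul0r, addr0).
have -> : f t - f s = (f ((s + t) / 2) - f s) + (f t - f ((s + t) / 2)).
  by rewrite [RHS]addrC addrA subrK.
exact: ler_normD.
Qed.

Section FormExpansion.
Variables (R : realType) (E : normedModType R) (om : E -> E -> R) (Com : R).
Hypothesis hom : alternating_form om Com.

Lemma aform_scale (k : R) (u v u' v' x y x' y' : E) : k != 0 ->
  x = k *: u -> y = k *: v -> x' = k *: u' -> y' = k *: v' ->
  om x y = om x' y' -> om u v = om u' v'.
Proof.
move=> k0 -> -> -> ->; rewrite !(aformZl hom) !(aformZr hom).
by move=> /(mulfI k0) /(mulfI k0).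
Qed.

(** The increments m, n and r are of order 1, 2 and 3 in [hpow]; the first two
    brackets on the right vanish for Hamiltonian fields. *)
Lemma form_expansion (a m n r a' m' n' r' : E) :
  om (a + m + n + r) (a' + m' + n' + r') - om a a' =
  (om m a' + om a m') + (om n a' + om a n' + om m m') +
  (om r (a' + m' + n' + r') + om (a + m + n) r' + om m n' + om n m' + om n n').
Proof.
by rewrite !(aformDl hom) !(aformDr hom); ring.
Qed.

Lemma form_remainder_bound (M c p : R) (a m n r a' m' n' r' : E) :
  0 <= M -> 0 <= c -> 0 <= p -> p <= 1 -> 0 <= Com ->
  `|m| <= c * p -> `|m'| <= c * p -> `|n| <= c * p ^+ 2 -> `|n'| <= c * p ^+ 2 ->
  `|r| <= M * p ^+ 3 -> `|r'| <= M * p ^+ 3 ->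
  `|a + m + n + r| <= 2 -> `|a' + m' + n' + r'| <= 2 ->
  `|om r (a' + m' + n' + r') + om (a + m + n) r' + om m n' + om n m' + om n n'|
    <= Com * (2 * M + (2 + M) * M + 3 * c ^+ 2) * p ^+ 3.
Proof.
move=> M0 c0 p0 p1 Com0 hm hm' hn hn' hr hr' hb hb'.
have bnd (u v : E) (A B : R) : `|u| <= A -> `|v| <= B -> `|om u v| <= Com * (A * B).
  move=> uA vB; apply: le_trans (form_bound hom u v) _.
  by rewrite ler_wpM2l// ler_pM.
have p3 : p ^+ 3 <= 1 by exact: exprn_ile1.
have p30 : 0 <= p ^+ 3 by exact: exprn_ge0.
have k : `|a + m + n| <= 2 + M.
  have -> : a + m + n = a + m + n + r - r by rewrite addrK.
  apply: le_trans (ler_normB _ _) _; apply: lerD => //.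
  by apply: le_trans hr _; rewrite ler_piMr.
have b1 := bnd _ _ _ _ hr hb'; have b2 := bnd _ _ _ _ k hr'.
have b3 := bnd _ _ _ _ hm hn'; have b4 := bnd _ _ _ _ hn hm'.
have b5 := bnd _ _ _ _ hn hn'.
have p4 : Com * (c ^+ 2 * p ^+ 4) <= Com * (c ^+ 2 * p ^+ 3).
  by rewrite ler_wpM2l// ler_wpM2l ?sqr_ge0// [p ^+ 4]exprS ler_piMl.
have t1 := ler_normD (om r (a' + m' + n' + r') + om (a + m + n) r' + om m n' + om n m') (om n n').
have t2 := ler_normD (om r (a' + m' + n' + r') + om (a + m + n) r' + om m n') (om n m').
have t3 := ler_normD (om r (a' + m' + n' + r') + om (a + m + n) r') (om m n').
have t4 := ler_normD (om r (a' + m' + n' + r')) (om (a + m + n) r').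
have -> : Com * (2 * M + (2 + M) * M + 3 * c ^+ 2) * p ^+ 3 =
  Com * (M * p ^+ 3 * 2) + Com * ((2 + M) * (M * p ^+ 3)) + Com * (c * p * (c * p ^+ 2))
  + Com * (c * p ^+ 2 * (c * p)) + Com * (c ^+ 2 * p ^+ 3) by ring.
have e5 : Com * (c * p ^+ 2 * (c * p ^+ 2)) = Com * (c ^+ 2 * p ^+ 4) by ring.
rewrite e5 in b5.
apply: le_trans t1 _; apply: lerD; last exact: le_trans b5 p4.
apply: le_trans t2 _; apply: lerD => //.
apply: le_trans t3 _; apply: lerD => //.
by apply: le_trans t4 _; apply: lerD.
Qed.

(** A k, B k j and A0 stand for DV_k, D(DV_j V_k) and DV_0.  After symmetrization
    zz enters only through its symmetric part, which is prescribed by z. *)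
Lemma form_second_order (K : nat) (z : 'I_K -> R) (zz : 'I_K -> 'I_K -> R) (tau : R)
    (A : 'I_K -> E -> E) (B : 'I_K -> 'I_K -> E -> E) (A0 : E -> E) (v w : E) :
  (forall k j, zz k j + zz j k = z k * z j) ->
  (forall j, om (A j v) w + om v (A j w) = 0) ->
  om (A0 v) w + om v (A0 w) = 0 ->
  (forall k j, om (B k j v) w + om v (B k j w)
     = - om (A k v) (A j w) - om (A j v) (A k w)) ->
  let m u := \sum_j z j *: A j u in
  let n u := \sum_k \sum_j zz k j *: B k j u + tau *: A0 u in
  om (m v) w + om v (m w) = 0 /\
  om (n v) w + om v (n w) + om (m v) (m w) = 0.
Proof.
move=> hz hA hA0 hB m n; split.
  rewrite /m (aform_suml hom) (aform_sumr hom) -big_split /= big1// => j _.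
  by rewrite (aformZl hom) (aformZr hom) -mulrDr hA mulr0.
have -> : om (n v) w + om v (n w) =
   - \sum_k \sum_j zz k j * (om (A k v) (A j w) + om (A j v) (A k w)).
  rewrite /n (aformDl hom) (aformDr hom) (aformZl hom) (aformZr hom) addrACA -mulrDr hA0 mulr0 addr0.
  rewrite (aform_suml hom) (aform_sumr hom) -big_split -sumrN /=; apply: eq_bigr => k _.
  rewrite (aform_suml hom) (aform_sumr hom) -big_split -sumrN /=; apply: eq_bigr => j _.
  by rewrite (aformZl hom) (aformZr hom) -mulrDr hB; ring.
have -> : om (m v) (m w) = \sum_k \sum_j z k * z j * om (A k v) (A j w).
  rewrite /m (aform_suml hom); apply: eq_bigr => k _.
  rewrite (aformZl hom) (aform_sumr hom) mulr_sumr; apply: eq_bigr => j _.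
  by rewrite (aformZr hom) mulrA.
have -> : \sum_k \sum_j zz k j * (om (A k v) (A j w) + om (A j v) (A k w)) =
   \sum_k \sum_j (zz k j + zz j k) * om (A k v) (A j w).
  under eq_bigr do under eq_bigr do rewrite mulrDr.
  under [RHS]eq_bigr do under eq_bigr do rewrite mulrDl.
  under eq_bigr do rewrite big_split /=.
  under [RHS]eq_bigr do rewrite big_split /=.
  rewrite !big_split /=; congr (_ + _); rewrite exchange_big /=.
  by apply: eq_bigr => k _; apply: eq_bigr.
under eq_bigr do under eq_bigr do rewrite hz.
by rewrite addNr.
Qed.

End FormExpansion.

Section Conservation.
Variables (R : realType) (E : normedModType R) (n K : nat).
Variables (c : 'I_n -> E -> R) (e : 'I_n -> E).
Hypothesis hE : coordinates c e.
Variables (om : E -> E -> R) (Com : R).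
Hypotheses (hom : alternating_form om Com) (Com0 : 0 <= Com).
Variables (alpha t0 t1 : R) (Z : R -> 'rV[R]_K) (ZZ : R -> R -> 'M[R]_K) (CZ : R).
Hypothesis halpha : 3^-1 < alpha <= 2^-1.
Hypotheses (CZ0 : 0 <= CZ) (hb : rough_path_bound alpha t0 t1 Z ZZ CZ).
Hypothesis hc : chen t0 t1 Z ZZ.
Hypothesis hgeo : forall s t, t0 <= s -> s <= t -> t <= t1 ->
  forall k j, ZZ s t k j + ZZ s t j k = (Z t - Z s) 0 k * (Z t - Z s) 0 j.
Variables (H : E -> R) (Hs : 'I_K -> E -> R) (V : 'I_K -> E -> E) (V0 : E -> E).
Hypotheses (hH : smooth_on setT H) (hHs : forall j, smooth_on setT (Hs j)).
Hypotheses (hV : forall j, smooth_field c (V j)) (hV0 : smooth_field c V0).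
Hypotheses (HV : forall j, hamiltonian_field om (Hs j) (V j)).
Hypothesis (HV0 : hamiltonian_field om H V0).

Local Notation F := (fun k j x => 'd (V j) x (V k x)).
Local Notation Rem := (davie_rem Z ZZ V F V0).

Variables (phi : R -> E -> E) (D : set E) (x0 : E) (rho : R).
Hypotheses (oD : open D) (Dx0 : D x0).
Hypothesis dphi : forall t, t0 <= t -> t <= t1 -> differentiable (phi t) x0.
Hypothesis hrho : forall t, t0 <= t -> t <= t1 -> `|phi t x0| <= rho.
Hypothesis hdavie : forall z, D z -> exists2 C, 0 <= C &
  forall s t, t0 <= s -> s <= t -> t <= t1 ->
    `|phi t z - phi s z| <= C * hpow alpha (t - s) /\
    `|Rem (phi^~ z) s t| <= C * hpow alpha (t - s) ^+ 3.

Local Notation J t v := ('d (phi t) x0 v).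

(** The constant C bounds the terms of order 1 and 2 in the expansion of J, for
    vectors of norm at most 2; what is left by the cancellations is of order 3. *)
Lemma form_increment_bound : exists2 C, 0 <= C & forall M s t v w,
  0 <= M -> t0 <= s -> s <= t -> t <= t1 -> t - s <= 1 ->
  `|J s v| <= 2 -> `|J t v| <= 2 -> `|J s w| <= 2 -> `|J t w| <= 2 ->
  `|linearized_rem Z ZZ V V0 phi x0 v s t| <= M * hpow alpha (t - s) ^+ 3 ->
  `|linearized_rem Z ZZ V V0 phi x0 w s t| <= M * hpow alpha (t - s) ^+ 3 ->
  `|om (J t v) (J t w) - om (J s v) (J s w)|
     <= Com * (2 * M + (2 + M) * M + 3 * C ^+ 2) * hpow alpha (t - s) ^+ 3.
Proof.
have [C1 C10 H1] : exists2 C, 0 <= C & forall j, field_bounds C rho (V j).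
  apply: exists_common_bound => [j C C'|j]; first exact: field_bounds_mono.
  exact: (smooth_field_bounds hE _ (hV j)).
have [C2 C20 H2] : exists2 C, 0 <= C & forall kj : 'I_K * 'I_K,
    field_bounds C rho (fun x => 'd (V kj.2) x (V kj.1 x)).
  apply: exists_common_bound => [j C C'|[k j]]; first exact: field_bounds_mono.
  exact: (smooth_field_bounds hE _ (smooth_field_directional hE (hV j) (hV k))).
have [C3 C30 H3] := smooth_field_bounds hE rho hV0.
have le1 : C1 <= C1 + C2 + C3 by rewrite -addrA lerDl addr_ge0.
have le2 : C2 <= C1 + C2 + C3 by rewrite addrAC lerDr addr_ge0.
have le3 : C3 <= C1 + C2 + C3 by rewrite lerDr addr_ge0.
pose L := 2 * (C1 + C2 + C3).
have L0 : 0 <= L by rewrite mulr_ge0// !addr_ge0.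
pose C := K%:R * (CZ * L) + (K%:R * K%:R * (CZ * L) + L).
have CL : 0 <= CZ * L by exact: mulr_ge0.
have KL : 0 <= K%:R * (CZ * L) by exact: mulr_ge0.
have KKL : 0 <= K%:R * K%:R * (CZ * L) by apply: mulr_ge0 => //; exact: mulr_ge0.
have C0 : 0 <= C by apply: addr_ge0 => //; exact: addr_ge0.
exists C => // M s t v w M0 s0 st tt1 ts1 sv tv sw tw rv rw.
have s1 := le_trans st tt1.
have xr := hrho s0 s1.
have ts : 0 <= t - s <= 1 by rewrite subr_ge0 st.
have p0 := hpow_ge0 alpha (t - s); have p1 := hpow_le1 halpha ts.
have ptau := le_hpow_sq halpha ts.
set p := hpow alpha (t - s) in p0 p1 ptau rv rw *.
have p20 : 0 <= p ^+ 2 by exact: exprn_ge0.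
pose m u := \sum_(j < K) (Z t - Z s) 0 j *: 'd (V j) (phi s x0) u.
pose n2 u := \sum_(k < K) \sum_(j < K) ZZ s t k j *: 'd (F k j) (phi s x0) u
  + (t - s) *: 'd V0 (phi s x0) u.
have decomp u : J t u = J s u + m (J s u) + n2 (J s u) + linearized_rem Z ZZ V V0 phi x0 u s t.
  rewrite /linearized_rem /germ -/(m (J s u)) -(addrA (m _)) -/(n2 (J s u)).
  by rewrite -(addrA (J s u)) [RHS]addrC -(addrA (J t u)) -opprD -addrA addNr addr0.
have lin (f : E -> E) (Cf : R) u : field_bounds Cf rho f -> 0 <= Cf -> Cf <= C1 + C2 + C3 ->
    `|u| <= 2 -> `|'d f (phi s x0) u| <= L.
  move=> hf Cf0 CfL u2; apply: le_trans (fb_diff hf u xr) _.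
  by rewrite /L mulrC ler_pM.
have mn u : `|u| <= 2 -> `|m u| <= C * p /\ `|n2 u| <= C * p ^+ 2.
  move=> u2.
  have l1 j : `|'d (V j) (phi s x0) u| <= L by exact: (lin (V j) C1 u (H1 j) C10 le1 u2).
  have l2 k j : `|'d (F k j) (phi s x0) u| <= L by exact: (lin (F k j) C2 u (H2 (k, j)) C20 le2 u2).
  have l3 : `|'d V0 (phi s x0) u| <= L by exact: (lin V0 C3 u H3 C30 le3 u2).
  have [g1 g2] := @le_germ R K alpha t0 t1 Z ZZ E (fun r j => 'd (V j) (phi s x0) u)
    (fun r k j => 'd (F k j) (phi s x0) u) CZ L s t CZ0 L0 hb s0 st tt1 l1 l2.
  split.
    apply: le_trans g1 _; rewrite ler_wpM2r// lerDl addr_ge0//.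
  apply: le_trans (ler_normD _ _) _.
  have g3 : `|(t - s) *: 'd V0 (phi s x0) u| <= L * p ^+ 2.
    rewrite normrZ mulrC ger0_norm ?subr_ge0//; apply: ler_pM => //.
    by rewrite subr_ge0.
  apply: le_trans (lerD g2 g3) _; rewrite -mulrDl ler_wpM2r// lerDr//.
have [m1 m2] := mn _ sv; have [m3 m4] := mn _ sw.
have [q1 q2] := @form_second_order R E om Com hom K (fun j => (Z t - Z s) 0 j)
  (fun k j => ZZ s t k j) (t - s) (fun j => 'd (V j) (phi s x0))
  (fun k j => 'd (F k j) (phi s x0)) ('d V0 (phi s x0)) (J s v) (J s w)
  (hgeo s0 st tt1)
  (fun j => diff_field_sp hE hom _ _ _ (hHs j) (hV j) (HV j))
  (diff_field_sp hE hom _ _ _ hH hV0 HV0)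
  (fun k j => form_directional_sp hE hom (hHs j) (hHs k) (hV j) (hV k) (HV j) (HV k) _ _ _).
have tv2 := tv; have tw2 := tw; rewrite (decomp v) in tv2; rewrite (decomp w) in tw2.
rewrite (decomp v) (decomp w) (form_expansion hom) -/(m _) -/(n2 _).
move: q1 q2; rewrite /= -/(m (J s v)) -/(m (J s w)) -/(n2 (J s v)) -/(n2 (J s w)) => -> ->.
rewrite !add0r.
exact: (form_remainder_bound hom M0 C0 p0 p1 Com0 m1 m3 m2 m4 rv rw tv2 tw2).
Qed.

(** The vectors are first scaled so that J a v and J a w have norm less than 1,
    which is harmless for a bilinear identity. *)
Lemma form_conserved_short : exists2 h, 0 < h & forall a b v w,
  t0 <= a -> a <= b -> b <= t1 -> b - a <= h ->
  om (J b v) (J b w) = om (J a v) (J a w).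
Proof.
have [C C0 HC] := form_increment_bound.
have [h /andP[h0 h1] [M M0 HM]] := flow_derivative_bound hE halpha CZ0 hb hc hV hV0 oD Dx0
  dphi hrho hdavie.
exists h; first exact: h0.
move=> a b v w ta ab bt bah; pose kap := (`|J a v| + `|J a w| + 1)^-1.
have N0 : 0 < `|J a v| + `|J a w| + 1 by rewrite ltr_wpDl// addr_ge0.
have kap0 : 0 < kap by rewrite invr_gt0.
have sc t u : J t (kap *: u) = kap *: J t u by exact: linearZ.
have scale u : `|J a u| <= `|J a v| + `|J a w| -> `|J a (kap *: u)| < 1.
  move=> hu; rewrite sc normrZ gtr0_norm// /kap mulrC ltr_pdivrMr// mul1r.
  by apply: le_lt_trans hu _; rewrite ltrDl.
have sv : `|J a (kap *: v)| < 1 by apply: scale; rewrite lerDl.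
have sw : `|J a (kap *: w)| < 1 by apply: scale; rewrite lerDr.
have P0 : 0 <= Com * (2 * M + (2 + M) * M + 3 * C ^+ 2).
  by rewrite mulr_ge0// !addr_ge0// mulr_ge0// ?addr_ge0// sqr_ge0.
have := @superlinear_constant R alpha
  (fun t => om (J t (kap *: v)) (J t (kap *: w))) a b _ halpha P0 ab.
have step : forall s t, a <= s -> s <= t -> t <= b ->
  `|om (J t (kap *: v)) (J t (kap *: w)) - om (J s (kap *: v)) (J s (kap *: w))|
  <= Com * (2 * M + (2 + M) * M + 3 * C ^+ 2) * hpow alpha (t - s) ^+ 3.
  move=> s t as_ st tb.
  have [v1 v2] := HM a b ta ab bt bah _ sv s t as_ st tb.
  have [w1 w2] := HM a b ta ab bt bah _ sw s t as_ st tb.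
  have [v3 _] := HM a b ta ab bt bah _ sv t t (le_trans as_ st) (lexx _) tb.
  have [w3 _] := HM a b ta ab bt bah _ sw t t (le_trans as_ st) (lexx _) tb.
  apply: HC => //.
  - exact: le_trans as_.
  - exact: le_trans bt.
  - by apply: le_trans h1; apply: le_trans bah; exact: lerB.
move=> /(_ step).
exact: (aform_scale hom (lt0r_neq0 kap0) (sc b v) (sc b w) (sc a v) (sc a w)).
Qed.

Lemma form_conserved v w : t0 <= t1 ->
  om (J t1 v) (J t1 w) = om (J t0 v) (J t0 w).
Proof.
move=> t01; have [h h0 Hh] := form_conserved_short.
suff P (m : nat) t : t0 <= t -> t <= t1 -> t <= t0 + m%:R * h ->
    om (J t v) (J t w) = om (J t0 v) (J t0 w).
  apply: (P (Num.truncn ((t1 - t0) / h)).+1) => //.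
  by rewrite -lerBlDl -ler_pdivrMr//; apply: ltW; exact: truncnS_gt.
elim: m t => [|m IH] t tt0 tt1.
  by rewrite mul0r addr0 => ht; have -> : t = t0 by apply/eqP; rewrite eq_le ht tt0.
move=> tm; have [tm'|tm'] := leP t (t0 + m%:R * h); first exact: IH.
rewrite -(IH (t0 + m%:R * h)); last by [].
- apply: Hh => //; [by rewrite lerDl mulr_ge0// ltW|exact: ltW|].
  by move: tm; rewrite -[m.+1]addn1 natrD mulrDl mul1r addrA; lra.
- by rewrite lerDl mulr_ge0// ltW.
- by apply: le_trans tt1; exact: ltW.
Qed.

End Conservation.

(** * The canonical form on phase space *)

Section CanonicalForm.
Variables (R : realType) (N : nat).
Local Notation E := (phase R N).

Definition canonical_form (v w : E) : R :=
  \sum_(i < N) (v.2 0 i * w.1 0 i - w.2 0 i * v.1 0 i).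

Lemma canonical_form_alternating : alternating_form canonical_form (N%:R * 2).
Proof.
split.
- move=> w a u v; rewrite /canonical_form mulr_sumr -big_split /=.
  by apply: eq_bigr => i _; rewrite !mxE; ring.
- by move=> u v; rewrite /canonical_form -sumrN; apply: eq_bigr => i _; rewrite opprB.
- move=> u v; have hE := @phase_coordinates R N.
  have l1 (w : E) i : `|w.1 0 i| <= `|w| by rewrite -phase_coordl; exact: (coord_le hE).
  have l2 (w : E) i : `|w.2 0 i| <= `|w| by rewrite -phase_coordr; exact: (coord_le hE).
  rewrite -mulrA; apply: ler_norm_sum_const => i.
  apply: le_trans (ler_normB _ _) _; rewrite !normrM.
  have h1 := ler_pM (normr_ge0 _) (normr_ge0 _) (l2 u i) (l1 v i).
  have h2 := ler_pM (normr_ge0 _) (normr_ge0 _) (l2 v i) (l1 u i).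
  by apply: le_trans (lerD h1 h2) _; rewrite [`|v| * _]mulrC -mulr2n mulr_natl.
Qed.

Lemma ham_hamiltonian_field (H : E -> R) : smooth_on setT H ->
  hamiltonian_field canonical_form H (ham H).
Proof.
move=> hH x w; have dH := smooth_differentiable hH (I : setT x).
rewrite (diff_expand (@phase_coordinates R N)) big_split_ord /= opprD /canonical_form.
rewrite -!sumrN -big_split /=; apply: eq_bigr => i _.
rewrite phase_coordl phase_coordr /phase_basis (unsplitK (inl i)) (unsplitK (inr i)).
rewrite !mxE !deriveE// /GRing.scale /=; ring.
Qed.

Lemma dp_wedge_dq_form (V : normedModType R) (f : V -> E) x v w :
  differentiable f x ->
  dp_wedge_dq (fun y => (f y).2) (fun y => (f y).1) x v w
    = canonical_form ('d f x v) ('d f x w).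
Proof.
move=> df; rewrite /dp_wedge_dq /canonical_form; apply: eq_bigr => i _.
have hE := @phase_coordinates R N.
have c1 u : 'd (fun y => (f y).1 0 i) x u = ('d f x u).1 0 i.
  have -> : (fun y => (f y).1 0 i) = (fun y => phase_coord (lshift N i) (f y)).
    by apply/funext => y; rewrite phase_coordl.
  exact: etrans (esym (coord_of_diff hE u (lshift N i) df)) (phase_coordl _ _).
have c2 u : 'd (fun y => (f y).2 0 i) x u = ('d f x u).2 0 i.
  have -> : (fun y => (f y).2 0 i) = (fun y => phase_coord (rshift N i) (f y)).
    by apply/funext => y; rewrite phase_coordr.
  exact: etrans (esym (coord_of_diff hE u (rshift N i) df)) (phase_coordr _ _).
by congr (_ * _ - _ * _); [exact: c2|exact: c1|exact: c2|exact: c1].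
Qed.

Lemma omegaE (x v w : E) : omega x v w = canonical_form v w.
Proof.
rewrite /omega; have did : differentiable (@id E) x by [].
by rewrite (dp_wedge_dq_form v w did) diff_id_apply diff_id_apply.
Qed.

End CanonicalForm.

Section Flow.
Variables (R : realType) (N K : nat) (alpha t0 t1 : R).
Variables (Z : R -> 'rV[R]_K) (ZZ : R -> R -> 'M[R]_K).
Variables (H : phase R N -> R) (Hs : 'I_K -> phase R N -> R).
Hypotheses (halpha : 3^-1 < alpha <= 2^-1) (ht : t0 < t1).
Hypothesis hZ : geometric_rough_path alpha t0 t1 Z ZZ.
Hypotheses (hH : smooth_on setT H) (hHs : forall j, smooth_on setT (Hs j)).
Variables (Phi : R -> R -> phase R N -> phase R N) (D : set (phase R N)).
Hypothesis hD : local_flow_at alpha t0 t1 Z ZZ H Hs Phi t0 D.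

Lemma flow_differentiable t x : t0 <= t -> t <= t1 -> D x -> differentiable (Phi t t0) x.
Proof.
by move=> h1 h2 Dx; have [_ _ h _] := flow_diffeo hD h1 h2; exact: smooth_differentiable h Dx.
Qed.

Lemma flow_domain_open : open D.
Proof. by have [] := flow_diffeo hD (lexx t0) (ltW ht). Qed.

(** At time t0 the flow is the identity near x, and the form is conserved from there
    on. *)
Lemma flow_symplectic x v w : D x ->
  canonical_form ('d (Phi t1 t0) x v) ('d (Phi t1 t0) x w) = canonical_form v w.
Proof.
move=> Dx; have oD := flow_domain_open.
have [[CZ CZ0 hb] hc] := geometric_rough_path_bound hZ.
have hsol z : D z -> rough_hamilton_solution alpha t0 t1 Z ZZ H Hs (fun t => Phi t t0 z).
  by move=> /(flow_exists hD) [].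
have hdav z (Dz : D z) := solution_davie halpha hH hHs CZ0 hb hc (hsol z Dz).
have [rho hrho _] := hdav x Dx.
have hgeo s t : t0 <= s -> s <= t -> t <= t1 ->
    forall k j, ZZ s t k j + ZZ s t j k = (Z t - Z s) 0 k * (Z t - Z s) 0 j.
  move=> h1 h2 h3 k j; have /matrixP /(_ k j) := rough_path_geometric hZ h1 h2 h3.
  by rewrite mxE [X in _ + X]mxE => ->; rewrite mxE big_ord1 mxE.
have t00 : forall u, 'd (Phi t0 t0) x u = u.
  move=> u; rewrite -[RHS](diff_id_apply x u).
  apply: diff_near_eq => //; first exact: (flow_differentiable (lexx _) (ltW ht) Dx).
  have : nbhs x D by exact: open_nbhs_nbhs.
  by apply: filterS => y Dy; have [_ ->] := flow_exists hD Dy.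
rewrite -[in RHS](t00 v) -[in RHS](t00 w).
have dphi t : t0 <= t -> t <= t1 -> differentiable (Phi t t0) x.
  by move=> h1 h2; exact: flow_differentiable.
have hdavie z : D z -> exists2 C, 0 <= C & forall s t, t0 <= s -> s <= t -> t <= t1 ->
    `|Phi t t0 z - Phi s t0 z| <= C * hpow alpha (t - s) /\
    `|ham_rem Z ZZ H Hs (fun t => Phi t t0 z) s t| <= C * hpow alpha (t - s) ^+ 3.
  by move=> Dz; have [? _ [C C0 HC]] := hdav z Dz; exists C.
have N2 : 0 <= N%:R * 2 :> R by rewrite mulr_ge0.
exact: (form_conserved (@phase_coordinates R N) (@canonical_form_alternating R N) N2
  halpha CZ0 hb hc hgeo hH hHs (fun j => ham_smooth (hHs j)) (ham_smooth hH)
  (fun j => ham_hamiltonian_field (hHs j)) (ham_hamiltonian_field hH) oD Dx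
  (phi := fun t => Phi t t0) dphi hrho hdavie _ _ (ltW ht)).
Qed.

End Flow.

Theorem corollary2p2 (R : realType) (N K : nat) (alpha t0 t1 : R)
  (Z : R -> 'rV[R]_K) (ZZ : R -> R -> 'M[R]_K)
  (H : phase R N -> R) (Hs : 'I_K -> phase R N -> R)
  (Phi : R -> R -> phase R N -> phase R N)
  (U : set (phase R N)) (sol : phase R N -> R -> phase R N)
  (halpha : 3^-1 < alpha <= 2^-1) (ht : t0 < t1)
  (hZ : geometric_rough_path alpha t0 t1 Z ZZ)
  (hH : smooth_on setT H) (hHs : forall j, smooth_on setT (Hs j))
  (hPhi : solution_flow_near_branch alpha t0 t1 Z ZZ H Hs Phi U sol)
  (hsol : nondegenerate_branch alpha t0 t1 Z ZZ H Hs Phi U sol) :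
  (forall ab, U ab -> forall v w : phase R N,
     dp_wedge_dq (fun y => (sol y t0).2) (fun y => (sol y t0).1) ab v w =
     dp_wedge_dq (fun y => (sol y t1).2) (fun y => (sol y t1).1) ab v w) /\
  (forall ab, U ab -> \forall x \near sol ab t0, forall v w : phase R N,
     pullback (Phi t1 t0) (@omega R N) x v w = @omega R N x v w).
Proof.
split=> ab Uab; last first.
  have [D Dab hD] := hPhi ab Uab t0 (lexx _) (ltW ht).
  have oD := flow_domain_open ht hD.
  have : nbhs (sol ab t0) D by exact: open_nbhs_nbhs.
  apply: filterS => x Dx v w; rewrite /pullback !omegaE.
  exact: (flow_symplectic halpha ht hZ hH hHs hD).
move=> v w.
have [D Dab hD] := hPhi ab Uab t0 (lexx _) (ltW ht).
have oD := flow_domain_open ht hD.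
have d0 : differentiable (fun y => sol y t0) ab.
  exact: smooth_differentiable (branch_smooth hsol (lexx _) (ltW ht)) Uab.
have d1 : differentiable (fun y => sol y t1) ab.
  exact: smooth_differentiable (branch_smooth hsol (ltW ht) (lexx _)) Uab.
rewrite (dp_wedge_dq_form v w d0) (dp_wedge_dq_form v w d1).
have dPhi := flow_differentiable hD (ltW ht) (lexx _) Dab.
have J u : 'd (fun y => sol y t1) ab u = 'd (Phi t1 t0) (sol ab t0) ('d (fun y => sol y t0) ab u).
  apply: (diff_near_comp u d0 dPhi d1).
  have nU : nbhs ab U by apply: open_nbhs_nbhs; split => //; exact: branch_open hsol.
  have nD : nbhs ab (fun y => D (sol y t0)).
    by apply: (differentiable_continuous d0); exact: open_nbhs_nbhs.
  near=> y; apply: (flow_unique hD) => //; [|by near: y|exact: ltW].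
  by apply: (branch_solution hsol); near: y.
have Phi_symp := flow_symplectic halpha ht hZ hH hHs hD
  ('d (fun y => sol y t0) ab v) ('d (fun y => sol y t0) ab w) Dab.
exact: etrans (esym Phi_symp) (f_equal2 (@canonical_form R N) (esym (J v)) (esym (J w))).
Unshelve. all: by end_near. Qed.
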